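(* Let $(\mathcal G_t)_{t\in(\varepsilon_-,\varepsilon_+)}$, $0\in(\varepsilon_-,\varepsilon_+)$, be a left-invariant solution of the generalized Ricci flow on a left-invariant exact Courant algebroid $E$ over a simply connected Lie group $\mathsf G$, defined on its maximal time interval, and let $\mathcal S_t$ denote the generalized scalar curvature of $\mathcal G_t$. Then: (1) if $\varepsilon_+<\infty$, then $\mathcal S_t\to\infty$ as $t\to\varepsilon_+$; (2) if $\varepsilon_->-\infty$, then $\mathcal S_t\to-\infty$ as $t\to\varepsilon_-$.
   Context: After choosing the splitting determined by $\mathcal G_0$, such a solution is equivalent to a family $(g_t,b_t)$ of left-invariant Riemannian metrics and left-invariant 2-forms on $\mathsf G$, together with a closed left-invariant 3-form $H_0$, satisfying, with $H_t=H_0+\mathrm db_t$ and $b_0=0$, $$\tfrac{\partial}{\partial t}g_t=-2\operatorname{Ric}(g_t)+\tfrac12(H_t)^2_{g_t},\qquad\tfrac{\partial}{\partial t}b_t=-\mathrm d^*_{g_t}H_t .$$ This is an ODE on left-invariant tensors, and the maximal interval is that of the ODE. Here $H_g^2(X,Y)=\sum_{i,j}H(X,e_i,e_j)H(Y,e_i,e_j)$ for a $g$-orthonormal frame and $\mathrm d_g^*$ is the usual codifferential. The generalized scalar curvature is the (constant in space) function $\mathcal S_t=\mathrm R_{g_t}-\frac1{12}|H_t|^2_{g_t}$, where $\mathrm R_g$ is the scalar curvature and $|H|_g^2=\sum_{i,j,k}H(e_i,e_j,e_k)^2$ (sum over all indices). *)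

(* Defs.v *)
From HB Require Import structures.
From mathcomp Require Import all_boot all_order all_algebra.
From mathcomp Require Import all_classical all_reals all_analysis.
From mathcomp Require Import ring lra.

Set Implicit Arguments.
Unset Strict Implicit.
Unset Printing Implicit Defensive.

Import Order.TTheory GRing.Theory Num.Theory.
Import numFieldNormedType.Exports.

Local Open Scope classical_set_scope.
Local Open Scope ring_scope.

(* A simply connected Lie group is represented by its Lie algebra, a finite-
   dimensional real vector space V with a Lie bracket; left-invariant tensors
   are multilinear maps on V, and left-invariant vector fields are elements of
   V, with br X Y = [X, Y].                                                   *)

Definition lie_bracket (R : realType) (V : vectType R) (br : V -> V -> V)
    : Prop :=
  [/\ bilinear_for *:%R *:%R br,
      forall X, br X X = 0
    & forall X Y Z, br X (br Y Z) + br Y (br Z X) + br Z (br X Y) = 0].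

Definition metric (R : realType) (V : vectType R) (g : V -> V -> R) : Prop :=
  [/\ bilinear_for *%R *%R g,
      forall X Y, g X Y = g Y X
    & forall X, X != 0 -> 0 < g X X].

Definition two_form (R : realType) (V : vectType R) (b : V -> V -> R) : Prop :=
  bilinear_for *%R *%R b /\ forall X, b X X = 0.

Definition three_form (R : realType) (V : vectType R)
    (H : V -> V -> V -> R) : Prop :=
  [/\ forall X, bilinear_for *%R *%R (H X),
      forall Y Z, scalar (fun X => H X Y Z),
      forall X Y, H X X Y = 0
    & forall X Y, H X Y Y = 0].

(* Exterior derivatives of left-invariant forms: in the invariant formula for
   d, the terms differentiating the (constant) component functions vanish.    *)

Definition d2 (R : realType) (V : vectType R) (br : V -> V -> V)
    (b : V -> V -> R) (X Y Z : V) : R :=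
  - b (br X Y) Z + b (br X Z) Y - b (br Y Z) X.

Definition d3 (R : realType) (V : vectType R) (br : V -> V -> V)
    (H : V -> V -> V -> R) (W X Y Z : V) : R :=
  - H (br W X) Y Z + H (br W Y) X Z - H (br W Z) X Y
  - H (br X Y) W Z + H (br X Z) W Y - H (br Y Z) W X.

Definition orthonormal (R : realType) (V : vectType R) (g : V -> V -> R)
    (e : (\dim {:V}).-tuple V) : Prop :=
  forall i j : 'I_(\dim {:V}), g e`_i e`_j = (i == j)%:R.

(* A chosen g-orthonormal frame; it exists by onframeP below, and the tensors
   defined with it do not depend on the choice.                               *)
Definition onframe (R : realType) (V : vectType R) (g : V -> V -> R)
    : (\dim {:V}).-tuple V :=
  xget [tuple 0 | i < \dim {:V}] [set e | orthonormal g e].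

Lemma onframeP (R : realType) (V : vectType R) (g : V -> V -> R) :
  metric g -> orthonormal g (onframe g).
Proof.
move=> [[gl gr] gs gp].
have gDl Y X a X' : g (a *: X + X') Y = a * g X Y + g X' Y by exact: gl.
have g0l Y : g 0 Y = 0.
  by have := gDl Y 0 (-1) 0; rewrite scaler0 addr0 mulN1r addNr.
have gZl a X Y : g (a *: X) Y = a * g X Y.
  by have := gDl Y X a 0; rewrite !addr0 g0l addr0.
have gAl X X' Y : g (X + X') Y = g X Y + g X' Y.
  by have := gDl Y X 1 X'; rewrite scale1r mul1r.
have gsuml (I : finType) (F : I -> V) Y :
    g (\sum_i F i) Y = \sum_i g (F i) Y.
  by elim/big_rec2: _ => [|i y1 y2 _ <-] //; rewrite gAl.
have step k : (k <= \dim {:V})%N ->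
    exists s : k.-tuple V, forall i j : 'I_k, g s`_i s`_j = (i == j)%:R.
  elim: k => [_|k IHk ltk]; first by exists [tuple]; case.
  have [s sP] := IHk (ltnW ltk).
  have [v vNs] : exists v, v \notin span s.
    apply: contrapT => /forallNP vs.
    have : (\dim {:V} <= \dim (span s))%N.
      by apply: dimvS; apply/subvP => v _; apply: contrapT => /negP; exact: vs.
    have := dim_span s; rewrite size_tuple => /[swap] /leq_trans/[apply].
    by rewrite leqNgt ltk.
  pose w := v - \sum_(i < k) g v s`_i *: s`_i.
  have w0 : w != 0.
    apply: contra vNs; rewrite subr_eq0 => /eqP ->.
    apply: rpred_sum => i _; apply/rpredZ/memv_span/mem_nth.
    by rewrite size_tuple.
  have ws (j : 'I_k) : g w s`_j = 0.
    rewrite /w gAl -scaleN1r gZl gsuml (bigD1 j) //= gZl sP eqxx mulr1.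
    by rewrite big1 ?addr0 ?mulN1r ?subrr// => i /negPf ij; rewrite gZl sP ij mulr0.
  pose c := (Num.sqrt (g w w))^-1.
  have cw : c * (c * g w w) = 1.
    rewrite mulrA -expr2 /c exprVn sqr_sqrtr ?ltW ?gp// mulVf//.
    by rewrite gt_eqF// gp.
  exists [tuple of rcons s (c *: w)] => i j; rewrite /= !nth_rcons size_tuple.
  have nk (l : 'I_k.+1) : ~~ (l < k)%N -> nat_of_ord l = k.
    by rewrite -leqNgt => kl; apply/anti_leq; rewrite kl -ltnS ltn_ord.
  case: (boolP (i < k)%N) => ik; case: (boolP (j < k)%N) => jk.
  - by rewrite (sP (Ordinal ik) (Ordinal jk)).
  - rewrite (nk _ jk) eqxx gs gZl (ws (Ordinal ik)) mulr0.
    by rewrite -val_eqE /= (nk _ jk) ltn_eqF.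
  - rewrite (nk _ ik) eqxx gZl (ws (Ordinal jk)) mulr0.
    by rewrite -val_eqE /= (nk _ ik) gtn_eqF.
  - rewrite (nk _ ik) (nk _ jk) eqxx gZl gs gZl cw.
    by rewrite -val_eqE /= (nk _ ik) (nk _ jk) eqxx.
have [s sP] := step _ (leqnn _).
rewrite /onframe; case: xgetP => [e _ //|/(_ s)]; by case.
Qed.

(* g (nabla_X Y) Z for left-invariant X, Y, Z, by the Koszul formula.         *)
Definition koszul (R : realType) (V : vectType R) (br : V -> V -> V)
    (g : V -> V -> R) (X Y Z : V) : R :=
  2^-1 * (g (br X Y) Z - g (br Y Z) X + g (br Z X) Y).

Definition levi_civita (R : realType) (V : vectType R) (br : V -> V -> V)
    (g : V -> V -> R) (X Y : V) : V :=
  \sum_(i < \dim {:V}) koszul br g X Y (onframe g)`_i *: (onframe g)`_i.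

(* levi_civita is the metric, torsion-free connection.                        *)
Lemma levi_civitaE (R : realType) (V : vectType R) (br : V -> V -> V)
    (g : V -> V -> R) (X Y Z : V) :
  lie_bracket br -> metric g -> g (levi_civita br g X Y) Z = koszul br g X Y Z.
Proof.
move=> [[brl brr] bra _] gm; have eP := onframeP gm.
case: gm => [[gl gr] gs gp].
set e := onframe g in eP *.
have gDl Y' X' a X'' : g (a *: X' + X'') Y' = a * g X' Y' + g X'' Y'.
  exact: gl.
have gDr Y' X' a X'' : g Y' (a *: X' + X'') = a * g Y' X' + g Y' X''.
  by rewrite gs gDl !(gs _ Y').
have brDl Y' X' a X'' : br (a *: X' + X'') Y' = a *: br X' Y' + br X'' Y'.
  exact: brl.
have brDr Y' X' a X'' : br Y' (a *: X' + X'') = a *: br Y' X' + br Y' X''.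
  exact: brr.
pose f1 (W : V) := koszul br g X Y W.
have f1D a W W' : f1 (a *: W + W') = a * f1 W + f1 W'.
  rewrite /f1 /koszul brDl brDr !gDl !gDr; ring.
have lin0 (f : V -> R) : (forall a W W', f (a *: W + W') = a * f W + f W') ->
    forall (c : 'I_(\dim {:V}) -> R),
    f (\sum_i c i *: e`_i) = \sum_i c i * f e`_i.
  move=> fD c; have f0 : f 0 = 0.
    by have := fD (-1) 0 0; rewrite scaler0 addr0 mulN1r addNr.
  by elim/big_rec2: _ => [|i y1 y2 _ <-]//; rewrite fD.
have fe : free e.
  apply/freeP => c; move/(congr1 (g^~ _)) => c0 i.
  have := c0 e`_i; rewrite (lin0 (g^~ e`_i)); last by move=> *; exact: gDl.
  have -> : g 0 e`_i = 0.
    by have := gDl e`_i 0 (-1) 0; rewrite scaler0 addr0 mulN1r addNr.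
  rewrite (bigD1 i)//= eP eqxx mulr1 big1 ?addr0// => j /negPf ji.
  by rewrite eP ji mulr0.
have be : basis_of fullv e by rewrite basisEfree fe subvf size_tuple leqnn.
have -> : Z = \sum_i coord e i Z *: e`_i by exact: (coord_basis be (memvf Z)).
rewrite -/(f1 _) (lin0 f1)// (lin0 (g _)); last by move=> *; exact: gDr.
apply: eq_bigr => i _; congr (_ * _).
rewrite /levi_civita -/e (lin0 (g^~ e`_i)); last by move=> *; exact: gDl.
rewrite (bigD1 i)//= eP eqxx mulr1 big1 ?addr0// => j /negPf ji.
by rewrite eP ji mulr0.
Qed.

Lemma levi_civita_metric (R : realType) (V : vectType R) (br : V -> V -> V)
    (g : V -> V -> R) (X Y Z : V) : lie_bracket br -> metric g ->
  g (levi_civita br g X Y) Z + g Y (levi_civita br g X Z) = 0.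
Proof.
move=> hbr hg; have [[brl brr] bra _] := hbr; have [[gl gr] gs gp] := hg.
rewrite (gs Y) !levi_civitaE// /koszul.
have brN A B : br A B = - br B A.
  apply/eqP; rewrite -addr_eq0; apply/eqP.
  have brDl Y' X' a X'' : br (a *: X' + X'') Y' = a *: br X' Y' + br X'' Y'.
    exact: brl.
  have brDr Y' X' a X'' : br Y' (a *: X' + X'') = a *: br Y' X' + br Y' X''.
    exact: brr.
  have := bra (1 *: A + B); rewrite brDl !brDr !bra !scale1r addr0 add0r.
  by [].
have gN A B : g (- A) B = - g A B.
  have gDl Y' X' a X'' : g (a *: X' + X'') Y' = a * g X' Y' + g X'' Y'.
    exact: gl.
  have g0 : g 0 B = 0.
    by have := gDl B 0 (-1) 0; rewrite scaler0 addr0 mulN1r addNr.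
  by have := gDl B A (-1) 0; rewrite addr0 scaleN1r g0 mulN1r addr0.
rewrite (brN Z X) (brN Y X) (brN Z Y) !gN; ring.
Qed.

Lemma levi_civita_torsion_free (R : realType) (V : vectType R)
    (br : V -> V -> V) (g : V -> V -> R) (X Y : V) :
  lie_bracket br -> metric g ->
  levi_civita br g X Y - levi_civita br g Y X = br X Y.
Proof.
move=> hbr hg; have [[brl brr] bra _] := hbr; have [[gl gr] gs gp] := hg.
have brN A B : br A B = - br B A.
  apply/eqP; rewrite -addr_eq0; apply/eqP.
  have brDl Y' X' a X'' : br (a *: X' + X'') Y' = a *: br X' Y' + br X'' Y'.
    exact: brl.
  have brDr Y' X' a X'' : br Y' (a *: X' + X'') = a *: br Y' X' + br Y' X''.
    exact: brr.
  have := bra (1 *: A + B); rewrite brDl !brDr !bra !scale1r addr0 add0r.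
  by [].
have gDl Y' X' a X'' : g (a *: X' + X'') Y' = a * g X' Y' + g X'' Y'.
  exact: gl.
have gAl A A' B : g (A + A') B = g A B + g A' B.
  by have := gDl B A 1 A'; rewrite scale1r mul1r.
have gN A B : g (- A) B = - g A B.
  have g0 : g 0 B = 0.
    by have := gDl B 0 (-1) 0; rewrite scaler0 addr0 mulN1r addNr.
  by have := gDl B A (-1) 0; rewrite addr0 scaleN1r g0 mulN1r addr0.
apply/eqP; rewrite -subr_eq0; apply/contraT => /gp; set D := (X in g X _).
suff -> : g D D = 0 by rewrite ltxx.
rewrite {1}/D !gAl !gN !levi_civitaE// /koszul.
rewrite (brN Y X) (brN D X) (brN D Y) !gN; by field.
Qed.

Definition curvature (R : realType) (V : vectType R) (br : V -> V -> V)
    (g : V -> V -> R) (X Y Z : V) : V :=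
  let nabla := levi_civita br g in
  nabla X (nabla Y Z) - nabla Y (nabla X Z) - nabla (br X Y) Z.

Definition Ric (R : realType) (V : vectType R) (br : V -> V -> V)
    (g : V -> V -> R) (X Y : V) : R :=
  let e := onframe g in
  \sum_(i < \dim {:V}) g (curvature br g e`_i X Y) e`_i.

Definition scalar_curvature (R : realType) (V : vectType R)
    (br : V -> V -> V) (g : V -> V -> R) : R :=
  let e := onframe g in \sum_(i < \dim {:V}) Ric br g e`_i e`_i.

Definition sqform (R : realType) (V : vectType R) (g : V -> V -> R)
    (H : V -> V -> V -> R) (X Y : V) : R :=
  let e := onframe g in
  \sum_(i < \dim {:V}) \sum_(j < \dim {:V}) H X e`_i e`_j * H Y e`_i e`_j.

Definition sqnorm3 (R : realType) (V : vectType R) (g : V -> V -> R)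
    (H : V -> V -> V -> R) : R :=
  let e := onframe g in
  \sum_(i < \dim {:V}) \sum_(j < \dim {:V}) \sum_(k < \dim {:V})
    H e`_i e`_j e`_k ^+ 2.

(* (nabla_W H)(X, Y, Z)                                                       *)
Definition covariant3 (R : realType) (V : vectType R) (br : V -> V -> V)
    (g : V -> V -> R) (H : V -> V -> V -> R) (W X Y Z : V) : R :=
  let nabla := levi_civita br g in
  - H (nabla W X) Y Z - H X (nabla W Y) Z - H X Y (nabla W Z).

(* d^* H = - tr_g (nabla H). On a non-unimodular group this differs from the
   algebraic adjoint of d on left-invariant forms.                            *)
Definition codiff3 (R : realType) (V : vectType R) (br : V -> V -> V)
    (g : V -> V -> R) (H : V -> V -> V -> R) (X Y : V) : R :=
  let e := onframe g in
  - \sum_(i < \dim {:V}) covariant3 br g H e`_i e`_i X Y.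

Definition flux (R : realType) (V : vectType R) (br : V -> V -> V)
    (H0 : V -> V -> V -> R) (b : V -> V -> R) (X Y Z : V) : R :=
  H0 X Y Z + d2 br b X Y Z.

Definition gen_scalar_curvature (R : realType) (V : vectType R)
    (br : V -> V -> V) (g : V -> V -> R) (H : V -> V -> V -> R) : R :=
  scalar_curvature br g - 12^-1 * sqnorm3 g H.

(* (g, b) solves the generalized Ricci flow on the open interval (em, ep),
   whose endpoints may be infinite; values outside (em, ep) are irrelevant.   *)
Definition gRF_solution (R : realType) (V : vectType R) (br : V -> V -> V)
    (H0 : V -> V -> V -> R) (em ep : \bar R) (g b : R -> V -> V -> R) : Prop :=
  forall t : R, (em < t%:E)%E -> (t%:E < ep)%E ->
  [/\ metric (g t),
      two_form (b t),
      forall X Y, is_derive t 1 (fun s => g s X Y)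
        (- 2 * Ric br (g t) X Y
         + 2^-1 * sqform (g t) (flux br H0 (b t)) X Y)
    & forall X Y, is_derive t 1 (fun s => b s X Y)
        (- codiff3 br (g t) (flux br H0 (b t)) X Y)].

Definition gRF_maximal_solution (R : realType) (V : vectType R)
    (br : V -> V -> V) (H0 : V -> V -> V -> R) (em ep : \bar R)
    (g b : R -> V -> V -> R) : Prop :=
  gRF_solution br H0 em ep g b /\
  forall (em' ep' : \bar R) (g' b' : R -> V -> V -> R),
    (em' <= em)%E -> (ep <= ep')%E ->
    gRF_solution br H0 em' ep' g' b' ->
    (forall t : R, (em < t%:E)%E -> (t%:E < ep)%E ->
       forall X Y, g' t X Y = g t X Y /\ b' t X Y = b t X Y) ->
    em' = em /\ ep' = ep.

(* Main.v *)
(* Along the flow the generalized scalar curvature S satisfies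
   S' = (|g'|^2 + |b'|^2) / 2, so S is monotone.  If it stays bounded near a
   finite end T of the time interval, then log g_t(X,X) and b_t(X,Y) have
   derivatives dominated by C (1 + S'); such a function is a difference of
   monotone functions bounded near T, hence converges.  Thus (g_t, b_t) tends to
   a metric and a 2-form, and Picard's theorem continues the solution past T.

   On a group that is not unimodular, the formula for S' contains divergence
   terms given by the mean curvature vector z (the trace of ad).  They cancel
   because ad z is a derivation, so that the scalar curvature is stationary along
   g |-> L_z g, and because dH = 0 gives L_z H = d (i_z H). *)
Require Import Defs.
From mathcomp Require Import all_boot all_order all_algebra.
From mathcomp Require Import all_classical all_reals all_analysis.
From mathcomp Require Import ring lra.
Set Implicit Arguments.
Unset Strict Implicit.
Unset Printing Implicit Defensive.
Import Order.TTheory GRing.Theory Num.Theory.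
Import numFieldNormedType.Exports.
Local Open Scope classical_set_scope.
Local Open Scope ring_scope.

(** * Ordinary differential equations *)

(** The tensors are defined through [onframe g], a frame obtained by choice, which need not vary
    continuously with g. So before anything can be differentiated in t, or compared for two metrics,
    every trace over the frame is rewritten as a contraction with the inverse Gram matrix in a fixed
    basis. There Ric, H^2, d^*H and S are polynomials in the components of g, of H and of the
    inverse metric. This serves twice: with the frame of time t frozen it yields S', the inverse
    metric being the identity at t; and in a frame of the limit metric it gives a locally Lipschitz
    field for Picard's theorem. The logarithm has two purposes. In an orthonormal frame |g'(X,X)| is
    at most g(X,X) times the sum of the |g'_ij|, so the bound on the derivative of ln g(X,X) is free
    of the factor g(X,X); and a finite limit of ln g(X,X) keeps g(X,X) away from 0, so that the
    limit is definite. As |x| <= 1 + x^2/2, such bounds are affine in S'. For b the bound still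
    contains g(X,X) + g(Y,Y), so the metric has to converge before the 2-form. *)

Lemma is_derive_continuous (R : realType) (f : R -> R) (t d : R) :
  is_derive t 1 f d -> {for t, continuous f}.
Proof. by move=> [fd _]; apply/differentiable_continuous/derivable1_diffP. Qed.

Lemma mean_value (R : realType) (f df : R -> R) (a b : R) : a < b ->
  (forall t, a <= t -> t <= b -> is_derive t 1 f (df t)) ->
  exists2 c, a < c < b & f b - f a = df c * (b - a).
Proof.
move=> ab fd; have [t||c] := @MVT R f df a b ab.
- by rewrite in_itv/= => /andP[/ltW ? /ltW ?]; exact: fd.
- apply: derivable_within_continuous => t; rewrite in_itv/= => /andP[ta tb].
  by have [] := fd t ta tb.
- by rewrite in_itv/= => cab fE; exists c.
Qed.

Lemma derive_lipschitz (R : realType) (f df : R -> R) (a b M : R) :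
  (forall t, a < t -> t < b -> is_derive t 1 f (df t) /\ `|df t| <= M) ->
  forall s t, a < s < b -> a < t < b -> `|f t - f s| <= M * `|t - s|.
Proof.
move=> fd; suff H s t : a < s < b -> a < t < b -> s < t ->
    `|f t - f s| <= M * `|t - s|.
  move=> s t sab tab; have [/H|/H|->] := ltgtP s t; first by apply.
    by rewrite distrC [`|t - s|]distrC; apply.
  by rewrite !subrr normr0 mulr0.
move=> /andP[as_ sb] /andP[at_ tb] st.
have [r rs rt|c /andP[sc ct] ->] := @mean_value R f df s t st.
  by have [] := fd r (lt_le_trans as_ rs) (le_lt_trans rt tb).
have [_ ?] := fd c (lt_trans as_ sc) (lt_trans ct tb).
by rewrite normrM ler_wpM2r.
Qed.

Lemma is_derive_reflect (R : realType) (f : R -> R) (t df : R) :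
  is_derive t 1 f df -> is_derive (- t) 1 (f \o -%R) (- df).
Proof.
move=> fd; rewrite -[- df]mulrN1; apply: is_derive1_comp.
by rewrite opprK.
Qed.

Lemma lipschitz_continuous (R : realType) (f : R -> R) (K : R) :
  (forall s t, `|f t - f s| <= K * `|t - s|) -> continuous f.
Proof.
move=> fK t; apply/cvgrPdist_le => e e0.
have K1 : 0 < `|K| + 1 by rewrite ltr_wpDl.
near=> s.
rewrite (le_trans (fK _ _))// (@le_trans _ _ ((`|K| + 1) * `|t - s|))//.
  by rewrite ler_wpM2r// (le_trans (ler_norm K))// lerDl.
rewrite mulrC -ler_pdivlMr//; near: s.
apply/nbhs_ballP; exists (e / (`|K| + 1)); first exact: divr_gt0.
by move=> s /=; rewrite /ball/= => /ltW.
Unshelve. all: by end_near. Qed.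

Lemma antiderivative (R : realType) (f : R -> R) (a b : R) : continuous f ->
  exists F : R -> R, forall t, a < t -> t < b -> is_derive t 1 F (f t).
Proof.
move=> cf.
exists (fun x => \int[@lebesgue_measure R]_(t in [set` `[a, x]]) f t)%R.
move=> t ta tb.
have fi : (@lebesgue_measure R).-integrable `[a, b] (EFin \o f).
  apply: continuous_compact_integrable; first exact: segment_compact.
  exact: continuous_subspaceT.
have [fd fE] := continuous_FTC1_closed tb fi ta (cf t).
by apply: DeriveDef; [exact: fd|rewrite -derive1E].
Qed.

(** * Locally Lipschitz functions of finitely many variables *)

(** One constant K is both the Lipschitz constant and the inverse of the radius, so that enlarging K
    weakens the condition in both respects and a finite family gets a common K by summation. The
    bound r replaces the sup norm, states being bare functions on a finite type. *)
Definition lip_at (R : realType) (I : finType) (p : I -> R) (K : R)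
    (f : (I -> R) -> R) : Prop :=
  forall x y r, (forall i, `|x i - p i| <= K^-1) ->
    (forall i, `|y i - p i| <= K^-1) -> 0 <= r ->
    (forall i, `|x i - y i| <= r) -> `|f x - f y| <= K * r.

Definition loc_lip (R : realType) (I : finType) (p : I -> R)
    (f : (I -> R) -> R) : Prop := exists2 K, 0 < K & lip_at p K f.

Section loc_lip_closure.
Context {R : realType} {I : finType} (p : I -> R).
Implicit Types (f g : (I -> R) -> R) (K : R).

Lemma lip_atW K K' f : 0 < K -> K <= K' -> lip_at p K f -> lip_at p K' f.
Proof.
move=> K0 KK' fK x y r xp yp r0 xy.
have K'0 : 0 < K' by exact: lt_le_trans KK'.
have KV : K'^-1 <= K^-1 by rewrite lef_pV2.
rewrite (le_trans (fK x y r _ _ r0 xy)) ?ler_wpM2r// => i.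
- exact: le_trans (xp i) KV.
- exact: le_trans (yp i) KV.
Qed.

Lemma loc_lip_cst c : loc_lip p (fun=> c).
Proof. by exists 1 => // x y r _ _ r0 _; rewrite subrr normr0 mul1r. Qed.

Lemma loc_lip_coord i : loc_lip p (fun x => x i).
Proof. by exists 1 => // x y r _ _ _ /(_ i); rewrite mul1r. Qed.

Lemma loc_lip_add f g :
  loc_lip p f -> loc_lip p g -> loc_lip p (fun x => f x + g x).
Proof.
move=> [K K0 fK] [L L0 gL]; exists (K + L); first exact: addr_gt0.
have KL : K <= K + L by rewrite lerDl ltW.
have LK : L <= K + L by rewrite lerDr ltW.
move=> x y r xp yp r0 xy.
rewrite opprD addrACA (le_trans (ler_normD _ _))// mulrDl lerD//.
- apply: fK => // i; rewrite (le_trans (xp i), le_trans (yp i)) ?lef_pV2//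
    ?posrE ?addr_gt0//.
- apply: gL => // i; rewrite (le_trans (xp i), le_trans (yp i)) ?lef_pV2//
    ?posrE ?addr_gt0//.
Qed.

Lemma lip_at_bound K f x : 0 < K -> lip_at p K f ->
  (forall i, `|x i - p i| <= K^-1) -> `|f x - f p| <= 1.
Proof.
move=> K0 fK xp; rewrite -(mulfV (lt0r_neq0 K0)); apply: fK => //.
- by move=> i; rewrite subrr normr0 invr_ge0 ltW.
- by rewrite invr_ge0 ltW.
Qed.

Lemma loc_lip_mul f g :
  loc_lip p f -> loc_lip p g -> loc_lip p (fun x => f x * g x).
Proof.
move=> [K0 K00 fK0] [L0 L00 gL0].
pose K := K0 + L0.
have K_gt0 : 0 < K by rewrite addr_gt0.
have fK : lip_at p K f by apply: lip_atW fK0; rewrite // lerDl ltW.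
have gK : lip_at p K g by apply: lip_atW gL0; rewrite // lerDr ltW.
(* The sum of the bounds |f p| + 1 and |g p| + 1 for the two factors on the ball of radius 1/K. *)
pose A := `|f p| + `|g p| + 2.
have A1 : 1 <= A.
  by rewrite /A; have := normr_ge0 (f p); have := normr_ge0 (g p); lra.
exists (A * K); first by rewrite mulr_gt0// (lt_le_trans _ A1).
have KA : K <= A * K by rewrite ler_peMl// ltW.
move=> x y r xp yp r0 xy.
have KV : (A * K)^-1 <= K^-1.
  by rewrite lef_pV2// posrE mulr_gt0// (lt_le_trans _ A1).
have {}xp i : `|x i - p i| <= K^-1 := le_trans (xp i) KV.
have {}yp i : `|y i - p i| <= K^-1 := le_trans (yp i) KV.
have fx : `|f x| <= `|f p| + 1.
  have := lip_at_bound K_gt0 fK xp; have := ler_normD (f x - f p) (f p).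
  by rewrite subrK; lra.
have gy : `|g y| <= `|g p| + 1.
  have := lip_at_bound K_gt0 gK yp; have := ler_normD (g y - g p) (g p).
  by rewrite subrK; lra.
have -> : f x * g x - f y * g y = f x * (g x - g y) + g y * (f x - f y).
  by ring.
rewrite (le_trans (ler_normD _ _))// !normrM.
have -> : A * K * r = (`|f p| + 1) * (K * r) + (`|g p| + 1) * (K * r).
  by rewrite /A; ring.
by rewrite lerD// ler_pM//; [exact: gK|exact: fK].
Qed.

Lemma loc_lip_inv f : f p != 0 -> loc_lip p f -> loc_lip p (fun x => (f x)^-1).
Proof.
move=> fp0 [K K0 fK].
pose a := `|f p|; have a0 : 0 < a by rewrite normr_gt0.
(* The term 2/a shrinks the ball until f varies by at most a/2, the term 4/a^2 bounds 1/|f x f y|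
   there, and the 1 keeps the new radius at most 1/K. *)
pose A := 1 + 2 * a^-1 + 4 * a^-2.
have aV : 0 < a^-1 by rewrite invr_gt0.
have aV2 : 0 < a^-2 by rewrite invr_gt0 exprn_gt0.
have A1 : 1 <= A by rewrite /A; lra.
have AK0 : 0 < A * K by rewrite mulr_gt0// (lt_le_trans _ A1).
have KA : K <= A * K by rewrite ler_peMl// ltW.
exists (A * K) => // x y r xp yp r0 xy.
have far z : (forall i, `|z i - p i| <= (A * K)^-1) -> a / 2 <= `|f z|.
  move=> zp; have : `|f z - f p| <= K * (A * K)^-1.
    apply: fK => [i|i||//].
    - by rewrite (le_trans (zp i))// lef_pV2.
    - by rewrite subrr normr0 invr_ge0 ltW.
    - by rewrite invr_ge0 ltW.
  rewrite invfM mulrCA divff ?lt0r_neq0// mulr1 => h.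
  have A2 : A^-1 <= a / 2.
    rewrite -[a / 2]invrK lef_pV2 ?posrE ?invr_gt0 ?divr_gt0//; last first.
      by rewrite (lt_le_trans _ A1).
    by rewrite invfM invrK /A; lra.
  have := ler_distD (f z) (f p) 0; rewrite !subr0 -/a distrC; lra.
have fx := far _ xp; have fy := far _ yp.
have fx0 : f x != 0 by rewrite -normr_gt0 (lt_le_trans _ fx)// divr_gt0.
have fy0 : f y != 0 by rewrite -normr_gt0 (lt_le_trans _ fy)// divr_gt0.
have -> : (f x)^-1 - (f y)^-1 = (f y - f x) * ((f x)^-1 * (f y)^-1).
  by field; rewrite ?fx0 ?fy0.
rewrite normrM.
have -> : A * K * r = (K * r) * A by ring.
have xyK : `|f y - f x| <= K * r.
  rewrite distrC; apply: fK => // i.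
  - by rewrite (le_trans (xp i))// lef_pV2.
  - by rewrite (le_trans (yp i))// lef_pV2.
rewrite ler_pM// normrM !normfV.
apply: (@le_trans _ _ (4 * a^-2)); last by rewrite /A; lra.
have h2 (u : R) : a / 2 <= u -> u^-1 <= 2 / a.
  move=> au; rewrite -[2 / a]invrK lef_pV2 ?posrE ?invr_gt0 ?divr_gt0//.
    by rewrite invfM invrK mulrC.
  by rewrite (lt_le_trans _ au)// divr_gt0.
have -> : 4 * a^-2 = (2 / a) * (2 / a).
  by field; rewrite lt0r_neq0.
by rewrite ler_pM ?invr_ge0 ?h2.
Qed.

Lemma loc_lip_uniform (J : finType) (F : (I -> R) -> J -> R) :
  (forall j, loc_lip p (F^~ j)) ->
  exists2 K, 0 < K & forall j, lip_at p K (F^~ j).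
Proof.
move=> FK.
have /choice[K KP] : forall j, exists k, 0 < k /\ lip_at p k (F^~ j).
  by move=> j; have [K] := FK j; exists K.
exists (1 + \sum_j K j).
  by rewrite ltr_pwDl// sumr_ge0// => j _; case: (KP j) => /ltW.
move=> j; have [K0 ?] := KP j; apply: (@lip_atW (K j)) => //.
rewrite (bigD1 j)//= addrCA lerDl addr_ge0// sumr_ge0// => k _.
by case: (KP k) => /ltW.
Qed.

End loc_lip_closure.

(** * Picard's existence theorem *)

(** Applied to states, it makes a local vector field bounded and globally Lipschitz; applied to
    times, it lets the Picard iterates live on the whole line. *)
Definition clamp (R : realType) (a b x : R) : R := Num.max a (Num.min b x).

Lemma clamp_itv (R : realType) (a b x : R) : a <= b -> a <= clamp a b x <= b.
Proof.
by move=> ab; rewrite /clamp le_max lexx/= ge_max ab/= ge_min lexx.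
Qed.

Lemma clamp_id (R : realType) (a b x : R) : a <= x -> x <= b -> clamp a b x = x.
Proof. by move=> ax xb; rewrite /clamp min_r// max_r. Qed.

Lemma clamp_lipschitz (R : realType) (a b x y : R) : a <= b ->
  `|clamp a b x - clamp a b y| <= `|x - y|.
Proof.
move=> ab; rewrite /clamp ler_norml.
have h1 := ler_norm (x - y); have h2 := ler_norm (- (x - y)).
rewrite normrN in h2.
by rewrite /Num.max /Num.min; apply/andP; split;
  do !case: ifPn => //; rewrite -?leNgt => *; lra.
Qed.

Lemma le_of_geometric (R : realType) (K u v : R) :
  (forall n, u <= v + K / 2 ^+ n) -> u <= v.
Proof.
move=> H; rewrite leNgt; apply/negP => vu.
have e0 : 0 < u - v by rewrite subr_gt0.
have := H (Num.bound (`|K| / (u - v))); set n := Num.bound _.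
have n0 : `|K| / (u - v) < 2 ^+ n.
  rewrite (lt_trans (archi_boundP _)) ?divr_ge0// ?ltW// -natrX ltr_nat.
  exact: ltn_expl.
rewrite leNgt => /negP; apply; rewrite -ltrBrDl ltr_pdivrMr ?exprn_gt0//.
by rewrite (le_lt_trans (ler_norm K))// mulrC -ltr_pdivrMr.
Qed.

Section picard.
Context {R : realType} {I : finType} (F : (I -> R) -> I -> R) (p : I -> R).
Context (L M d : R).
Hypothesis FL : forall x y (r : R), 0 <= r -> (forall i, `|x i - y i| <= r) ->
  forall i, `|F x i - F y i| <= L * r.
Hypothesis FM : forall x i, `|F x i| <= M.
Hypothesis d0 : 0 < d.
Hypothesis d1 : d < 1.
Hypothesis Ld : L * d <= 2^-1.
Hypothesis L0 : 0 <= L.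
Hypothesis M0 : 0 <= M.

Let lipM (x : R -> I -> R) := forall i s t, `|x t i - x s i| <= M * `|t - s|.

Let dd : - d <= d.
Proof. by have := d0; lra. Qed.

(** A chosen antiderivative on (-1, 1), an interval that contains [-d, d] because d < 1. The default
    value is never taken when f is continuous. *)
Let anti (f : R -> R) : R -> R :=
  xget (fun=> 0) [set f' | forall t : R, -1 < t -> t < 1 -> is_derive t 1 f' (f t)].

Let antiP f : continuous f ->
  forall t : R, -1 < t -> t < 1 -> is_derive t 1 (anti f) (f t).
Proof.
move=> /(antiderivative (-1) 1)[f' f'P]; rewrite /anti.
by case: xgetP => [g _ //|/(_ f')].
Qed.

Let clampd (t : R) := clamp (- d) d t.

Let clampd1 t : -1 < clampd t < 1.
Proof.
have /andP[h1 h2] : - d <= clampd t <= d by exact: clamp_itv.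
by have hd1 := d1; apply/andP; split; lra.
Qed.

(** The Picard operator: the integral from 0 to the clamped time is a difference of two values of an
    antiderivative. *)
Let P (x : R -> I -> R) (t : R) (i : I) : R :=
  p i + anti (fun s => F (x s) i) (clampd t) - anti (fun s => F (x s) i) 0.

Let Fx_continuous x i : lipM x -> continuous (fun s => F (x s) i).
Proof.
move=> xM; apply: (@lipschitz_continuous _ _ (L * M)) => s t.
by rewrite -mulrA; apply: FL => [|j]; [rewrite mulr_ge0|exact: xM].
Qed.


Let lipMP x : lipM x -> lipM (P x).
Proof.
move=> xM i s t.
have hd := dd; have -> : P x t i - P x s i = anti (fun s => F (x s) i) (clampd t)
    - anti (fun s => F (x s) i) (clampd s) by rewrite /P; ring.
apply: (@le_trans _ _ (M * `|clampd t - clampd s|)); last first.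
  by rewrite ler_wpM2l// clamp_lipschitz//; lra.
apply: (@derive_lipschitz _ _ (fun s => F (x s) i) (-1) 1) => //.
by move=> u u1 u2; split; [apply: antiP => //; exact: Fx_continuous|exact: FM].
Qed.

(** The difference has a time derivative of size at most L r and is followed over a time at most d;
    the factor 1/2 is the bound on L d. *)
Let contrP x y r : lipM x -> lipM y -> 0 <= r ->
  (forall t i, `|x t i - y t i| <= r) ->
  forall t i, `|P x t i - P y t i| <= r / 2.
Proof.
move=> xM yM r0 xy t i.
pose h s := anti (fun s => F (x s) i) s - anti (fun s => F (y s) i) s.
have -> : P x t i - P y t i = h (clampd t) - h 0 by rewrite /P /h; ring.
apply: (@le_trans _ _ ((L * r) * `|clampd t - 0|)).
  apply: (@derive_lipschitz _ _ (fun s => F (x s) i - F (y s) i) (-1) 1) => //.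
  - move=> u u1 u2; split; last by apply: FL => // j; exact: xy.
    apply: is_deriveB; apply: antiP => //; exact: Fx_continuous.
  - by rewrite oppr_lt0 !ltr01.
have h1 : `|clampd t - 0| <= d by rewrite subr0 ler_norml; exact: clamp_itv.
rewrite (@le_trans _ _ (L * r * d))// ?ler_wpM2l// ?mulr_ge0//.
by rewrite mulrAC [leRHS]mulrC ler_wpM2r.
Qed.

Let xn n : R -> I -> R := iter n P (fun=> p).

Let lipMxn n : lipM (xn n).
Proof.
elim: n => [i s t|n IHn]; last exact: lipMP.
by rewrite /= subrr normr0 mulr_ge0.
Qed.

(** The first step moves by at most M, clamped times lying in (-1, 1); each further application of
    [P] halves the distance. *)
Let xnS n t i : `|xn n.+1 t i - xn n t i| <= M / 2 ^+ n.
Proof.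
elim: n t i => [|n IHn] t i.
  rewrite expr0 divr1 /xn/=.
  have hd := d0; have -> : P (fun=> p) t i - p i = P (fun=> p) t i - P (fun=> p) 0 i.
    by rewrite [P _ 0 i]/P /clampd clamp_id; [ring|lra|lra].
  have := @lipMP (fun=> p) (@lipMxn 0) i 0 (clampd t).
  rewrite subr0.
  have -> : P (fun=> p) (clampd t) i = P (fun=> p) t i.
    rewrite /P; congr (_ + anti _ _ - _); rewrite /clampd clamp_id//.
      by have /andP[] : - d <= clampd t <= d by exact: clamp_itv.
    by have /andP[] : - d <= clampd t <= d by exact: clamp_itv.
  move=> /le_trans; apply; rewrite ler_piMr// ler_norml.
  by have /andP[h1 h2] := clampd1 t; rewrite !ltW.
have -> : M / 2 ^+ n.+1 = M / 2 ^+ n / 2 by rewrite exprS invfM; ring.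
apply: (@contrP _ _ _ (@lipMxn n.+1) (@lipMxn n) _ IHn t i).
by rewrite divr_ge0// exprn_ge0.
Qed.

(** The margin 2M/2^n is the tail of the geometric series of step sizes. The intervals from [lo n]
    to [hi n] are therefore nested, and the limit can be taken as the supremum of their left ends,
    separately for each time and component. *)
Let lo n t i := xn n t i - 2 * M / 2 ^+ n.
Let hi n t i := xn n t i + 2 * M / 2 ^+ n.

Let lohi n m t i : lo n t i <= hi m t i.
Proof.
have lo1 k : lo k t i <= lo k.+1 t i.
  have := xnS k t i; rewrite ler_norml => /andP[+ _].
  by rewrite /lo exprS invfM; set u := _ ^-1; lra.
have hi1 k : hi k.+1 t i <= hi k t i.
  have := xnS k t i; rewrite ler_norml => /andP[_].
  by rewrite /hi exprS invfM; set u := _ ^-1; lra.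
have lok k l : lo k t i <= lo (k + l)%N t i.
  by elim: l => [|l IHl]; rewrite ?addn0// addnS (le_trans IHl).
have hik k l : hi (k + l)%N t i <= hi k t i.
  by elim: l => [|l IHl]; rewrite ?addn0// addnS (le_trans _ IHl).
rewrite (le_trans (lok n m))// (le_trans _ (hik m n))// addnC /lo /hi.
rewrite lerD2l (@le_trans _ _ 0)// ?oppr_le0; rewrite divr_ge0 ?mulr_ge0//;
  exact: exprn_ge0.
Qed.

Let x t i := sup [set lo n t i | n in [set: nat]].

Let x_near n t i : `|x t i - xn n t i| <= 2 * M / 2 ^+ n.
Proof.
have hs : has_sup [set lo n t i | n in [set: nat]].
  split; first by exists (lo 0%N t i), 0%N.
  by exists (hi 0%N t i) => _ [k _ <-]; exact: lohi.
have h1 : lo n t i <= x t i by apply: sup_upper_bound => //; exists n.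
have h2 : x t i <= hi n t i.
  apply: sup_le_ub; first by case: hs.
  by move=> _ [k _ <-]; exact: lohi.
by rewrite ler_norml; move: h1 h2; rewrite /lo /hi; lra.
Qed.

Let xM : lipM x.
Proof.
move=> i s t; apply: (@le_of_geometric _ (4 * M)) => n.
have h1 := x_near n t i; have h2 := x_near n s i; have h3 := @lipMxn n i s t.
have -> : x t i - x s i = (x t i - xn n t i) - (x s i - xn n s i) +
  (xn n t i - xn n s i) by ring.
rewrite (le_trans (ler_normD _ _))// addrC lerD// (le_trans (ler_normB _ _))//.
by rewrite (le_trans (lerD h1 h2))// -mulrDl ler_wpM2r ?invr_ge0 ?exprn_ge0//; lra.
Qed.

Let PxE t i : P x t i = x t i.
Proof.
apply/eqP; rewrite -subr_eq0 -normr_le0.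
apply: (@le_of_geometric _ (3 * M)) => n.
have h1 : `|P x t i - xn n.+1 t i| <= 2 * M / 2 ^+ n / 2.
  apply: contrP; [exact: xM|exact: lipMxn| |by move=> u j; exact: x_near].
  by rewrite divr_ge0 ?exprn_ge0// mulr_ge0.
have h2 := x_near n.+1 t i.
have -> : P x t i - x t i =
  (P x t i - xn n.+1 t i) - (x t i - xn n.+1 t i) by ring.
rewrite add0r (le_trans (ler_normB _ _))// (le_trans (lerD h1 h2))//.
have u0 : 0 <= M / 2 ^+ n by rewrite divr_ge0 ?exprn_ge0.
have -> : 2 * M / 2 ^+ n / 2 + 2 * M / 2 ^+ n.+1 = 2 * (M / 2 ^+ n).
  by rewrite exprS invfM; field; rewrite expf_neq0.
by rewrite -[3 * M / _]mulrA ler_wpM2r//; lra.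
Qed.

Lemma picard_global : exists2 x : R -> I -> R,
  x 0 = p /\ (forall i (s t : R), `|x t i - x s i| <= M * `|t - s|) &
  forall t : R, - d < t -> t < d -> forall i, is_derive t 1 (x^~ i) (F (x t) i).
Proof.
have hd0 := d0; have hd1 := d1; exists x => [|t t1 t2 i].
  split=> //; apply/funext => i; rewrite -PxE /P /clampd clamp_id; [ring|lra|lra].
apply: (@near_eq_is_derive _ _ _ (fun t => p i +
    anti (fun s => F (x s) i) t - anti (fun s => F (x s) i) 0)).
  near=> s; rewrite -PxE /P /clampd clamp_id//; near: s.
  - by apply: filterS (lt_nbhsr t1) => ?; exact: ltW.
  - by apply: filterS (lt_nbhsl t2) => ?; exact: ltW.
rewrite -[F _ _]subr0 -[F _ _]add0r.
apply: is_deriveB; apply: is_deriveD; apply: antiP; [|lra|lra].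
exact: Fx_continuous.
Unshelve. all: by end_near. Qed.

End picard.

(** Clamping the state to a box around p makes the field bounded and globally Lipschitz. For times
    below d the solution stays in the box, where clamping changes nothing. *)
Lemma picard_local (R : realType) (I : finType) (F : (I -> R) -> I -> R)
    (p : I -> R) (rho : R) : 0 < rho -> (forall i, loc_lip p (F^~ i)) ->
  exists d (x : R -> I -> R), [/\ 0 < d, x 0 = p &
    forall t, - d < t -> t < d -> forall i,
      `|x t i - p i| <= rho /\ is_derive t 1 (x^~ i) (F (x t) i)].
Proof.
move=> rho0 /loc_lip_uniform[K K0 FK].
pose r0 := Num.min rho K^-1.
have r00 : 0 < r0 by rewrite lt_min rho0 invr_gt0.
pose cl (x : I -> R) j := clamp (p j - r0) (p j + r0) (x j).
have clp x j : `|cl x j - p j| <= r0.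
  rewrite ler_distl; apply: clamp_itv.
  by rewrite lerD2l -subr_ge0 opprK addr_ge0// ltW.
have r0K : r0 <= K^-1 by rewrite ge_min lexx orbT.
pose M := 1 + \sum_i `|F p i|.
have M0 : 0 < M by rewrite ltr_pwDl// sumr_ge0.
have A0 : 0 < 2 + 2 * K + M / r0.
  by rewrite !addr_gt0// ?mulr_gt0 ?invr_gt0.
(* The three terms give d < 1, K d <= 1/2 and M d <= r0. *)
pose d := (2 + 2 * K + M / r0)^-1.
have Mr0 : 0 < M / r0 by rewrite divr_gt0.
have d0 : 0 < d by rewrite invr_gt0.
have dA : d * (2 + 2 * K + M / r0) = 1 by rewrite mulVf// lt0r_neq0.
have dK0 : 0 < d * K by rewrite mulr_gt0.
have dM0 : 0 < d * (M / r0) by rewrite mulr_gt0.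
have d1 : d < 1 by move: dA; rewrite !mulrDr; lra.
have Kd : K * d <= 2^-1 by move: dA; rewrite !mulrDr [K * d]mulrC; lra.
have Md : M * d <= r0.
  have -> : M * d = r0 * (d * (M / r0)) by field; rewrite lt0r_neq0.
  by rewrite ler_piMr ?ltW//; move: dA; rewrite !mulrDr; lra.
have [||x [x0 xM] xd] := @picard_global R I (fun x => F (cl x)) p K M d _ _ d0
    d1 Kd (ltW K0) (ltW M0).
- move=> x y r r_ge0 xy i; apply: FK => // j; rewrite ?(le_trans (clp _ _))//.
  rewrite (le_trans (clamp_lipschitz _ _ _))//.
  by rewrite lerD2l -subr_ge0 opprK addr_ge0// ltW.
- move=> x i.
  have : `|F (cl x) i - F p i| <= 1.
    by apply: lip_at_bound (FK i) _ => // j; rewrite (le_trans (clp _ _)).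
  have := ler_normD (F (cl x) i - F p i) (F p i); rewrite subrK.
  have : `|F p i| <= \sum_i `|F p i|.
    by rewrite (bigD1 i)//= lerDl sumr_ge0.
  rewrite /M; lra.
exists d, x; split => // t t1 t2 i.
have xp j : `|x t j - p j| <= r0.
  rewrite -x0 (le_trans (xM _ _ _))// (le_trans _ Md)//.
  apply: ler_wpM2l; first exact: ltW.
  by rewrite subr0 ler_norml !ltW.
split; first by rewrite (le_trans (xp i))// ge_min lexx.
have := xd t t1 t2 i; congr is_derive; congr (F _ i); apply/funext => j.
by have := xp j; rewrite ler_distl => /andP[]; exact: clamp_id.
Qed.

(** * Continuation of a solution past a finite limit *)

(** By the mean value theorem a difference quotient at T is a value of [df] at a point that tends to
    T. This settles the derivative at the point where two solutions are glued. *)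
Lemma is_derive_punctured (R : realType) (f df : R -> R) (T d : R) : 0 < d ->
  (forall t, T - d < t -> t < T + d -> t != T -> is_derive t 1 f (df t)) ->
  {for T, continuous f} -> {for T, continuous df} -> is_derive T 1 f (df T).
Proof.
move=> d0 fd cf cdf.
have ct t : T - d < t -> t < T + d -> {for t, continuous f}.
  have [->//|tT t1 t2] := eqVneq t T.
  exact: (is_derive_continuous (fd t t1 t2 tT)).
have mv s t : T - d < s -> s < t -> t < T + d -> (s = T \/ t = T) ->
    exists2 c, s < c < t & f t - f s = df c * (t - s).
  move=> s1 st t1 stT; have [u||c] := @MVT R f df s t st.
  - rewrite in_itv/= => /andP[su ut]; apply: fd.
    + exact: lt_trans su.
    + exact: lt_trans t1.
    + by case: stT => <-; [rewrite gt_eqF|rewrite lt_eqF].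
  - apply: continuous_in_subspaceT => u; rewrite inE/= in_itv/= => /andP[su ut].
    by apply: ct; [exact: lt_le_trans su|exact: le_lt_trans t1].
  - by rewrite in_itv/= => cst fE; exists c.
have H : h^-1 *: ((f \o shift T) (h *: 1) - f T) @[h --> 0^'] --> df T.
  apply/cvgrPdist_le => e e0.
  have [e1 /= e10 He] := (@nbhs_ballP _ _ _ _).1
    ((@cvgrPdist_le _ _ _ _ _ _ _).1 cdf e e0).
  near=> h.
  have h0 : h != 0 by near: h; exact: nbhs_dnbhs_neq.
  have hd : `|h| < d by near: h; apply: dnbhs0_lt.
  have he : `|h| < e1 by near: h; apply: dnbhs0_lt.
  have [c cT fE] : exists2 c, `|T - c| < e1 & f (h + T) - f T = df c * h.
    move: hd he; rewrite !ltr_norml => /andP[? ?] /andP[? ?].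
    have [hlt|hgt|h00] := ltgtP h 0; last by rewrite h00 eqxx in h0.
      have [||||c /andP[c1 c2] cE] := mv (h + T) T.
      - by lra.
      - by lra.
      - by lra.
      - by right.
      exists c; first by rewrite ltr_norml; apply/andP; split; lra.
      by rewrite -opprB cE; ring.
    have [||||c /andP[c1 c2] cE] := mv T (h + T).
    - by lra.
    - by lra.
    - by lra.
    - by left.
    exists c; first by rewrite ltr_norml; apply/andP; split; lra.
    by rewrite cE; ring.
  rewrite /= [h *: 1]mulr1 fE /GRing.scale/= mulrCA mulVf// mulr1.
  exact: He.
by apply: DeriveDef; [apply/cvg_ex; exists (df T)|exact/cvg_lim].
Unshelve. all: by end_near. Qed.

Lemma loc_lip_continuous (R : realType) (I : finType) (f : (I -> R) -> R)
    (x : R -> I -> R) (T : R) : loc_lip (x T) f ->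
  (forall i, {for T, continuous (x^~ i)}) -> {for T, continuous (f \o x)}.
Proof.
move=> [K K0 fK] cx; apply/cvgrPdist_le => e e0.
pose r := Num.min K^-1 (e / K).
have r0 : 0 < r by rewrite lt_min invr_gt0 K0 divr_gt0.
have xr : \forall t \near T, forall i, `|x T i - x t i| <= r.
  apply: (@filter_forall R I (fun i t => `|x T i - x t i| <= r) (nbhs T)) => i.
  by have /cvgrPdist_le/(_ r r0) := cx i.
apply: filterS xr => t xr /=.
apply: (@le_trans _ _ (K * r)); last first.
  by rewrite mulrC -ler_pdivlMr// ge_min lexx orbT.
apply: fK => //; last exact: ltW.
- by move=> i; rewrite subrr normr0 invr_ge0 ltW.
- by move=> i; rewrite distrC (le_trans (xr i))// ge_min lexx.
Qed.

(** A local Picard solution started at the limit p is attached at T. The radius [rho] is left to the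
    caller: it will keep the continuation among the positive definite metrics. *)
Lemma ode_extend_right (R : realType) (I : finType)
    (F : (I -> R) -> I -> R) (p : I -> R) (a : \bar R) (T rho : R)
    (x : R -> I -> R) :
  (a < T%:E)%E -> 0 < rho -> (forall i, loc_lip p (F^~ i)) ->
  (forall t, (a < t%:E)%E -> t < T ->
     forall i, is_derive t 1 (x^~ i) (F (x t) i)) ->
  (forall i, x t i @[t --> T^'-] --> p i) ->
  exists d (y : R -> I -> R), [/\ 0 < d,
    forall t, t < T -> y t = x t,
    forall t, T <= t -> t < T + d -> forall i, `|y t i - p i| <= rho &
    forall t, (a < t%:E)%E -> t < T + d ->
      forall i, is_derive t 1 (y^~ i) (F (y t) i)].
Proof.
move=> aT rho0 FK xd xp.
have [d [z [d0 z0 zd]]] := picard_local rho0 FK.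
pose y t := if t < T then x t else z (t - T).
have yx t : t < T -> y t = x t by rewrite /y => ->.
have yz t : T <= t -> y t = z (t - T) by rewrite /y ltNge => ->.
exists d, y; split => // [t t1 t2 i|].
  rewrite yz//; have h1 : - d < t - T by lra.
  have h2 : t - T < d by lra.
  by have [] := zd _ h1 h2 i.
have yl t : (a < t%:E)%E -> t < T ->
    forall i, is_derive t 1 (y^~ i) (F (y t) i).
  move=> at_ tT i; rewrite yx//.
  apply: (@near_eq_is_derive _ _ _ (x^~ i)); last exact: xd.
  by apply: filterS (lt_nbhsl tT) => s sT; rewrite yx.
have yr t : T < t -> t < T + d -> forall i, is_derive t 1 (y^~ i) (F (y t) i).
  move=> Tt tT i; rewrite yz ?ltW//.
  apply: (@near_eq_is_derive _ _ _ ((z^~ i) \o (fun s => s - T))).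
    by apply: filterS (lt_nbhsr Tt) => s sT; rewrite /= yz// ltW.
  rewrite -[F _ _]mulr1; apply: is_derive1_comp.
    have h1 : - d < t - T by lra.
    have h2 : t - T < d by lra.
    by have [_] := zd _ h1 h2 i.
  by rewrite -[X in is_derive _ _ _ X]subr0; apply: is_deriveB.
have yTp : y T = p by rewrite yz// subrr.
(* The left limit of x and the initial value of z are both p. *)
have yc i : {for T, continuous (y^~ i)}.
  have zc : {for 0, continuous (z^~ i)}.
    have h1 : - d < 0 by rewrite oppr_lt0.
    by have [_ /is_derive_continuous] := zd _ h1 d0 i.
  apply/cvgrPdist_le => e e0; rewrite yTp.
  have /cvgrPdist_le/(_ e e0) xpe := xp i.
  have /cvgrPdist_le/(_ e e0) := zc; rewrite z0 => /nbhs_ballP[r /= r0 zr].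
  have h : \forall t \near T, t < T -> `|p i - x t i| <= e by exact: xpe.
  near=> t; have [tT|Tt] := ltP t T.
    by rewrite yx//; move: tT; near: t.
  rewrite yz//; apply: zr; rewrite /ball/= sub0r normrN distrC.
  by near: t; apply/nbhs_ballP; exists r.
move=> t at_ tT i; have [tlT|Tlt|->] := ltgtP t T; [exact: yl|exact: yr|].
have [e e0 ae] : exists2 e, 0 < e & forall s, T - e < s -> (a < s%:E)%E.
  case: a aT {xd yl at_} => [a|//|_].
  - rewrite lte_fin => aT; exists (T - a) => [|s]; rewrite ?subr_gt0//.
    by rewrite lte_fin; lra.
  - by exists 1 => // s _; rewrite ltNyr.
pose r := Num.min e d.
apply: (@is_derive_punctured _ _ (fun s => F (y s) i) T r).
- by rewrite lt_min e0.
- move=> s s1 s2; rewrite neq_lt => /orP[sT|Ts].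
  + apply: yl => //; apply: ae; apply: le_lt_trans s1.
    by rewrite lerD2l lerN2 ge_min lexx.
  + apply: yr => //; apply: lt_le_trans s2 _.
    by rewrite lerD2l ge_min lexx orbT.
- exact: yc.
- by apply: (@loc_lip_continuous _ _ (F^~ i) y) => //; rewrite yTp.
Unshelve. all: by end_near. Qed.

(** Time reversal: x(-t) solves the equation with field -F. *)
Lemma ode_extend_left (R : realType) (I : finType)
    (F : (I -> R) -> I -> R) (p : I -> R) (a : \bar R) (T rho : R)
    (x : R -> I -> R) :
  (T%:E < a)%E -> 0 < rho -> (forall i, loc_lip p (F^~ i)) ->
  (forall t, (t%:E < a)%E -> T < t ->
     forall i, is_derive t 1 (x^~ i) (F (x t) i)) ->
  (forall i, x t i @[t --> T^'+] --> p i) ->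
  exists d (y : R -> I -> R), [/\ 0 < d,
    forall t, T < t -> y t = x t,
    forall t, t <= T -> T - d < t -> forall i, `|y t i - p i| <= rho &
    forall t, (t%:E < a)%E -> T - d < t ->
      forall i, is_derive t 1 (y^~ i) (F (y t) i)].
Proof.
move=> Ta rho0 FK xd xp.
have [|||i|d [y [d0 yx yp yd]]] := @ode_extend_right R I (fun x i => - F x i) p
    (- a)%E (- T) rho (x \o -%R) _ rho0.
- by rewrite EFinN lteN2.
- move=> i; have := loc_lip_mul (loc_lip_cst p (-1)) (FK i).
  by under eq_fun do rewrite mulN1r.
- move=> t at_ tT i.
  have H : is_derive (- t) 1 (x^~ i) (F (x (- t)) i).
    by apply: xd; [rewrite EFinN lteNl|rewrite ltrNr].
  by have := is_derive_reflect H; rewrite opprK.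
- by have /cvg_at_rightNP := xp i.
exists d, (y \o -%R); split => // [t Tt|t t1 t2 i|t t1 t2 i].
- by rewrite /= yx ?ltrN2//= opprK.
- by apply: yp; rewrite ?lerN2//; lra.
- have H : is_derive (- t) 1 (y^~ i) (- F (y (- t)) i).
    by apply: yd; [rewrite EFinN lteN2|lra].
  by have := is_derive_reflect H; rewrite !opprK.
Qed.

(** * Functions dominated by a monotone function *)

Lemma cvg_at_left_dominated (R : realType) (S dS f df : R -> R) (T C M : R) :
  0 <= C ->
  (\forall t \near T^'-, [/\ is_derive (t : R) 1 S (dS t), is_derive t 1 f (df t),
     `|df t| <= C * (1 + dS t) & S t <= M]) ->
  cvg (f t @[t --> T^'-]).
Proof.
move=> C0 H.
have [s sT Hs] : exists2 s, s < T & forall t : R, s <= t -> t < T ->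
    [/\ is_derive t 1 S (dS t), is_derive t 1 f (df t),
        `|df t| <= C * (1 + dS t) & S t <= M].
  move: H => /nbhs_ballP[e /= e0 He]; exists (T - e / 2).
    by rewrite ltrBlDr ltrDl divr_gt0.
  move=> t t1 t2; apply: He => //; rewrite /ball/= ltr_norml.
  by apply/andP; split; lra.
(* The summand t accounts for the 1 in 1 + S': the derivative of psi dominates |f'|, so psi + f and
   psi - f are both nondecreasing. *)
pose psi t := C * (t + S t).
have psid t : s <= t -> t < T -> is_derive t 1 psi (C * (1 + dS t)).
  move=> t1 t2; have [Sd _ _ _] := Hs t t1 t2.
  by apply: is_deriveZ; apply: is_deriveD.
have mono (h dh : R -> R) :
    (forall t : R, s <= t -> t < T -> is_derive t 1 h (dh t) /\ 0 <= dh t) ->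
    forall u v, s <= u -> u <= v -> v < T -> h u <= h v.
  move=> hd u v su; rewrite le_eqVlt => /orP[/eqP->//|uv vT].
  have [t ut tv|c /andP[uc cv] hE] := @mean_value _ h dh u v uv.
    by have [] := hd t (le_trans su ut) (le_lt_trans tv vT).
  rewrite -subr_ge0 hE mulr_ge0 ?subr_ge0 ?(ltW uv)//.
  by have [_] := hd c (le_trans su (ltW uc)) (lt_trans cv vT).
have mpsi := @mono psi (fun t => C * (1 + dS t)).
have mp := @mono (fun t => psi t + f t) (fun t => C * (1 + dS t) + df t).
have mm := @mono (fun t => psi t - f t) (fun t => C * (1 + dS t) - df t).
have psi_mono u v : s <= u -> u <= v -> v < T -> psi u <= psi v.
  apply: mpsi => t t1 t2; split; first exact: psid.
  by have [_ _ + _] := Hs t t1 t2; apply: le_trans.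
have p_mono u v : s <= u -> u <= v -> v < T -> psi u + f u <= psi v + f v.
  apply: mp => t t1 t2; have [_ fd fC _] := Hs t t1 t2; split.
    by apply: is_deriveD => //; exact: psid.
  by move: fC; rewrite ler_norml => /andP[+ _]; lra.
have m_mono u v : s <= u -> u <= v -> v < T -> psi u - f u <= psi v - f v.
  apply: mm => t t1 t2; have [_ fd fC _] := Hs t t1 t2; split.
    by apply: is_deriveB => //; exact: psid.
  by move: fC; rewrite ler_norml => /andP[_]; lra.
have psiM t : s <= t -> t < T -> psi t <= C * (T + M).
  move=> t1 t2; have [_ _ _ SM] := Hs t t1 t2.
  by rewrite ler_wpM2l// lerD// ltW.
have cvgm (h : R -> R) B : (forall u v, s <= u -> u <= v -> v < T -> h u <= h v) ->
    (forall t, s <= t -> t < T -> h t <= B) -> cvg (h t @[t --> T^'-]).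
  move=> hm hB; apply: nondecreasing_at_left_is_cvgr.
    apply: filterS (nbhs_left_ge sT) => u su x y.
    rewrite !in_itv/= => /andP[ux xT] /andP[uy yT] xy.
    exact: hm (le_trans su (ltW ux)) xy yT.
  apply: filterS (nbhs_left_ge sT) => u su; exists B => z [x] /=.
  rewrite in_itv/= => /andP[ux xT] <-.
  exact: hB (le_trans su (ltW ux)) xT.
have c1 : cvg (psi t @[t --> T^'-]) by exact: (cvgm _ _ psi_mono psiM).
(* Write psi + f = 2 psi - (psi - f), where psi <= C (T + M) and psi - f is at least its value at
   s. *)
have c2 : cvg (psi t + f t @[t --> T^'-]).
  apply: (cvgm _ (2 * (C * (T + M)) - (psi s - f s)) p_mono) => t t1 t2.
  have := psiM t t1 t2; have := m_mono s t (lexx s) t1 t2; lra.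
have -> : f = (fun t => (psi t + f t) - psi t) by apply/funext => t; ring.
exact: is_cvgB.
Unshelve. all: by end_near. Qed.

(** Time reversal with S(t) replaced by -S(-t): the derivative keeps its sign, and a lower bound on
    S becomes an upper bound. *)
Lemma cvg_at_right_dominated (R : realType) (S dS f df : R -> R) (T C M : R) :
  0 <= C ->
  (\forall t \near T^'+, [/\ is_derive (t : R) 1 S (dS t), is_derive t 1 f (df t),
     `|df t| <= C * (1 + dS t) & M <= S t]) ->
  cvg (f t @[t --> T^'+]).
Proof.
move=> C0 H.
suff : cvg ((f \o -%R) t @[t --> (- T)^'-]).
  move=> /cvg_ex[l fl]; apply/cvg_ex; exists l.
  exact/cvg_at_rightNP.
apply: (@cvg_at_left_dominated _ (fun t => - S (- t)) (dS \o -%R) _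
  (fun t => - df (- t)) _ C (- M)) => //.
rewrite at_leftN near_simpl; apply: filterS H => t [Sd fd fC SM].
split; rewrite /= ?opprK ?normrN ?lerN2//.
- by rewrite -[dS t]opprK; apply: is_deriveN; exact: is_derive_reflect.
- exact: is_derive_reflect.
Qed.

(** Reduces the blow-up to the refutation of the second alternative, from which a continuation will
    be built. *)
Lemma bounded_or_cvgy (R : realType) (S dS : R -> R) (a : \bar R) (T : R) :
  (a < T%:E)%E ->
  (forall t : R, (a < t%:E)%E -> t < T -> is_derive t 1 S (dS t) /\ 0 <= dS t) ->
  S t @[t --> T^'-] --> +oo \/ exists M, \forall t \near T^'-, S t <= M.
Proof.
move=> aT Sd.
have near_a : \forall t \near T^'-, (a < t%:E)%E.
  case: a aT {Sd} => [a|//|_].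
  - by rewrite lte_fin => aT; near=> t; rewrite lte_fin; near: t; exact: nbhs_left_gt.
  - by near=> t; rewrite ltNyr.
have mono u v : (a < u%:E)%E -> u <= v -> v < T -> S u <= S v.
  move=> au; rewrite le_eqVlt => /orP[/eqP->//|uv vT].
  have aE t : u <= t -> (a < t%:E)%E.
    by move=> ut; apply: lt_le_trans au _; rewrite lee_fin.
  have [t ut tv|c /andP[uc cv] hE] := @mean_value _ S dS u v uv.
    by have [] := Sd t (aE _ ut) (le_lt_trans tv vT).
  rewrite -subr_ge0 hE mulr_ge0 ?subr_ge0 ?(ltW uv)//.
  by have [_] := Sd c (aE _ (ltW uc)) (lt_trans cv vT).
have [[M SM]|nM] := pselect (exists M, forall t, (a < t%:E)%E -> t < T -> S t <= M).
  right; exists M; near=> t; apply: SM; near: t => //.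
  exact: nbhs_left_lt.
left; apply/cvgryPge => M.
have [u [au uT Mu]] : exists u, [/\ (a < u%:E)%E, u < T & M <= S u].
  apply: contrapT => h; apply: nM; exists M => t at_ tT.
  by rewrite leNgt; apply/negP => Mt; apply: h; exists t; split => //; exact: ltW.
near=> t; rewrite (le_trans Mu)//; apply: mono => //; near: t.
exact: nbhs_left_ge.
Unshelve. all: by end_near. Qed.

Lemma bounded_or_cvgNy (R : realType) (S dS : R -> R) (a : \bar R) (T : R) :
  (T%:E < a)%E ->
  (forall t : R, (t%:E < a)%E -> T < t -> is_derive t 1 S (dS t) /\ 0 <= dS t) ->
  S t @[t --> T^'+] --> -oo \/ exists M, \forall t \near T^'+, M <= S t.
Proof.
move=> aT Sd.
have [|t at_ tT|H|[M H]] := @bounded_or_cvgy _ (fun t => - S (- t)) (dS \o -%R)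
    (- a)%E (- T).
- by rewrite EFinN lteN2.
- have [||Sd' dS0] := Sd (- t); [by rewrite EFinN lteNl|by rewrite ltrNr|].
  split => //=; rewrite -[dS _]opprK; apply: is_deriveN.
  rewrite -[- dS _]mulrN1; exact: is_derive1_comp.
- left; apply/cvgNry.
  have := H; rewrite at_leftN -fmap_comp.
  by under [X in fmap X]eq_fun do rewrite /= opprK.
- right; exists (- M); move: H; rewrite at_leftN near_simpl.
  by apply: filterS => t; rewrite opprK lerNl.
Qed.

(** * Structure constants in an orthonormal frame *)

(** Lets an identity between double sums be checked term by term when it holds only modulo exchange
    of the two indices. *)
Lemma sum_antisym (R : realType) (I : finType) (F : I -> I -> R) :
  (forall i j, F i j + F j i = 0) -> \sum_i \sum_j F i j = 0.
Proof.
move=> FA; suff : \sum_i \sum_j F i j + \sum_i \sum_j F i j = 0 by lra.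
rewrite [X in _ + X]exchange_big -big_split big1// => i _.
by rewrite -big_split big1// => j _; exact: FA.
Qed.

Lemma sum3_rot (R : realType) (I : finType) (F : I -> I -> I -> R) :
  \sum_i \sum_j \sum_k F i j k = \sum_i \sum_j \sum_k F j k i.
Proof.
rewrite [RHS]exchange_big; apply: eq_bigr => i _.
by rewrite [RHS]exchange_big.
Qed.

Lemma sum3_swap (R : realType) (I : finType) (F : I -> I -> I -> R) :
  \sum_i \sum_j \sum_k F i j k = \sum_i \sum_j \sum_k F j i k.
Proof. exact: exchange_big. Qed.

Section structure_constants.
Context {R : realType} {I : finType} (c : I -> I -> I -> R) (H : I -> I -> I -> R).

(* c i j k stands for <[e_i, e_j], e_k>.  Then z is the mean curvature vector,
   K the Killing form, D the matrix of ad z, Q the square of H, W = i_z H,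
   cod = d^* H, and h = -2 Ric + Q / 2 the velocity of the metric. *)
Definition sc_z m := \sum_i c m i i.
Definition sc_A a b := \sum_i \sum_j c a i j * c b i j.
Definition sc_K a b := \sum_i \sum_j c a j i * c b i j.
Definition sc_N a b := \sum_i \sum_j c i j a * c i j b.
Definition sc_D a b := \sum_m sc_z m * c m a b.
Definition sc_ric a b :=
  - 2^-1 * sc_A a b - 2^-1 * sc_K a b + 4^-1 * sc_N a b
  - 2^-1 * (sc_D a b + sc_D b a).
Definition sc_Q a b := \sum_i \sum_j H a i j * H b i j.
Definition sc_E a b := \sum_i \sum_j c i j a * H i j b.
Definition sc_W a b := \sum_m sc_z m * H m a b.
Definition sc_cod a b := sc_W a b - 2^-1 * sc_E a b + 2^-1 * sc_E b a.
Definition sc_h a b := - 2 * sc_ric a b + 2^-1 * sc_Q a b.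

Hypothesis cA : forall i j k, c i j k = - c j i k.
Hypothesis cJ : forall i j k l,
  \sum_m (c j k m * c i m l + c k i m * c j m l + c i j m * c k m l) = 0.
Hypothesis HA12 : forall i j k, H i j k = - H j i k.
Hypothesis HA23 : forall i j k, H i j k = - H i k j.
Hypothesis dH : forall m x y u,
  \sum_p (c m x p * H p y u - c m y p * H p x u + c m u p * H p x y
  + c x y p * H p m u - c x u p * H p m y + c y u p * H p m x) = 0.

Lemma sc_KC a b : sc_K a b = sc_K b a.
Proof.
rewrite /sc_K exchange_big; apply: eq_bigr => i _; apply: eq_bigr => j _.
by rewrite mulrC.
Qed.

(** This is tr ad [e_i, e_j] = 0, the trace of a commutator: in the traced Jacobi identity two terms
    cancel after exchanging the summation indices. *)
Lemma sc_z_bracket i j : \sum_m c i j m * sc_z m = 0.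
Proof.
have : \sum_k \sum_m (c j k m * c i m k + c k i m * c j m k
    + c i j m * c k m k) = 0 by rewrite big1.
under eq_bigr do rewrite big_split/=.
rewrite big_split/= => h.
have h1 : \sum_k \sum_m (c j k m * c i m k + c k i m * c j m k) = 0.
  under eq_bigr do rewrite big_split/=.
  rewrite big_split/= [X in X + _]exchange_big/= -big_split big1// => k _.
  rewrite -big_split big1// => m _.
  by rewrite [c k i m]cA /= ; ring.
move: h; rewrite h1 add0r exchange_big/= => h.
rewrite -[RHS]oppr0 -[X in - X]h -sumrN; apply: eq_bigr => m _.
rewrite /sc_z mulr_sumr -sumrN; apply: eq_bigr => k _.
by rewrite [c k m k]cA; ring.
Qed.

(** The Killing form is ad-invariant, so K([e_m, e_a], e_a) = K(e_m, [e_a, e_a]) = 0 already for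
    each a. *)
Lemma sc_cK m : \sum_a \sum_b c m a b * sc_K a b = 0.
Proof.
rewrite big1// => a _.
have -> : \sum_b c m a b * sc_K a b =
    \sum_i \sum_j (\sum_b c m a b * c b i j) * c a j i.
  under eq_bigr do rewrite /sc_K mulr_sumr.
  rewrite exchange_big; apply: eq_bigr => i _.
  under eq_bigr do rewrite mulr_sumr.
  rewrite exchange_big; apply: eq_bigr => j _.
  by rewrite mulr_suml; apply: eq_bigr => b _; ring.
have J i j : \sum_b c m a b * c b i j =
    \sum_b (c a i b * c m b j - c m i b * c a b j).
  apply/eqP; rewrite -subr_eq0 -sumrB; apply/eqP.
  rewrite -[RHS]oppr0 -[X in - X](cJ i m a j) -sumrN; apply: eq_bigr => b _.
  by rewrite [c b i j]cA [c i m b]cA; ring.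
under eq_bigr do under eq_bigr do rewrite J mulr_suml.
under eq_bigr do under eq_bigr do under eq_bigr do rewrite mulrBl.
under eq_bigr do under eq_bigr do rewrite sumrB.
under eq_bigr do rewrite sumrB.
rewrite sumrB [X in _ - X]sum3_rot [X in _ - X]sum3_rot.
apply/eqP; rewrite subr_eq0; apply/eqP.
apply: eq_bigr => i _; apply: eq_bigr => j _; apply: eq_bigr => b _; ring.
Qed.

(** Pair [e_m, [e_i, e_j]] = [[e_m, e_i], e_j] + [e_i, [e_m, e_j]] with [e_i, e_j] and sum. The two
    terms on the right give equal sums by antisymmetry, hence the factor 2. *)
Lemma sc_cN m :
  \sum_a \sum_b c m a b * sc_N a b = 2 * \sum_a \sum_b c m a b * sc_A a b.
Proof.
have -> : \sum_a \sum_b c m a b * sc_N a b =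
    \sum_b \sum_i \sum_j (\sum_a c i j a * c m a b) * c i j b.
  rewrite exchange_big; apply: eq_bigr => b _.
  under eq_bigr do rewrite /sc_N mulr_sumr.
  rewrite exchange_big; apply: eq_bigr => i _.
  under eq_bigr do rewrite mulr_sumr.
  rewrite exchange_big; apply: eq_bigr => j _.
  by rewrite mulr_suml; apply: eq_bigr => a _; ring.
have J i j b : \sum_a c i j a * c m a b =
    \sum_a (c m i a * c a j b + c m j a * c i a b).
  apply/eqP; rewrite -subr_eq0 -sumrB; apply/eqP; rewrite -[RHS](cJ i j m b).
  apply: eq_bigr => a _.
  by rewrite [c m i a]cA [c a j b]cA [c m a b]cA [c m j a]cA
             [c j m a]cA; ring.
under eq_bigr do under eq_bigr do under eq_bigr do rewrite J mulr_suml.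
under eq_bigr do under eq_bigr do under eq_bigr do under eq_bigr do rewrite mulrDl.
under eq_bigr do under eq_bigr do under eq_bigr do rewrite big_split/=.
under eq_bigr do under eq_bigr do rewrite big_split/=.
under eq_bigr do rewrite big_split/=.
rewrite big_split/= [X in _ + X](_ : _ =
  \sum_b \sum_i \sum_j \sum_a c m i a * c a j b * c i j b); last first.
  apply: eq_bigr => b _; rewrite exchange_big; apply: eq_bigr => i _.
  apply: eq_bigr => j _; apply: eq_bigr => a _.
  by rewrite [c j a b]cA [c j i b]cA; ring.
set X := \sum_b _.
suff -> : X = \sum_a \sum_b c m a b * sc_A a b by ring.
rewrite /X exchange_big; apply: eq_bigr => i _.
under eq_bigr do rewrite exchange_big/=.
rewrite exchange_big; apply: eq_bigr => a _.
rewrite /sc_A [in RHS]exchange_big mulr_sumr; apply: eq_bigr => b _.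
by rewrite mulr_sumr; apply: eq_bigr => j _; rewrite mulrC; ring.
Qed.

Lemma sc_DM (M : I -> I -> R) :
  \sum_a \sum_b sc_D a b * M a b =
  \sum_m sc_z m * \sum_a \sum_b c m a b * M a b.
Proof.
under [RHS]eq_bigr do rewrite mulr_sumr.
rewrite [RHS]exchange_big; apply: eq_bigr => a _.
under [RHS]eq_bigr do rewrite mulr_sumr.
rewrite [RHS]exchange_big; apply: eq_bigr => b _.
by rewrite /sc_D mulr_suml; apply: eq_bigr => m _; ring.
Qed.

Lemma sum_zz_sq (X : I -> I -> I -> R) (Y : I -> I -> I -> R) :
  \sum_a \sum_b (\sum_i \sum_j X a i j * Y b i j) * (sc_z a * sc_z b) =
  \sum_i \sum_j (\sum_a sc_z a * X a i j) * (\sum_b sc_z b * Y b i j).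
Proof.
have -> : \sum_a \sum_b (\sum_i \sum_j X a i j * Y b i j) * (sc_z a * sc_z b)
   = \sum_a \sum_b \sum_i \sum_j (sc_z a * X a i j) * (sc_z b * Y b i j).
  apply: eq_bigr => a _; apply: eq_bigr => b _.
  rewrite mulr_suml; apply: eq_bigr => i _.
  by rewrite mulr_suml; apply: eq_bigr => j _; ring.
under eq_bigr do rewrite exchange_big/=.
rewrite exchange_big; apply: eq_bigr => i _.
under eq_bigr do rewrite exchange_big/=.
rewrite exchange_big; apply: eq_bigr => j _.
rewrite mulr_suml; apply: eq_bigr => a _.
by rewrite mulr_sumr.
Qed.

(** This is (div Ric)(z) = 0, since div h (z) = <h, D> - h(z, z) for an invariant symmetric h. Both
    sides reduce to -(|D|^2 + tr D^2)/2: every bracket is orthogonal to z, [sc_cK] kills the Killing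
    term and [sc_cN] makes the A and N terms cancel. *)
Lemma sc_ric_zz :
  \sum_a \sum_b sc_ric a b * (sc_z a * sc_z b) =
  \sum_a \sum_b sc_D a b * sc_ric a b.
Proof.
have hA : \sum_a \sum_b sc_A a b * (sc_z a * sc_z b) =
    \sum_a \sum_b sc_D a b * sc_D a b.
  exact: (sum_zz_sq (fun a i j => c a i j) (fun b i j => c b i j)).
have hK : \sum_a \sum_b sc_K a b * (sc_z a * sc_z b) =
    \sum_a \sum_b sc_D b a * sc_D a b.
  exact: (sum_zz_sq (fun a i j => c a j i) (fun b i j => c b i j)).
have zc i j : \sum_a sc_z a * c i j a = 0.
  by rewrite -[RHS](sc_z_bracket i j); apply: eq_bigr => a _; rewrite mulrC.
have hN : \sum_a \sum_b sc_N a b * (sc_z a * sc_z b) = 0.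
  rewrite (sum_zz_sq (fun a i j => c i j a) (fun b i j => c i j b)).
  by rewrite big1// => i _; rewrite big1// => j _; rewrite zc mul0r.
have hD : \sum_a \sum_b (sc_D a b + sc_D b a) * (sc_z a * sc_z b) = 0.
  have hD1 : \sum_a \sum_b sc_D a b * (sc_z a * sc_z b) = 0.
    rewrite sc_DM big1// => m _; rewrite big1 ?mulr0// => a _.
    rewrite -[RHS](mul0r (sc_z a)) -[X in _ = X * _](zc m a) mulr_suml; apply: eq_bigr => b _.
    by ring.
  under eq_bigr do under eq_bigr do rewrite mulrDl.
  under eq_bigr do rewrite big_split/=.
  rewrite big_split/= hD1 add0r exchange_big -[RHS]hD1.
  by apply: eq_bigr => a _; apply: eq_bigr => b _; rewrite [sc_z b * _]mulrC.
have hDK : \sum_a \sum_b sc_D a b * sc_K a b = 0.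
  by rewrite sc_DM big1// => m _; rewrite sc_cK mulr0.
have hDN : \sum_a \sum_b sc_D a b * sc_N a b =
    2 * \sum_a \sum_b sc_D a b * sc_A a b.
  rewrite !sc_DM mulr_sumr; apply: eq_bigr => m _; rewrite sc_cN; ring.
have L : \sum_a \sum_b sc_ric a b * (sc_z a * sc_z b) =
  - 2^-1 * (\sum_a \sum_b sc_A a b * (sc_z a * sc_z b))
  - 2^-1 * (\sum_a \sum_b sc_K a b * (sc_z a * sc_z b))
  + 4^-1 * (\sum_a \sum_b sc_N a b * (sc_z a * sc_z b))
  - 2^-1 * (\sum_a \sum_b (sc_D a b + sc_D b a) * (sc_z a * sc_z b)).
  rewrite !mulr_sumr -!sumrB -big_split -sumrB/=; apply: eq_bigr => a _.
  rewrite !mulr_sumr -!sumrB -big_split -sumrB/=; apply: eq_bigr => b _.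
  by rewrite /sc_ric; ring.
have L' : \sum_a \sum_b sc_D a b * sc_ric a b =
  - 2^-1 * (\sum_a \sum_b sc_D a b * sc_A a b)
  - 2^-1 * (\sum_a \sum_b sc_D a b * sc_K a b)
  + 4^-1 * (\sum_a \sum_b sc_D a b * sc_N a b)
  - 2^-1 * (\sum_a \sum_b sc_D a b * sc_D a b)
  - 2^-1 * (\sum_a \sum_b sc_D b a * sc_D a b).
  rewrite !mulr_sumr -!sumrB -big_split -!sumrB/=; apply: eq_bigr => a _.
  rewrite !mulr_sumr -!sumrB -big_split -!sumrB/=; apply: eq_bigr => b _.
  by rewrite /sc_ric; ring.
by rewrite L L' hA hK hN hD hDK hDN; field.
Qed.

(** Pair dH(e_m, ., ., .) = 0 with H. Of its six terms the three with a bracket [e_m, .] are copies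
    of the left side, and the other three are copies of the right side with a minus sign. *)
Lemma sc_QD : \sum_a \sum_b sc_D a b * sc_Q a b =
  \sum_a \sum_b sc_E a b * sc_W a b.
Proof.
have -> : \sum_a \sum_b sc_E a b * sc_W a b =
    \sum_m sc_z m * \sum_a \sum_b sc_E a b * H m a b.
  under [RHS]eq_bigr do rewrite mulr_sumr.
  rewrite [RHS]exchange_big; apply: eq_bigr => a _.
  under [RHS]eq_bigr do rewrite mulr_sumr.
  rewrite [RHS]exchange_big; apply: eq_bigr => b _.
  by rewrite /sc_W mulr_sumr; apply: eq_bigr => m _; ring.
rewrite sc_DM; apply: eq_bigr => m _; congr (_ * _).
set q := LHS; set e := RHS.
pose T (F : I -> I -> I -> I -> R) :=
  \sum_x \sum_y \sum_u \sum_p F x y u p.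
have TD F G : T (fun x y u p => F x y u p + G x y u p) = T F + T G.
  rewrite /T -big_split; apply: eq_bigr => x _ /=.
  rewrite -big_split; apply: eq_bigr => y _ /=.
  by rewrite -big_split; apply: eq_bigr => u _ /=; rewrite -big_split.
have TE F G : (forall x y u p, F x y u p = G x y u p) -> T F = T G.
  by move=> FG; do 4 (apply: eq_bigr => ? _); exact: FG.
have rot F : T F = T (fun x y u p => F y u x p).
  exact: (sum3_rot (fun x y u => \sum_p F x y u p)).
have swp F : T F = T (fun x y u p => F y x u p).
  exact: (sum3_swap (fun x y u => \sum_p F x y u p)).
have qE : q = T (fun x y u p => c m x p * H p y u * H x y u).
  rewrite /q /T; apply: eq_bigr => x _.
  under eq_bigr do rewrite /sc_Q mulr_sumr.
  rewrite exchange_big; apply: eq_bigr => y _.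
  under eq_bigr do rewrite mulr_sumr.
  rewrite exchange_big; apply: eq_bigr => u _.
  by apply: eq_bigr => p _; ring.
have eE : e = T (fun x y u p => c x y p * H x y u * H m p u).
  rewrite /e /T; under eq_bigr do under eq_bigr do rewrite /sc_E mulr_suml.
  under eq_bigr do rewrite exchange_big/=.
  rewrite exchange_big/=; apply: eq_bigr => x _.
  under eq_bigr do under eq_bigr do rewrite mulr_suml.
  under eq_bigr do rewrite exchange_big/=.
  rewrite exchange_big/=; apply: eq_bigr => y _.
  by rewrite exchange_big.
have : T (fun x y u p => (c m x p * H p y u - c m y p * H p x u
  + c m u p * H p x y + c x y p * H p m u - c x u p * H p m y
  + c y u p * H p m x) * H x y u) = 0.
  rewrite /T big1// => x _; rewrite big1// => y _; rewrite big1// => u _.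
  by rewrite -mulr_suml dH mul0r.
have -> : T (fun x y u p => (c m x p * H p y u - c m y p * H p x u
    + c m u p * H p x y + c x y p * H p m u - c x u p * H p m y
    + c y u p * H p m x) * H x y u) =
  T (fun x y u p => c m x p * H p y u * H x y u) +
  T (fun x y u p => c m y p * H p x u * H y x u) +
  T (fun x y u p => c m u p * H p x y * H u x y) +
  - T (fun x y u p => c x y p * H x y u * H m p u) +
  - T (fun x y u p => c x u p * H x u y * H m p y) +
  - T (fun x y u p => c y u p * H y u x * H m p x).
  have TN F : - T F = T (fun x y u p => - F x y u p).
    by rewrite /T -sumrN; do 3 (apply: eq_bigr => ? _; rewrite -sumrN).
  rewrite !TN -!TD; apply: TE => x y u p.
  rewrite [H y x u]HA12 [H u x y]HA12 [H x u y]HA23 [H y u x]HA23 [H y x u]HA12.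
  by rewrite [H m p u]HA12 [H m p y]HA12 [H m p x]HA12; ring.
have t2 : q = T (fun x y u p => c m y p * H p x u * H y x u).
  by rewrite qE; exact: swp.
have t3 : q = T (fun x y u p => c m u p * H p x y * H u x y).
  by rewrite qE; exact: (etrans (rot _) (rot _)).
have t5 : e = T (fun x y u p => c x u p * H x u y * H m p y).
  by rewrite eE; exact: (etrans (rot _) (swp _)).
have t6 : e = T (fun x y u p => c y u p * H y u x * H m p x).
  by rewrite eE; exact: rot.
rewrite -qE -t2 -t3 -eE -t5 -t6; lra.
Qed.

Lemma sc_Qzz : \sum_a \sum_b sc_Q a b * (sc_z a * sc_z b) =
  \sum_a \sum_b sc_W a b * sc_W a b.
Proof.
exact: (sum_zz_sq (fun a i j => H a i j) (fun b i j => H b i j)).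
Qed.

Lemma sc_codA a b : sc_cod a b = - sc_cod b a.
Proof.
have WA : sc_W a b = - sc_W b a.
  by rewrite /sc_W -sumrN; apply: eq_bigr => m _; rewrite HA23; ring.
by rewrite /sc_cod WA; ring.
Qed.

(** Cyclic renaming and the antisymmetry of H make the three terms of d be contribute equally,
    whence the 3. *)
Lemma sc_Hdb (be : I -> I -> R) :
  \sum_x \sum_y \sum_u H x y u *
    \sum_p (- c x y p * be p u + c x u p * be p y - c y u p * be p x) =
  - 3 * \sum_a \sum_b sc_E a b * be a b.
Proof.
pose T (F : I -> I -> I -> R) := \sum_x \sum_y \sum_u F x y u.
have eE : \sum_a \sum_b sc_E a b * be a b =
    T (fun x y u => \sum_p H x y u * (c x y p * be p u)).
  rewrite /T; under eq_bigr do under eq_bigr do rewrite /sc_E mulr_suml.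
  under eq_bigr do rewrite exchange_big/=.
  rewrite exchange_big/=; apply: eq_bigr => x _.
  under eq_bigr do under eq_bigr do rewrite mulr_suml.
  under eq_bigr do rewrite exchange_big/=.
  rewrite exchange_big/=; apply: eq_bigr => y _.
  rewrite exchange_big; apply: eq_bigr => u _.
  by apply: eq_bigr => p _; ring.
have t2 : \sum_a \sum_b sc_E a b * be a b =
    T (fun x y u => \sum_p H x u y * (c x u p * be p y)).
  rewrite eE; exact: (etrans (sum3_rot _) (sum3_swap _)).
have t3 : \sum_a \sum_b sc_E a b * be a b =
    T (fun x y u => \sum_p H y u x * (c y u p * be p x)).
  rewrite eE; exact: sum3_rot.
set e := \sum_a _ in eE t2 t3 *.
have -> : - 3 * e = - e - e - e by ring.
rewrite {1}eE {1}t2 {1}t3 /T -!sumrN -!big_split; apply: eq_bigr => x _ /=.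
rewrite -!sumrN -!big_split; apply: eq_bigr => y _ /=.
rewrite -!sumrN -!big_split; apply: eq_bigr => u _ /=.
rewrite mulr_sumr -!sumrN -!big_split; apply: eq_bigr => p _ /=.
by rewrite [H x u y]HA23 [H y u x]HA23 [H y x u]HA12; ring.
Qed.

(* The divergence terms of the variation of the scalar curvature cancel: the
   Ricci part by the contracted Bianchi identity along the mean curvature
   vector z, the remaining part by closedness of H. *)
Lemma sc_evolution : let be a b := - sc_cod a b in
  2^-1 * (\sum_a \sum_b sc_h a b * sc_A a b)
  - 4^-1 * (\sum_a \sum_b sc_h a b * sc_N a b)
  + 2^-1 * (\sum_a \sum_b sc_h a b * sc_K a b)
  + \sum_a \sum_b sc_h a b * (sc_z a * sc_z b)
  + 4^-1 * (\sum_a \sum_b sc_h a b * sc_Q a b)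
  + 2^-1 * (\sum_a \sum_b sc_E a b * be a b)
  = 2^-1 * (\sum_a \sum_b sc_h a b ^+ 2)
  + 2^-1 * (\sum_a \sum_b be a b ^+ 2).
Proof.
move=> be.
have hC a b : sc_h a b = sc_h b a.
  have AC : sc_A a b = sc_A b a.
    by apply: eq_bigr => i _; apply: eq_bigr => j _; rewrite mulrC.
  have NC : sc_N a b = sc_N b a.
    by apply: eq_bigr => i _; apply: eq_bigr => j _; rewrite mulrC.
  have QC : sc_Q a b = sc_Q b a.
    by apply: eq_bigr => i _; apply: eq_bigr => j _; rewrite mulrC.
  by rewrite /sc_h /sc_ric AC NC QC sc_KC; ring.
pose X := \sum_a \sum_b sc_h a b * (sc_z a * sc_z b).
pose Y := \sum_a \sum_b sc_D a b * sc_h a b.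
have Y' : Y = \sum_a \sum_b sc_h a b * sc_D b a.
  rewrite /Y exchange_big; apply: eq_bigr => a _; apply: eq_bigr => b _.
  by rewrite hC mulrC.
have e1 : X - Y = 2^-1 * (\sum_a \sum_b sc_Q a b * (sc_z a * sc_z b))
    - 2^-1 * (\sum_a \sum_b sc_D a b * sc_Q a b)
    - 2 * (\sum_a \sum_b sc_ric a b * (sc_z a * sc_z b))
    + 2 * (\sum_a \sum_b sc_D a b * sc_ric a b).
  rewrite /X /Y !mulr_sumr -!sumrB -big_split/=; apply: eq_bigr => a _.
  rewrite !mulr_sumr -!sumrB -big_split/=; apply: eq_bigr => b _.
  by rewrite /sc_h; ring.
(* Now X - Y = (WW - EW)/2 in the notation below, while [e2] and [e3] give EB/2 = BB/2 + (EW -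
   WW)/2. The divergence terms cancel in the total. *)
rewrite sc_Qzz sc_QD sc_ric_zz in e1.
pose EB := \sum_a \sum_b sc_E a b * be a b.
have EB' : EB = \sum_a \sum_b sc_E b a * be b a by rewrite /EB exchange_big.
pose WB := \sum_a \sum_b sc_W a b * be a b.
pose WW := \sum_a \sum_b sc_W a b * sc_W a b.
pose EW := \sum_a \sum_b sc_E a b * sc_W a b.
have EW' : EW = \sum_a \sum_b sc_E b a * sc_W b a by rewrite /EW exchange_big.
pose BB := \sum_a \sum_b be a b ^+ 2.
have WA a b : sc_W b a = - sc_W a b.
  by rewrite /sc_W -sumrN; apply: eq_bigr => m _; rewrite HA23; ring.
have e2 : 2^-1 * EB + 2^-1 * EB = BB + WB.
  rewrite {2}EB' /EB /BB /WB !mulr_sumr -!big_split; apply: eq_bigr => a _ /=.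
  rewrite !mulr_sumr -!big_split; apply: eq_bigr => b _ /=.
  by rewrite /be [sc_cod b a]sc_codA /sc_cod; ring.
have e3 : WB = - WW + (2^-1 * EW + 2^-1 * EW).
  rewrite {2}EW' /EW /WW /WB !mulr_sumr -sumrN -!big_split.
  apply: eq_bigr => a _ /=.
  rewrite !mulr_sumr -sumrN -!big_split; apply: eq_bigr => b _ /=.
  by rewrite /be [sc_W b a]WA /sc_cod; ring.
pose hh := \sum_a \sum_b sc_h a b ^+ 2.
have e4 : 2^-1 * (\sum_a \sum_b sc_h a b * sc_A a b)
  - 4^-1 * (\sum_a \sum_b sc_h a b * sc_N a b)
  + 2^-1 * (\sum_a \sum_b sc_h a b * sc_K a b)
  + 4^-1 * (\sum_a \sum_b sc_h a b * sc_Q a b)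
  = 2^-1 * hh - 2^-1 * Y - 2^-1 * Y.
  rewrite {2}Y' /Y /hh !mulr_sumr -!sumrB -!big_split/=; apply: eq_bigr => a _.
  rewrite !mulr_sumr -!sumrB -!big_split/=; apply: eq_bigr => b _.
  by rewrite /sc_h /sc_ric; field.
move: e1 e2 e3 e4; rewrite -/WW -/EW -/X -/EB -/hh -/BB; lra.
Qed.

End structure_constants.

(** * Frames and traces *)

Section scalar_forms.
Context {R : realType} {V : vectType R} (f : V -> R) (fl : scalar f).

Lemma scalar_form0 : f 0 = 0.
Proof. by have := fl (-1) 0 0; rewrite scaler0 addr0 mulN1r addNr. Qed.

Lemma scalar_formD u v : f (u + v) = f u + f v.
Proof. by have := fl 1 u v; rewrite scale1r mul1r. Qed.

Lemma scalar_formZ a u : f (a *: u) = a * f u.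
Proof. by have := fl a u 0; rewrite !addr0 scalar_form0 addr0. Qed.

Lemma scalar_formN u : f (- u) = - f u.
Proof. by rewrite -scaleN1r scalar_formZ mulN1r. Qed.

Lemma scalar_formB u v : f (u - v) = f u - f v.
Proof. by rewrite scalar_formD scalar_formN. Qed.

Lemma scalar_form_sum (I : finType) (c : I -> R) (w : I -> V) :
  f (\sum_i c i *: w i) = \sum_i c i * f (w i).
Proof.
elim/big_rec2: _ => [|i y1 y2 _ <-]; first exact: scalar_form0.
by rewrite scalar_formD scalar_formZ.
Qed.

End scalar_forms.

Section frames.
Context {R : realType} {V : vectType R} (g : V -> V -> R).
Hypothesis gm : metric g.
Local Notation n := (\dim {:V}).

Lemma metric_scalarl Y : scalar (fun X => g X Y).
Proof. by case: gm => [[gl _] _ _]; exact: gl. Qed.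

Lemma metric_scalarr X : scalar (g X).
Proof. by case: gm => [[_ gr] _ _]; exact: gr. Qed.

Lemma metricC X Y : g X Y = g Y X. Proof. by case: gm. Qed.

Section orthonormal_frame.
Context (e : n.-tuple V) (eo : Defs.orthonormal g e).

Lemma orthonormal_basis : basis_of fullv e.
Proof.
have fe : free e.
  apply/freeP => c; move/(congr1 (g^~ _)) => c0 i.
  have := c0 e`_i; rewrite (scalar_form_sum (metric_scalarl _)).
  rewrite (scalar_form0 (metric_scalarl _)).
  rewrite (bigD1 i)//= eo eqxx mulr1 big1 ?addr0// => j /negPf ji.
  by rewrite eo ji mulr0.
by rewrite basisEfree fe subvf size_tuple leqnn.
Qed.

Lemma frame_expand v : v = \sum_(i < n) g v e`_i *: e`_i.
Proof.
rewrite {1}(coord_basis orthonormal_basis (memvf v)); apply: eq_bigr => i _.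
congr (_ *: _); rewrite {2}(coord_basis orthonormal_basis (memvf v)).
rewrite (scalar_form_sum (metric_scalarl _)) (bigD1 i)//= eo eqxx mulr1.
by rewrite big1 ?addr0// => j /negPf ji; rewrite eo ji mulr0.
Qed.

Lemma frame_form (f : V -> R) v : scalar f ->
  f v = \sum_(i < n) g v e`_i * f e`_i.
Proof. by move=> fl; rewrite {1}(frame_expand v) (scalar_form_sum fl). Qed.

Lemma frame_parseval u v : g u v = \sum_(i < n) g u e`_i * g v e`_i.
Proof.
rewrite (frame_form u (metric_scalarl v)).
by apply: eq_bigr => i _; rewrite [g _ v]metricC.
Qed.

End orthonormal_frame.

Section change_of_basis.
Context (e f : n.-tuple V) (eo : Defs.orthonormal g e) (fb : basis_of fullv f).

Definition gram : 'M[R]_n := \matrix_(i, j) g f`_i f`_j.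

Let A : 'M[R]_n := \matrix_(i, a) coord f a e`_i.

Let eE i : e`_i = \sum_(a < n) coord f a e`_i *: f`_a.
Proof. exact: coord_basis (memvf _). Qed.

(** The rows of A are the coordinates of e in the basis f, so orthonormality of e reads A G A^T = 1.
    Hence G is invertible with inverse A^T A. *)
Let AGA : A *m (gram *m A^T) = 1%:M.
Proof.
apply/matrixP => i j; rewrite !mxE -eo {1}eE.
rewrite (scalar_form_sum (metric_scalarl _)).
apply: eq_bigr => a _; rewrite !mxE; congr (_ * _).
rewrite {1}(eE j) (scalar_form_sum (metric_scalarr _)).
by apply: eq_bigr => b _; rewrite !mxE mulrC.
Qed.

Lemma gram_unit : gram \in unitmx.
Proof. by have := mulmx1C AGA; rewrite -mulmxA => /mulmx1_unit[]. Qed.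

Let invE : invmx gram = A^T *m A.
Proof.
have /(congr1 (mulmx (invmx gram))) := mulmx1C AGA.
by rewrite -mulmxA (mulKmx gram_unit) mulmx1.
Qed.

Lemma invmx_gramE a b :
  invmx gram a b = \sum_(i < n) coord f a e`_i * coord f b e`_i.
Proof. by rewrite invE !mxE; apply: eq_bigr => i _; rewrite !mxE. Qed.

(** This eliminates the chosen frame: for a fixed basis f the metric enters the right-hand trace
    only through its inverse Gram matrix and through phi itself. *)
Lemma frame_trace (phi : V -> V -> R) :
    (forall Y, scalar (fun X => phi X Y)) -> (forall X, scalar (phi X)) ->
  \sum_(i < n) phi e`_i e`_i =
  \sum_(a < n) \sum_(b < n) invmx gram a b * phi f`_a f`_b.
Proof.
move=> pl pr; under [RHS]eq_bigr do under eq_bigr do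
  rewrite invmx_gramE mulr_suml.
under [RHS]eq_bigr do rewrite exchange_big/=.
rewrite [RHS]exchange_big; apply: eq_bigr => i _.
rewrite {1}eE (scalar_form_sum (pl _)); apply: eq_bigr => a _.
rewrite [X in phi _ X](eE i) (scalar_form_sum (pr _)) mulr_sumr.
by apply: eq_bigr => b _; ring.
Qed.

Lemma linear_trace (L : V -> V) : linear L ->
  \sum_(i < n) g (L e`_i) e`_i = \sum_(a < n) coord f a (L f`_a).
Proof.
move=> Ll; have Ls Y : scalar (fun X => g (L X) Y).
  by move=> a u v; rewrite Ll (metric_scalarl Y).
rewrite (frame_trace Ls) => [|X]; last exact: metric_scalarr.
apply: eq_bigr => a _.
have fc : scalar (fun v => coord f a v) by move=> k u v; rewrite linearP.
rewrite (frame_form eo (L f`_a) fc).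
under eq_bigr do rewrite invmx_gramE mulr_suml.
rewrite exchange_big; apply: eq_bigr => i _ /=.
have -> : g (L f`_a) e`_i = \sum_(b < n) coord f b e`_i * g (L f`_a) f`_b.
  by rewrite {1}eE (scalar_form_sum (metric_scalarr _)).
by rewrite mulr_suml; apply: eq_bigr => b _; ring.
Qed.

End change_of_basis.
End frames.

(** * Curvature and codifferential in an orthonormal frame *)

Section lie_algebra.
Context {R : realType} {V : vectType R} (br : V -> V -> V).
Hypothesis hbr : lie_bracket br.
Local Notation n := (\dim {:V}).

Lemma bracket_linearl Y : linear (fun X => br X Y).
Proof. by case: hbr => [[bl _] _ _]; exact: bl. Qed.

Lemma bracket_linearr X : linear (br X).
Proof. by case: hbr => [[_ b_r] _ _]; exact: b_r. Qed.

Lemma bracketC X Y : br X Y = - br Y X.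
Proof.
apply/eqP; rewrite -addr_eq0; apply/eqP.
have bra Z : br Z Z = 0 by case: hbr.
have := bra (1 *: X + Y).
by rewrite bracket_linearl !bracket_linearr !bra !scale1r addr0 add0r.
Qed.

Lemma bracketNr X Y : br X (- Y) = - br X Y.
Proof.
have b0 : br X 0 = 0.
  by have := bracket_linearr X (-1) 0 0; rewrite scaler0 addr0 scaleN1r addNr.
by have := bracket_linearr X (-1) Y 0; rewrite !addr0 b0 addr0 !scaleN1r.
Qed.

Lemma bracket_jacobi X Y Z : br X (br Y Z) + br Y (br Z X) + br Z (br X Y) = 0.
Proof. by case: hbr. Qed.

(** The trace of ad X, and next the Killing form, are taken in coordinates of f. No metric enters,
    so both are constant along the flow. *)
Definition ad_trace (f : n.-tuple V) X := \sum_(a < n) coord f a (br X f`_a).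

Definition killing (f : n.-tuple V) X Y :=
  \sum_(a < n) coord f a (br X (br Y f`_a)).

Lemma ad_trace_scalar (f : n.-tuple V) : scalar (ad_trace f).
Proof.
move=> a u v; rewrite /ad_trace mulr_sumr -big_split; apply: eq_bigr => i _.
by rewrite bracket_linearl linearP.
Qed.

Lemma killing_scalarl (f : n.-tuple V) Y : scalar (fun X => killing f X Y).
Proof.
move=> a u v; rewrite /killing mulr_sumr -big_split; apply: eq_bigr => i _.
by rewrite bracket_linearl linearP.
Qed.

Lemma killing_scalarr (f : n.-tuple V) X : scalar (killing f X).
Proof.
move=> a u v; rewrite /killing mulr_sumr -big_split; apply: eq_bigr => i _.
by rewrite bracket_linearl bracket_linearr linearP.
Qed.

Section metric_tensors.
Context (g : V -> V -> R).
Hypothesis gm : metric g.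
Local Notation gam X Y Z := (g (br X Y) Z).

Lemma gam_scalar1 Y Z : scalar (fun X => gam X Y Z).
Proof. by move=> a u v; rewrite bracket_linearl (metric_scalarl gm). Qed.

Lemma gam_scalar2 X Z : scalar (fun Y => gam X Y Z).
Proof. by move=> a u v; rewrite bracket_linearr (metric_scalarl gm). Qed.

Lemma gam_scalar3 X Y : scalar (fun Z => gam X Y Z).
Proof. exact: metric_scalarr. Qed.

Lemma gamC X Y Z : gam X Y Z = - gam Y X Z.
Proof. by rewrite bracketC (scalar_formN (metric_scalarl gm _)). Qed.

Lemma koszul_scalar1 Y Z : scalar (fun X => koszul br g X Y Z).
Proof.
by move=> a u v; rewrite /koszul gam_scalar1 gam_scalar2 gam_scalar3; ring.
Qed.

Lemma koszul_scalar3 X Y : scalar (fun Z => koszul br g X Y Z).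
Proof.
by move=> a u v; rewrite /koszul gam_scalar1 gam_scalar2 gam_scalar3; ring.
Qed.

(* An antisymmetrized preimage of the structure constants, so that ring can
   see their antisymmetry. *)
Let gam_split : exists d : V -> V -> V -> R,
  forall X Y Z, gam X Y Z = d X Y Z - d Y X Z.
Proof.
exists (fun X Y Z => 2^-1 * gam X Y Z) => X Y Z.
by rewrite [gam Y X Z]gamC; field.
Qed.

Local Notation e := (onframe g).
Let eo : Defs.orthonormal g e := onframeP gm.

Lemma killingE (f : n.-tuple V) X Y : basis_of fullv f ->
  killing f X Y =
  \sum_(i < n) \sum_(m < n) gam X e`_m e`_i * gam Y e`_i e`_m.
Proof.
move=> fb; rewrite /killing.
have Ll : linear (fun Z => br X (br Y Z)).
  by move=> a u v; rewrite !bracket_linearr.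
rewrite -(linear_trace gm eo fb Ll); apply: eq_bigr => i _.
rewrite (frame_form gm eo (br Y e`_i) (gam_scalar2 X _)).
by apply: eq_bigr => m _; rewrite mulrC.
Qed.

Lemma killingC (f : n.-tuple V) X Y : basis_of fullv f ->
  killing f X Y = killing f Y X.
Proof.
move=> fb; rewrite !killingE// exchange_big; apply: eq_bigr => i _.
by apply: eq_bigr => m _; rewrite mulrC.
Qed.

Lemma ad_traceE (f : n.-tuple V) X : basis_of fullv f ->
  ad_trace f X = \sum_(i < n) gam X e`_i e`_i.
Proof.
by move=> fb; rewrite /ad_trace -(linear_trace gm eo fb (bracket_linearr X)).
Qed.

Lemma ad_trace_bracket (f : n.-tuple V) X Y : basis_of fullv f ->
  ad_trace f (br X Y) = 0.
Proof.
move=> fb; have J Z : br (br X Y) Z = br X (br Y Z) - br Y (br X Z).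
  have := bracket_jacobi X Y Z; rewrite [br Z (br X Y)]bracketC.
  rewrite [br Z X]bracketC bracketNr => /eqP; rewrite subr_eq0 => /eqP <-.
  by [].
have -> : ad_trace f (br X Y) = killing f X Y - killing f Y X.
  by rewrite -sumrB; apply: eq_bigr => i _; rewrite J linearB.
by rewrite killingC// subrr.
Qed.

(** Antisymmetry of [koszul] in its last two arguments, that is metric compatibility, turns each
    iterated covariant derivative into a product of two Koszul terms. *)
Lemma Ric_koszul X Y : Ric br g X Y =
  \sum_(i < n) \sum_(m < n)
    (- (koszul br g X Y e`_m * koszul br g e`_i e`_i e`_m)
     + koszul br g e`_i Y e`_m * koszul br g X e`_i e`_m
     - gam e`_i X e`_m * koszul br g e`_m Y e`_i).
Proof.
have kA A B C : koszul br g A B C = - koszul br g A C B.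
  rewrite /koszul; have [d dE] := gam_split; rewrite !dE; ring.
apply: eq_bigr => i _; rewrite /curvature.
rewrite !(scalar_formB (metric_scalarl gm _)) !levi_civitaE//.
rewrite !sumrB big_split/=; congr (_ + _ - _).
- rewrite kA /levi_civita (scalar_form_sum (koszul_scalar3 _ _)) -sumrN.
  by apply: eq_bigr => m _.
- rewrite kA opprK /levi_civita (scalar_form_sum (koszul_scalar3 _ _)).
  by apply: eq_bigr => m _.
- exact: (frame_form gm eo (br e`_i X) (koszul_scalar1 Y e`_i)).
Qed.

(** The two sides are double sums over the frame that agree only after exchange of i and m, so the
    difference is shown to be antisymmetric and summed by [sum_antisym]. *)
Lemma RicE (f : n.-tuple V) X Y : basis_of fullv f -> Ric br g X Y =
  - 2^-1 * (\sum_(i < n) g (br X e`_i) (br Y e`_i))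
  - 2^-1 * killing f X Y
  + 4^-1 * (\sum_(i < n) \sum_(m < n) gam e`_i e`_m X * gam e`_i e`_m Y)
  - 2^-1 * (\sum_(m < n) ad_trace f e`_m * (gam e`_m X Y + gam e`_m Y X)).
Proof.
move=> fb.
(* Half of this vanishing trace of ad [X, Y] is added below: it compensates the part of the first
   Koszul product that is antisymmetric in X and Y. *)
have Z0 : \sum_(i < n) \sum_(m < n) gam X Y e`_m * gam e`_m e`_i e`_i = 0.
  rewrite -[RHS](ad_trace_bracket X Y fb) ad_traceE//; apply: eq_bigr => i _.
  exact/esym/(frame_form gm eo (br X Y) (gam_scalar1 e`_i e`_i)).
rewrite Ric_koszul.
rewrite -[LHS]addr0 -[X in _ + X = _](mulr0 2^-1) -[X in _ + _ * X = _]Z0.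
under [X in - 2^-1 * X]eq_bigr do rewrite (frame_parseval gm eo).
rewrite killingE//.
under [X in _ = _ - _ * X]eq_bigr do rewrite ad_traceE// mulr_suml.
rewrite [X in _ = _ - _ * X]exchange_big/=.
apply/eqP; rewrite -subr_eq0; apply/eqP.
rewrite -[RHS](@sum_antisym R 'I_n (fun i m =>
    (- (koszul br g X Y e`_m * koszul br g e`_i e`_i e`_m)
     + koszul br g e`_i Y e`_m * koszul br g X e`_i e`_m
     - gam e`_i X e`_m * koszul br g e`_m Y e`_i)
   + 2^-1 * (gam X Y e`_m * gam e`_m e`_i e`_i)
   - (- 2^-1 * (gam X e`_i e`_m * gam Y e`_i e`_m)
      - 2^-1 * (gam X e`_m e`_i * gam Y e`_i e`_m)
      + 4^-1 * (gam e`_i e`_m X * gam e`_i e`_m Y)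
      - 2^-1 * (gam e`_m e`_i e`_i * (gam e`_m X Y + gam e`_m Y X))))).
  rewrite !mulr_sumr -!sumrB -!big_split -!sumrB; apply: eq_bigr => i _ /=.
  rewrite !mulr_sumr -!sumrB -!big_split -!sumrB; apply: eq_bigr => m _ /=.
  by [].
move=> i m; rewrite /koszul; have [d dE] := gam_split; rewrite !dE.
by field.
Qed.

Lemma RicC X Y : Ric br g X Y = Ric br g Y X.
Proof.
rewrite !(RicE _ _ (orthonormal_basis gm eo)) killingC; last first.
  exact: (orthonormal_basis gm eo).
congr (_ * _ - _ + _ * _ - _ * _).
- by apply: eq_bigr => i _; rewrite (metricC gm).
- by apply: eq_bigr => i _; apply: eq_bigr => m _; rewrite mulrC.
- by apply: eq_bigr => m _; rewrite addrC.
Qed.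

Lemma scalar_curvatureE (f : n.-tuple V) : basis_of fullv f ->
  scalar_curvature br g =
  - 4^-1 * (\sum_(i < n) \sum_(j < n) g (br e`_i e`_j) (br e`_i e`_j))
  - 2^-1 * (\sum_(i < n) killing f e`_i e`_i)
  - \sum_(i < n) ad_trace f e`_i * ad_trace f e`_i.
Proof.
move=> fb; rewrite /scalar_curvature.
under eq_bigr do rewrite (RicE _ _ fb).
rewrite !sumrB big_split/= sumrB -!mulr_sumr.
have -> : \sum_(i < n) \sum_(j < n) \sum_(k < n)
    gam e`_j e`_k e`_i * gam e`_j e`_k e`_i =
    \sum_(i < n) \sum_(j < n) g (br e`_i e`_j) (br e`_i e`_j).
  under [RHS]eq_bigr do under eq_bigr do rewrite (frame_parseval gm eo).
  by rewrite [RHS]sum3_rot.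
have -> : \sum_(i < n) \sum_(m < n) ad_trace f e`_m *
    (gam e`_m e`_i e`_i + gam e`_m e`_i e`_i) =
    2 * \sum_(i < n) ad_trace f e`_i * ad_trace f e`_i.
  rewrite exchange_big mulr_sumr; apply: eq_bigr => m _.
  rewrite {3}ad_traceE// mulr_sumr mulr_sumr; apply: eq_bigr => i _; ring.
by field.
Qed.

End metric_tensors.
End lie_algebra.

Section alternating_forms.
Context {R : realType} {V : vectType R}.

Lemma two_form_scalarl (b : V -> V -> R) Y : two_form b ->
  scalar (fun X => b X Y).
Proof. by move=> [[bl _] _]; exact: bl. Qed.

Lemma two_form_scalarr (b : V -> V -> R) X : two_form b -> scalar (b X).
Proof. by move=> [[_ b_r] _]; exact: b_r. Qed.

Lemma alternating_antisym (b : V -> V -> R) :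
  (forall Y, scalar (fun X => b X Y)) -> (forall X, scalar (b X)) ->
  (forall X, b X X = 0) -> forall X Y, b X Y = - b Y X.
Proof.
move=> bl b_r ba X Y; have := ba (1 *: X + Y).
rewrite (bl _ 1) !(b_r _ 1) !ba; lra.
Qed.

Lemma two_formC (b : V -> V -> R) : two_form b -> forall X Y, b X Y = - b Y X.
Proof.
move=> bf; apply: alternating_antisym.
- by move=> Y; exact: two_form_scalarl.
- by move=> X; exact: two_form_scalarr.
- by case: bf.
Qed.

Context (H : V -> V -> V -> R) (Hf : three_form H).

Lemma three_form_scalar1 Y Z : scalar (fun X => H X Y Z).
Proof. by case: Hf. Qed.

Lemma three_form_scalar2 X Z : scalar (fun Y => H X Y Z).
Proof. by case: Hf => H23 _ _ _; case: (H23 X) => h _; exact: h. Qed.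

Lemma three_form_scalar3 X Y : scalar (fun Z => H X Y Z).
Proof. by case: Hf => H23 _ _ _; case: (H23 X) => _ h; exact: h. Qed.

Lemma three_formA12 X Y Z : H X Y Z = - H Y X Z.
Proof.
apply: (@alternating_antisym (fun X Y => H X Y Z)) => [W|W|W].
- exact: three_form_scalar1.
- exact: three_form_scalar2.
- by case: Hf.
Qed.

Lemma three_formA23 X Y Z : H X Y Z = - H X Z Y.
Proof.
apply: (@alternating_antisym (H X)) => [W|W|W].
- exact: three_form_scalar2.
- exact: three_form_scalar3.
- by case: Hf.
Qed.

End alternating_forms.

Section forms_on_lie_algebra.
Context {R : realType} {V : vectType R} (br : V -> V -> V).
Hypothesis hbr : lie_bracket br.
Local Notation n := (\dim {:V}).

Lemma d2_three_form (b : V -> V -> R) : two_form b -> three_form (d2 br b).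
Proof.
move=> bf; have bl := two_form_scalarl _ bf; have b_r := two_form_scalarr _ bf.
have ba X : b X X = 0 by case: bf.
have bra X : br X X = 0 by case: hbr.
have b0 Y : b 0 Y = 0 by exact: (scalar_form0 (bl Y)).
have bN X Y : b (- X) Y = - b X Y by exact: (scalar_formN (bl Y)).
split=> [X|Y Z|X Y|X Y].
- have h2 Z : scalar (fun Y => d2 br b X Y Z).
    move=> a u v; rewrite /d2 (bracket_linearl hbr) (bracket_linearr hbr).
    by rewrite !bl !b_r; ring.
  have h3 Y : scalar (fun Z => d2 br b X Y Z).
    move=> a u v; rewrite /d2 !(bracket_linearr hbr).
    by rewrite !bl !b_r; ring.
  by split=> [Y|Y]; [exact: h2|exact: h3].
- by move=> a u v; rewrite /d2 !(bracket_linearl hbr) !bl !b_r; ring.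
- by rewrite /d2 bra b0 oppr0 add0r subrr.
- by rewrite /d2 bra b0 subr0 addNr.
Qed.

Lemma flux_three_form (H0 : V -> V -> V -> R) (b : V -> V -> R) :
  three_form H0 -> two_form b -> three_form (flux br H0 b).
Proof.
move=> H0f /d2_three_form df; split=> [X|Y Z|X Y|X Y]; rewrite /flux.
- have h2 Z : scalar (fun Y => H0 X Y Z + d2 br b X Y Z).
    move=> a u v.
    by rewrite (three_form_scalar2 H0f) (three_form_scalar2 df); ring.
  have h3 Y : scalar (fun Z => H0 X Y Z + d2 br b X Y Z).
    move=> a u v.
    by rewrite (three_form_scalar3 H0f) (three_form_scalar3 df); ring.
  by split=> [Y|Y]; [exact: h2|exact: h3].
- by move=> a u v; rewrite (three_form_scalar1 H0f) (three_form_scalar1 df); ring.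
- by case: H0f => _ _ -> _; case: df => _ _ -> _; rewrite addr0.
- by case: H0f => _ _ _ ->; case: df => _ _ _ ->; rewrite addr0.
Qed.

(** What remains is d(db) = 0: terms b([[A, B], C], D) cancel in triples by the Jacobi identity,
    terms b([A, B], [C, D]) in pairs by antisymmetry. *)
Lemma flux_closed (H0 : V -> V -> V -> R) (b : V -> V -> R) :
  (forall W X Y Z, d3 br H0 W X Y Z = 0) -> two_form b ->
  forall W X Y Z, d3 br (flux br H0 b) W X Y Z = 0.
Proof.
move=> dH0 bf W X Y Z.
have bl := two_form_scalarl _ bf; have b_r := two_form_scalarr _ bf.
have bC := two_formC bf.
have -> : d3 br (flux br H0 b) W X Y Z =
    d3 br H0 W X Y Z + d3 br (d2 br b) W X Y Z.
  by rewrite /d3 /flux; ring.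
rewrite dH0 add0r.
have J A B C D : b (br (br A B) C) D - b (br (br A C) B) D
    + b (br (br B C) A) D = 0.
  have := bracket_jacobi hbr A B C.
  rewrite [br A (br B C)](bracketC hbr) [br B (br C A)](bracketC hbr).
  rewrite [br C (br A B)](bracketC hbr).
  have -> : br (br C A) B = - br (br A C) B.
    rewrite [br C A](bracketC hbr) [LHS](bracketC hbr) (bracketNr hbr) opprK.
    exact: (bracketC hbr).
  move=> /(congr1 (fun v => b v D)).
  rewrite (scalar_form0 (bl D)) !(scalar_formD (bl D)) !(scalar_formN (bl D)).
  lra.
have := J W X Y Z; have := J W X Z Y; have := J W Y Z X; have := J X Y Z W.
rewrite /d3 /d2.
rewrite [b (br Y Z) (br W X)]bC [b (br X Z) (br W Y)]bC [b (br X Y) (br W Z)]bC.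
lra.
Qed.

Section metric_codifferential.
Context (g : V -> V -> R).
Hypothesis gm : metric g.
Local Notation e := (onframe g).
Let eo : Defs.orthonormal g e := onframeP gm.

Lemma codiff3E (f : n.-tuple V) (H : V -> V -> V -> R) X Y :
  basis_of fullv f -> three_form H -> codiff3 br g H X Y =
  \sum_(m < n) ad_trace br f e`_m * H e`_m X Y
  - 2^-1 * (\sum_(i < n) \sum_(m < n) g (br e`_i e`_m) X * H e`_i e`_m Y)
  + 2^-1 * (\sum_(i < n) \sum_(m < n) g (br e`_i e`_m) Y * H e`_i e`_m X).
Proof.
move=> fb Hf.
(* Antisymmetrized preimages of the bracket terms and of H, so that [field] sees both
   antisymmetries. *)
have [d dE] : exists d : V -> V -> V -> R,
    forall X Y Z, g (br X Y) Z = d X Y Z - d Y X Z.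
  exists (fun X Y Z => 2^-1 * g (br X Y) Z) => A B C.
  by rewrite [g (br B A) C](gamC hbr gm); field.
have [h hE] : exists h : V -> V -> V -> R,
    forall X Y Z, H X Y Z = h X Y Z - h Y X Z.
  exists (fun X Y Z => 2^-1 * H X Y Z) => A B C.
  by rewrite [H B A C](three_formA12 Hf); field.
have -> : codiff3 br g H X Y = \sum_(i < n) \sum_(m < n)
    (koszul br g e`_i e`_i e`_m * H e`_m X Y +
     koszul br g e`_i X e`_m * H e`_i e`_m Y
     - koszul br g e`_i Y e`_m * H e`_i e`_m X).
  rewrite /codiff3 -sumrN; apply: eq_bigr => i _.
  rewrite /covariant3 !opprD !opprK /levi_civita.
  rewrite (scalar_form_sum (three_form_scalar1 Hf _ _)).
  rewrite (scalar_form_sum (three_form_scalar2 Hf _ _)).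
  rewrite (scalar_form_sum (three_form_scalar3 Hf _ _)).
  rewrite -!big_split; apply: eq_bigr => m _ /=.
  by rewrite [H e`_i X e`_m](three_formA23 Hf); ring.
under [X in _ = X - _ + _]eq_bigr do rewrite (ad_traceE hbr gm _ fb) mulr_suml.
rewrite [X in _ = X - _ + _]exchange_big/=.
apply/eqP; rewrite -subr_eq0; apply/eqP.
rewrite -[RHS](@sum_antisym R 'I_n (fun i m =>
    (koszul br g e`_i e`_i e`_m * H e`_m X Y +
     koszul br g e`_i X e`_m * H e`_i e`_m Y
     - koszul br g e`_i Y e`_m * H e`_i e`_m X)
   - (g (br e`_m e`_i) e`_i * H e`_m X Y
      - 2^-1 * (g (br e`_i e`_m) X * H e`_i e`_m Y)
      + 2^-1 * (g (br e`_i e`_m) Y * H e`_i e`_m X)))).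
  rewrite !mulr_sumr -!sumrB -!big_split -!sumrB; apply: eq_bigr => i _ /=.
  by rewrite !mulr_sumr -!sumrB -!big_split -!sumrB; apply: eq_bigr => m _ /=.
move=> i m; rewrite /koszul !dE [H e`_i e`_m Y]hE [H e`_m e`_i Y]hE.
rewrite [H e`_i e`_m X]hE [H e`_m e`_i X]hE.
by field.
Qed.

End metric_codifferential.
End forms_on_lie_algebra.

(** * Contractions with the inverse metric *)

Section contraction.
Context {R : realType} {V : vectType R}.
Local Notation n := (\dim {:V}).

Definition contract (P : 'I_n -> 'I_n -> R) (F : 'I_n -> 'I_n -> R) : R :=
  \sum_(a < n) \sum_(b < n) P a b * F a b.

Lemma scalar_contract (P : 'I_n -> 'I_n -> R) (F : V -> 'I_n -> 'I_n -> R) :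
  (forall a b, scalar (fun X => F X a b)) ->
  scalar (fun X => contract P (F X)).
Proof.
move=> Fl k u v; rewrite /contract mulr_sumr -big_split; apply: eq_bigr => a _.
rewrite mulr_sumr -big_split; apply: eq_bigr => b _ /=.
by rewrite (Fl a b); ring.
Qed.

Lemma scalar_mull (f : V -> R) k : scalar f -> scalar (fun X => k * f X).
Proof. by move=> fl a u v; rewrite fl; ring. Qed.

Lemma scalar_mulr (f : V -> R) k : scalar f -> scalar (fun X => f X * k).
Proof. by move=> fl a u v; rewrite fl; ring. Qed.

Lemma scalar_add (f h : V -> R) :
  scalar f -> scalar h -> scalar (fun X => f X + h X).
Proof. by move=> fl hl a u v; rewrite fl hl; ring. Qed.

Context (g : V -> V -> R) (gm : metric g) (f : n.-tuple V).
Hypothesis fb : basis_of fullv f.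
Local Notation e := (onframe g).
Local Notation P := (fun a b => invmx (gram g f) a b).

Lemma contract1 (phi : V -> V -> R) :
    (forall Y, scalar (fun X => phi X Y)) -> (forall X, scalar (phi X)) ->
  \sum_(i < n) phi e`_i e`_i = contract P (fun a b => phi f`_a f`_b).
Proof. exact: (frame_trace gm (onframeP gm) fb). Qed.

(** Each frame vector is passed to [phi] in two separate slots, so that [phi] is linear in every
    slot and the traces can be replaced one at a time. *)
Lemma contract2 (phi : V -> V -> V -> V -> R) :
    (forall Y Z W, scalar (fun X => phi X Y Z W)) ->
    (forall X Z W, scalar (fun Y => phi X Y Z W)) ->
    (forall X Y W, scalar (fun Z => phi X Y Z W)) ->
    (forall X Y Z, scalar (fun W => phi X Y Z W)) ->
  \sum_(i < n) \sum_(j < n) phi e`_i e`_i e`_j e`_j =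
  contract P (fun a b => contract P (fun c d => phi f`_a f`_b f`_c f`_d)).
Proof.
move=> p1 p2 p3 p4.
rewrite -(@contract1 (fun X Y => contract P (fun c d => phi X Y f`_c f`_d))).
- by apply: eq_bigr => i _; rewrite -contract1.
- by move=> Y; apply: scalar_contract.
- by move=> X; apply: scalar_contract.
Qed.

Lemma contract3 (phi : V -> V -> V -> V -> V -> V -> R) :
    (forall Y Z W S T, scalar (fun X => phi X Y Z W S T)) ->
    (forall X Z W S T, scalar (fun Y => phi X Y Z W S T)) ->
    (forall X Y W S T, scalar (fun Z => phi X Y Z W S T)) ->
    (forall X Y Z S T, scalar (fun W => phi X Y Z W S T)) ->
    (forall X Y Z W T, scalar (fun S => phi X Y Z W S T)) ->
    (forall X Y Z W S, scalar (fun T => phi X Y Z W S T)) ->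
  \sum_(i < n) \sum_(j < n) \sum_(k < n)
    phi e`_i e`_i e`_j e`_j e`_k e`_k =
  contract P (fun a b => contract P (fun c d => contract P (fun s t =>
    phi f`_a f`_b f`_c f`_d f`_s f`_t))).
Proof.
move=> p1 p2 p3 p4 p5 p6.
rewrite -(@contract1 (fun X Y => contract P (fun c d => contract P (fun s t =>
  phi X Y f`_c f`_d f`_s f`_t)))).
- by apply: eq_bigr => i _; rewrite -contract2.
- by move=> Y; do 2 (apply: scalar_contract => ? ?).
- by move=> X; do 2 (apply: scalar_contract => ? ?).
Qed.

End contraction.

(** * Tensors in an arbitrary basis *)

Section basis_formulas.
Context {R : realType} {V : vectType R} (br : V -> V -> V).
Local Notation n := (\dim {:V}).
Context (f : n.-tuple V).

(** [P] stands for the inverse metric but is an independent argument, which makes the formulas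
    polynomial in the components of g, P and H. *)
Definition basis_Ric (g : V -> V -> R) (P : 'I_n -> 'I_n -> R) (X Y : V) : R :=
  - 2^-1 * contract P (fun a b => g (br X f`_a) (br Y f`_b))
  - 2^-1 * killing br f X Y
  + 4^-1 * contract P (fun a b => contract P (fun c d =>
      g (br f`_a f`_c) X * g (br f`_b f`_d) Y))
  - 2^-1 * contract P (fun a b =>
      ad_trace br f f`_a * (g (br f`_b X) Y + g (br f`_b Y) X)).

Definition basis_sqform (P : 'I_n -> 'I_n -> R) (H : V -> V -> V -> R)
    (X Y : V) : R :=
  contract P (fun a b => contract P (fun c d => H X f`_a f`_c * H Y f`_b f`_d)).

Definition basis_codiff3 (g : V -> V -> R) (P : 'I_n -> 'I_n -> R)
    (H : V -> V -> V -> R) (X Y : V) : R :=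
  contract P (fun a b => ad_trace br f f`_a * H f`_b X Y)
  - 2^-1 * contract P (fun a b => contract P (fun c d =>
      g (br f`_a f`_c) X * H f`_b f`_d Y))
  + 2^-1 * contract P (fun a b => contract P (fun c d =>
      g (br f`_a f`_c) Y * H f`_b f`_d X)).

Definition basis_gen_scalar (g : V -> V -> R) (P : 'I_n -> 'I_n -> R)
    (H : V -> V -> V -> R) : R :=
  - 4^-1 * contract P (fun a b => contract P (fun c d =>
      g (br f`_a f`_c) (br f`_b f`_d)))
  - 2^-1 * contract P (fun a b => killing br f f`_a f`_b)
  - contract P (fun a b => ad_trace br f f`_a * ad_trace br f f`_b)
  - 12^-1 * contract P (fun a b => contract P (fun c d => contract P (fun s t =>
      H f`_a f`_c f`_s * H f`_b f`_d f`_t))).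

Hypothesis hbr : lie_bracket br.
Hypothesis fb : basis_of fullv f.
Context (g : V -> V -> R) (H : V -> V -> V -> R).
Hypothesis gm : metric g.
Hypothesis Hf : three_form H.
Local Notation P := (fun a b => invmx (gram g f) a b).

Let g1 := gam_scalar1 hbr gm.
Let g2 := gam_scalar2 hbr gm.
Let H1 := three_form_scalar1 Hf.
Let H2 := three_form_scalar2 Hf.
Let H3 := three_form_scalar3 Hf.

Lemma basis_RicE X Y : Ric br g X Y = basis_Ric g P X Y.
Proof.
rewrite (RicE hbr gm _ _ fb) /basis_Ric.
congr (_ * _ - _ + _ * _ - _ * _).
- apply: (@contract1 _ _ _ gm _ fb (fun A B => g (br X A) (br Y B))) => A a u v.
    by rewrite g2.
  by rewrite (bracket_linearr hbr) (metric_scalarr gm).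
- apply: (@contract2 _ _ _ gm _ fb
    (fun A B C D => g (br A C) X * g (br B D) Y)) => A B C.
  + by apply: scalar_mulr; exact: g1.
  + by apply: scalar_mull; exact: g1.
  + by apply: scalar_mulr; exact: g2.
  + by apply: scalar_mull; exact: g2.
- apply: (@contract1 _ _ _ gm _ fb
    (fun A B => ad_trace br f A * (g (br B X) Y + g (br B Y) X))) => A.
  + by apply: scalar_mulr; exact: ad_trace_scalar.
  + by apply: scalar_mull; apply: scalar_add; exact: g1.
Qed.

Lemma basis_sqformE X Y : sqform g H X Y = basis_sqform P H X Y.
Proof.
apply: (@contract2 _ _ _ gm _ fb (fun A B C D => H X A C * H Y B D)) => A B C.
- by apply: scalar_mulr; exact: H2.
- by apply: scalar_mull; exact: H2.
- by apply: scalar_mulr; exact: H3.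
- by apply: scalar_mull; exact: H3.
Qed.

Lemma basis_codiff3E X Y : codiff3 br g H X Y = basis_codiff3 g P H X Y.
Proof.
rewrite (codiff3E hbr gm _ _ fb Hf) /basis_codiff3.
congr (_ - _ * _ + _ * _).
- apply: (@contract1 _ _ _ gm _ fb (fun A B => ad_trace br f A * H B X Y)) => A.
  + by apply: scalar_mulr; exact: ad_trace_scalar.
  + by apply: scalar_mull; exact: H1.
- apply: (@contract2 _ _ _ gm _ fb (fun A B C D => g (br A C) X * H B D Y))
    => A B C.
  + by apply: scalar_mulr; exact: g1.
  + by apply: scalar_mull; exact: H1.
  + by apply: scalar_mulr; exact: g2.
  + by apply: scalar_mull; exact: H2.
- apply: (@contract2 _ _ _ gm _ fb (fun A B C D => g (br A C) Y * H B D X))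
    => A B C.
  + by apply: scalar_mulr; exact: g1.
  + by apply: scalar_mull; exact: H1.
  + by apply: scalar_mulr; exact: g2.
  + by apply: scalar_mull; exact: H2.
Qed.

Lemma basis_gen_scalarE :
  gen_scalar_curvature br g H = basis_gen_scalar g P H.
Proof.
rewrite /gen_scalar_curvature (scalar_curvatureE hbr gm fb) /basis_gen_scalar.
congr (_ * _ - _ * _ - _ - _ * _).
- apply: (@contract2 _ _ _ gm _ fb (fun A B C D => g (br A C) (br B D)))
    => A B C a u v.
  + by rewrite g1.
  + by rewrite (bracket_linearl hbr) (metric_scalarr gm).
  + by rewrite g2.
  + by rewrite (bracket_linearr hbr) (metric_scalarr gm).
- apply: (@contract1 _ _ _ gm _ fb (fun A B => killing br f A B)) => A.
  + exact: killing_scalarl.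
  + exact: killing_scalarr.
- apply: (@contract1 _ _ _ gm _ fb
    (fun A B => ad_trace br f A * ad_trace br f B)) => A.
  + by apply: scalar_mulr; exact: ad_trace_scalar.
  + by apply: scalar_mull; exact: ad_trace_scalar.
- rewrite /sqnorm3; under eq_bigr do under eq_bigr do under eq_bigr do rewrite expr2.
  apply: (@contract3 _ _ _ gm _ fb (fun A B C D E F => H A C E * H B D F))
    => A B C D E.
  + by apply: scalar_mulr; exact: H1.
  + by apply: scalar_mull; exact: H1.
  + by apply: scalar_mulr; exact: H2.
  + by apply: scalar_mull; exact: H2.
  + by apply: scalar_mulr; exact: H3.
  + by apply: scalar_mull; exact: H3.
Qed.

End basis_formulas.

(** * Differentiation rules for expressions in time, and for contractions *)

Section pointwise_derivatives.
Context {R : realType} (t : R).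

Lemma is_derive_add (u v : R -> R) du dv : is_derive t 1 u du ->
  is_derive t 1 v dv -> is_derive t 1 (fun s => u s + v s) (du + dv).
Proof. exact: is_deriveD. Qed.

Lemma is_derive_sub (u v : R -> R) du dv : is_derive t 1 u du ->
  is_derive t 1 v dv -> is_derive t 1 (fun s => u s - v s) (du - dv).
Proof. exact: is_deriveB. Qed.

Lemma is_derive_mul (u v : R -> R) du dv : is_derive t 1 u du ->
  is_derive t 1 v dv ->
  is_derive t 1 (fun s => u s * v s) (du * v t + u t * dv).
Proof.
move=> ud vd; have -> : du * v t + u t * dv = u t *: dv + v t *: du.
  by rewrite /GRing.scale/=; ring.
exact: is_deriveM.
Qed.

Lemma is_derive_scale (k : R) (v : R -> R) dv : is_derive t 1 v dv ->
  is_derive t 1 (fun s => k * v s) (k * dv).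
Proof. exact: is_deriveZ. Qed.

Lemma is_derive_bigsum n (u : 'I_n -> R -> R) (du : 'I_n -> R) :
  (forall i, is_derive t 1 (u i) (du i)) ->
  is_derive t 1 (fun s => \sum_(i < n) u i s) (\sum_(i < n) du i).
Proof.
move=> ud; have -> : (fun s => \sum_(i < n) u i s) = \sum_(i < n) u i.
  by apply/funext => s; rewrite fct_sumE.
exact: is_derive_sum.
Qed.

Lemma is_derive_const (k : R) : is_derive t 1 (fun _ : R => k) 0.
Proof. exact: is_derive_cst. Qed.

(** The hypotheses on P are those of an inverse Gram matrix in a frame orthonormal at time t. The
    value comes along with the derivative because nested contractions need the value of the inner
    one. *)
Lemma is_derive_contract (V : vectType R)
    (P : R -> 'I_(\dim {:V}) -> 'I_(\dim {:V}) -> R)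
    (F : R -> 'I_(\dim {:V}) -> 'I_(\dim {:V}) -> R)
    (h dF : 'I_(\dim {:V}) -> 'I_(\dim {:V}) -> R) :
  (forall a b, P t a b = (a == b)%:R) ->
  (forall a b, is_derive t 1 (fun s => P s a b) (- h a b)) ->
  (forall a b, is_derive t 1 (fun s => F s a b) (dF a b)) ->
  contract (P t) (F t) = \sum_a F t a a /\
  is_derive t 1 (fun s => contract (P s) (F s))
    (\sum_a dF a a - \sum_a \sum_b h a b * F t a b).
Proof.
move=> P1 Pd Fd.
have col (G : 'I_(\dim {:V}) -> 'I_(\dim {:V}) -> R) :
    contract (P t) G = \sum_a G a a.
  apply: eq_bigr => a _; rewrite (bigD1 a)//= P1 eqxx mul1r big1 ?addr0//.
  by move=> b /negPf ba; rewrite P1 eq_sym ba mul0r.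
split; first exact: col.
have -> : \sum_a dF a a - \sum_a \sum_b h a b * F t a b =
    \sum_a \sum_b (- h a b * F t a b + P t a b * dF a b).
  rewrite -col /contract -sumrB; apply: eq_bigr => a _.
  by rewrite -sumrB; apply: eq_bigr => b _; ring.
apply: is_derive_bigsum => a; apply: is_derive_bigsum => b.
exact: is_derive_mul.
Qed.

End pointwise_derivatives.

(** * Evolution of the generalized scalar curvature *)

Section polynomial_closure.
Context {R : realType} {T : Type} (C : (T -> R) -> Prop).
Hypothesis C_cst : forall k, C (fun=> k).
Hypothesis C_add : forall f h, C f -> C h -> C (fun x => f x + h x).
Hypothesis C_mul : forall f h, C f -> C h -> C (fun x => f x * h x).

Lemma closure_sum (J : Type) (r : seq J) (F : T -> J -> R) :
  (forall j, C (F^~ j)) -> C (fun x => \sum_(j <- r) F x j).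
Proof.
move=> CF; elim: r => [|j r IHr].
  by under eq_fun do rewrite big_nil; exact: C_cst.
by under eq_fun do rewrite big_cons; apply: C_add.
Qed.

Lemma closure_prod (J : Type) (r : seq J) (F : T -> J -> R) :
  (forall j, C (F^~ j)) -> C (fun x => \prod_(j <- r) F x j).
Proof.
move=> CF; elim: r => [|j r IHr].
  by under eq_fun do rewrite big_nil; exact: C_cst.
by under eq_fun do rewrite big_cons; apply: C_mul.
Qed.

(** The class C is abstract because it will be once the functions derivable at a time and once the
    locally Lipschitz functions of a state. *)
Lemma closure_det m (M : T -> 'M[R]_m) :
  (forall i j, C (fun x => M x i j)) -> C (fun x => \det (M x)).
Proof.
move=> CM; rewrite /determinant; apply: closure_sum => s.
by apply: C_mul; [exact: C_cst|apply: closure_prod => i; exact: CM].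
Qed.

Lemma closure_adj m (M : T -> 'M[R]_m) a b :
  (forall i j, C (fun x => M x i j)) -> C (fun x => (\adj (M x)) a b).
Proof.
move=> CM; under eq_fun do rewrite mxE /cofactor.
apply: C_mul; first exact: C_cst.
apply: closure_det => i j; under eq_fun do rewrite !mxE; exact: CM.
Qed.

End polynomial_closure.

(** Cramer's formula without the case distinction of [invmx], so that the entry is visibly a
    quotient of polynomials in the entries of M. *)
Definition inv_entry (R : realType) m (M : 'M[R]_m) (a b : 'I_m) : R :=
  (\det M)^-1 * (\adj M) a b.

Lemma inv_entryE (R : realType) m (M : 'M[R]_m) a b : M \in unitmx ->
  inv_entry M a b = invmx M a b.
Proof. by move=> Mu; rewrite /invmx Mu mxE. Qed.

Lemma is_derive_unique (R : realType) (f : R -> R) (t d1 d2 : R) :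
  is_derive t 1 f d1 -> is_derive t 1 f d2 -> d1 = d2.
Proof. by move=> [_ <-] [_ <-]. Qed.

(** Cramer's formula gives differentiability; the value follows by differentiating M M^-1 = 1 at an
    instant where both factors are 1. *)
Lemma is_derive_invmx (R : realType) m (M : R -> 'M[R]_m) (dM : 'M[R]_m) (t : R) :
  (forall i j, is_derive t 1 (fun s => M s i j) (dM i j)) ->
  (\forall s \near t, M s \in unitmx) -> M t = 1%:M ->
  forall a b, is_derive t 1 (fun s => invmx (M s) a b) (- dM a b).
Proof.
move=> Md Mu M1.
pose C (f : R -> R) := derivable f t 1.
have C_cst k : C (fun=> k) by exact: derivable_cst.
have C_add f h : C f -> C h -> C (fun x => f x + h x) by exact: derivableD.
have C_mul f h : C f -> C h -> C (fun x => f x * h x) by exact: derivableM.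
have CM i j : C (fun s => M s i j) by have [] := Md i j.
have Ptd a b : derivable (fun s => invmx (M s) a b) t 1.
  apply: (@near_eq_derivable _ _ _ (fun s => inv_entry (M s) a b)).
    by apply: filterS Mu => s Ms; rewrite inv_entryE.
  apply: (C_mul); last exact: (@closure_adj _ _ C).
  apply: derivableV; last exact: (@closure_det _ _ C).
  by rewrite M1 det1 oner_neq0.
move=> a b; pose dP i j := 'D_1 (fun s => invmx (M s) i j) t.
have Pd i j : is_derive t 1 (fun s => invmx (M s) i j) (dP i j).
  exact: DeriveDef.
have PE i j : invmx (M t) i j = (i == j)%:R by rewrite M1 invmx1 mxE.
have d0 : is_derive t 1 (fun s => \sum_(j < m) M s a j * invmx (M s) j b)
    (\sum_(j < m) (dM a j * invmx (M t) j b + M t a j * dP j b)).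
  by apply: is_derive_bigsum => j; apply: is_derive_mul.
have d1 : is_derive t 1 (fun s => \sum_(j < m) M s a j * invmx (M s) j b) 0.
  apply: (@near_eq_is_derive R R R (fun=> (a == b)%:R)).
    apply: filterS Mu => s Ms.
    by have := congr1 (fun A : 'M[R]_(m, m) => A a b) (mulmxV Ms); rewrite !mxE.
have := is_derive_unique d0 d1; rewrite big_split/=.
rewrite (bigD1 b)//= PE eqxx mulr1 big1 => [|j /negPf jb]; last first.
  by rewrite PE jb mulr0.
rewrite (bigD1 a)//= M1 mxE eqxx mul1r big1 => [|j /negPf ja]; last first.
  by rewrite mxE eq_sym ja mul0r.
rewrite !addr0 => /eqP; rewrite addr_eq0 => /eqP ->; rewrite opprK.
exact: Pd.
Qed.

Lemma near_ereal_itv (R : realType) (a b : \bar R) (t : R) :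
  (a < t%:E)%E -> (t%:E < b)%E ->
  \forall s \near t, (a < s%:E)%E /\ (s%:E < b)%E.
Proof.
move=> at_ tb; near=> s; split; near: s.
- case: a at_ => [a|//|_]; last by apply: nearW => s; rewrite ltNyr.
  by rewrite lte_fin => at_; apply: filterS (lt_nbhsr at_) => s; rewrite lte_fin.
- case: b tb => [b|_|//]; last by apply: nearW => s; rewrite ltry.
  by rewrite lte_fin => tb; apply: filterS (lt_nbhsl tb) => s; rewrite lte_fin.
Unshelve. all: by end_near. Qed.

Section evolution.
Context {R : realType} {V : vectType R} (br : V -> V -> V).
Context (H0 : V -> V -> V -> R) (em ep : \bar R) (g b : R -> V -> V -> R).
Hypothesis hbr : lie_bracket br.
Hypothesis H0f : three_form H0.
Hypothesis dH0 : forall W X Y Z, d3 br H0 W X Y Z = 0.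
Hypothesis sol : gRF_solution br H0 em ep g b.
Local Notation n := (\dim {:V}).

Definition metric_velocity t X Y : R :=
  - 2 * Ric br (g t) X Y + 2^-1 * sqform (g t) (flux br H0 (b t)) X Y.

Definition form_velocity t X Y : R :=
  - codiff3 br (g t) (flux br H0 (b t)) X Y.

Definition energy t : R := let e := onframe (g t) in
  2^-1 * (\sum_(i < n) \sum_(j < n) metric_velocity t e`_i e`_j ^+ 2)
  + 2^-1 * (\sum_(i < n) \sum_(j < n) form_velocity t e`_i e`_j ^+ 2).

(** Bilinearity passes from g_s and b_s, for s near t, to their derivatives at t by uniqueness of
    the derivative. *)
Lemma velocity_bilinear t : (em < t%:E)%E -> (t%:E < ep)%E ->
  [/\ forall Y, scalar (fun X => metric_velocity t X Y), forall X, scalar (metric_velocity t X),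
      forall Y, scalar (fun X => form_velocity t X Y) & forall X, scalar (form_velocity t X)].
Proof.
move=> tm tp.
have gd X Y : is_derive t 1 (fun s => g s X Y) (metric_velocity t X Y) by case: (sol tm tp).
have bd X Y : is_derive t 1 (fun s => b s X Y) (form_velocity t X Y) by case: (sol tm tp).
have near_sol : \forall s \near t, metric (g s) /\ two_form (b s).
  apply: filterS (near_ereal_itv tm tp) => s [sm sp].
  by have [] := sol sm sp.
split=> [Y a u v|X a u v|Y a u v|X a u v].
- apply: (@is_derive_unique _ (fun s => g s (a *: u + v) Y) t).
  apply: (@near_eq_is_derive R R R (fun s => a * g s u Y + g s v Y)).
  by apply: filterS near_sol => s [gs _]; rewrite (metric_scalarl gs).
- apply: (@is_derive_unique _ (fun s => g s X (a *: u + v)) t).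
  apply: (@near_eq_is_derive R R R (fun s => a * g s X u + g s X v)).
  by apply: filterS near_sol => s [gs _]; rewrite (metric_scalarr gs).
- apply: (@is_derive_unique _ (fun s => b s (a *: u + v) Y) t).
  apply: (@near_eq_is_derive R R R (fun s => a * b s u Y + b s v Y)).
  by apply: filterS near_sol => s [_ bs]; rewrite (two_form_scalarl _ bs).
- apply: (@is_derive_unique _ (fun s => b s X (a *: u + v)) t).
  apply: (@near_eq_is_derive R R R (fun s => a * b s X u + b s X v)).
  by apply: filterS near_sol => s [_ bs]; rewrite (two_form_scalarr _ bs).
Qed.

Section at_time.
Context (t : R) (tm : (em < t%:E)%E) (tp : (t%:E < ep)%E).
Local Notation e := (onframe (g t)).
Local Notation h := (metric_velocity t).
Local Notation be := (form_velocity t).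
Local Notation H := (flux br H0 (b t)).

Let gm : metric (g t). Proof. by case: (sol tm tp). Qed.
Let bf : two_form (b t). Proof. by case: (sol tm tp). Qed.
Let gd X Y : is_derive t 1 (fun s => g s X Y) (h X Y).
Proof. by case: (sol tm tp). Qed.
Let bd X Y : is_derive t 1 (fun s => b s X Y) (be X Y).
Proof. by case: (sol tm tp). Qed.
Let Hf : three_form H. Proof. exact: flux_three_form. Qed.
Let eo : Defs.orthonormal (g t) e := onframeP gm.
Let eb : basis_of fullv e := orthonormal_basis gm eo.

Let c (i j k : 'I_n) : R := g t (br e`_i e`_j) e`_k.
Let K (i j k : 'I_n) : R := H e`_i e`_j e`_k.

Let cA i j k : c i j k = - c j i k. Proof. exact: (gamC hbr gm). Qed.

Let cJ i j k l :
  \sum_m (c j k m * c i m l + c k i m * c j m l + c i j m * c k m l) = 0.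
Proof.
rewrite !big_split/=.
rewrite -!(frame_form gm eo _ (gam_scalar2 hbr gm _ _)).
rewrite -!(scalar_formD (metric_scalarl gm _)) (bracket_jacobi hbr).
exact: (scalar_form0 (metric_scalarl gm _)).
Qed.

Let KA12 i j k : K i j k = - K j i k. Proof. exact: (three_formA12 Hf). Qed.
Let KA23 i j k : K i j k = - K i k j. Proof. exact: (three_formA23 Hf). Qed.

Let dK m x y u :
  \sum_p (c m x p * K p y u - c m y p * K p x u + c m u p * K p x y
  + c x y p * K p m u - c x u p * K p m y + c y u p * K p m x) = 0.
Proof.
rewrite !big_split/= !sumrN -!(frame_form gm eo _ (three_form_scalar1 Hf _ _)).
have := flux_closed hbr dH0 bf e`_m e`_x e`_y e`_u; rewrite /d3; lra.
Qed.

Let zE (m : 'I_n) : ad_trace br e e`_m = sc_z c m.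
Proof. exact: (ad_traceE hbr gm _ eb). Qed.

Let KE (x y : 'I_n) : killing br e e`_x e`_y = sc_K c x y.
Proof. by rewrite (killingE hbr gm _ _ eb). Qed.

Let AE (x y : 'I_n) : \sum_(i < n) g t (br e`_x e`_i) (br e`_y e`_i) = sc_A c x y.
Proof. by apply: eq_bigr => i _; exact: frame_parseval. Qed.

Let hE (x y : 'I_n) : h e`_x e`_y = sc_h c K x y.
Proof.
rewrite /metric_velocity (RicE hbr gm _ _ eb) /sc_h AE KE.
congr (_ * (_ + _ - _ * _) + _).
rewrite /sc_D -big_split; apply: eq_bigr => m _ /=.
by rewrite zE mulrDr.
Qed.

Let beE (x y : 'I_n) : be e`_x e`_y = - sc_cod c K x y.
Proof.
rewrite /form_velocity (codiff3E hbr gm _ _ eb Hf); congr (- (_ - _ + _)).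
by apply: eq_bigr => m _; rewrite zE.
Qed.

Lemma energyE : energy t =
  2^-1 * (\sum_i \sum_j sc_h c K i j ^+ 2)
  + 2^-1 * (\sum_i \sum_j (- sc_cod c K i j) ^+ 2).
Proof.
rewrite /energy; congr (_ * _ + _ * _).
- by apply: eq_bigr => i _; apply: eq_bigr => j _; rewrite hE.
- by apply: eq_bigr => i _; apply: eq_bigr => j _; rewrite beE.
Qed.

Let near_sol : \forall s \near t, metric (g s) /\ two_form (b s).
Proof.
apply: filterS (near_ereal_itv tm tp) => s [sm sp].
by have [] := sol sm sp.
Qed.

Let hl Y : scalar (fun X => h X Y).
Proof. by case: (velocity_bilinear tm tp). Qed.

Let hC X Y : h X Y = h Y X.
Proof.
rewrite /metric_velocity (RicC hbr gm); congr (_ + _ * _).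
by apply: eq_bigr => i _; apply: eq_bigr => j _; rewrite mulrC.
Qed.

Let bel Y : scalar (fun X => be X Y).
Proof. by case: (velocity_bilinear tm tp). Qed.

Let Hd X Y Z :
  is_derive t 1 (fun s => flux br H0 (b s) X Y Z) (d2 br be X Y Z).
Proof.
have D := is_deriveB (is_deriveD (is_deriveN (bd (br X Y) Z))
  (bd (br X Z) Y)) (bd (br Y Z) X).
rewrite -[d2 br be X Y Z]add0r.
exact: (is_derive_add (is_derive_const t (H0 X Y Z)) D).
Qed.

Let dbeE (x y u : 'I_n) : d2 br be e`_x e`_y e`_u =
  \sum_(p < n) (- c x y p * be e`_p e`_u + c x u p * be e`_p e`_y
           - c y u p * be e`_p e`_x).
Proof.
rewrite /d2 !(frame_form gm eo (br _ _) (bel _)) -sumrN -big_split -sumrB/=.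
by apply: eq_bigr => p _; rewrite mulNr.
Qed.

(** The inverse metric at time s in the frame of time t, which is held fixed. *)
Let P s (i j : 'I_n) : R := invmx (gram (g s) e) i j.

Let gram1 : gram (g t) e = 1%:M.
Proof. by apply/matrixP => i j; rewrite !mxE eo. Qed.

Let P1 i j : P t i j = (i == j)%:R.
Proof. by rewrite /P gram1 invmx1 mxE. Qed.

Let Pd i j : is_derive t 1 (fun s => P s i j) (- h e`_i e`_j).
Proof.
have -> : h e`_i e`_j = (\matrix_(i, j) h e`_i e`_j) i j :> R by rewrite mxE.
apply: is_derive_invmx gram1 _ _ => [k l|].
  by under eq_fun do rewrite mxE; rewrite mxE; exact: gd.
apply: filterS (near_ereal_itv tm tp) => s [sm sp].
have [gs _ _ _] := sol sm sp.
exact: (gram_unit gs (onframeP gs) eb).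
Qed.

Let hh (i j : 'I_n) : R := h e`_i e`_j.

Let hN : \sum_(i < n) \sum_(j < n) h (br e`_i e`_j) (br e`_i e`_j) =
  \sum_a \sum_b hh a b * sc_N c a b.
Proof.
have -> : \sum_(i < n) \sum_(j < n) h (br e`_i e`_j) (br e`_i e`_j) =
    \sum_(i < n) \sum_(j < n) \sum_a \sum_b hh a b * (c i j a * c i j b).
  apply: eq_bigr => i _; apply: eq_bigr => j _.
  rewrite (frame_form gm eo (br e`_i e`_j) (hl _)); apply: eq_bigr => a _.
  rewrite hC (frame_form gm eo (br e`_i e`_j) (hl _)) mulr_sumr.
  by apply: eq_bigr => k _; rewrite /hh hC /c; ring.
under eq_bigr do rewrite exchange_big/=.
rewrite exchange_big; apply: eq_bigr => a _ /=.
under eq_bigr do rewrite exchange_big/=.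
rewrite exchange_big; apply: eq_bigr => k _ /=.
rewrite /sc_N mulr_sumr; apply: eq_bigr => i _.
by rewrite mulr_sumr.
Qed.

Let hA : \sum_(i < n) \sum_(k < n) \sum_(l < n) hh k l * g t (br e`_i e`_k) (br e`_i e`_l) =
  \sum_a \sum_b hh a b * sc_A c a b.
Proof.
rewrite exchange_big; apply: eq_bigr => k _ /=.
rewrite exchange_big; apply: eq_bigr => l _ /=.
rewrite -mulr_sumr -AE; congr (_ * _); apply: eq_bigr => i _.
rewrite (gamC hbr gm) [g t _ _](metricC gm) (gamC hbr gm) opprK.
exact: metricC.
Qed.

Lemma gen_scalar_evolution : is_derive t 1
  (fun s => gen_scalar_curvature br (g s) (flux br H0 (b s)))
  (energy t).
Proof.
apply: (@near_eq_is_derive R R R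
    (fun s => basis_gen_scalar br e (g s) (P s) (flux br H0 (b s)))).
  apply: filterS near_sol => s [gs bs].
  by rewrite (basis_gen_scalarE hbr eb gs (flux_three_form hbr H0f bs)).
have I1 (i j : 'I_n) := is_derive_contract P1 Pd
  (F := fun s (k l : 'I_n) => g s (br e`_i e`_k) (br e`_j e`_l))
  (fun k l => gd _ _).
have T1 := (is_derive_contract P1 Pd (fun i j => (I1 i j).2)).2.
have T2 := (is_derive_contract P1 Pd
  (F := fun _ (i j : 'I_n) => killing br e e`_i e`_j)
  (fun i j => is_derive_const t _)).2.
have T3 := (is_derive_contract P1 Pd
  (F := fun _ (i j : 'I_n) => ad_trace br e e`_i * ad_trace br e e`_j)
  (fun i j => is_derive_const t _)).2.
have J1 (i j k l : 'I_n) := is_derive_contract P1 Pd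
  (F := fun s (p q : 'I_n) => flux br H0 (b s) e`_i e`_k e`_p *
                              flux br H0 (b s) e`_j e`_l e`_q)
  (fun p q => is_derive_mul (Hd _ _ _) (Hd _ _ _)).
have J2 (i j : 'I_n) := is_derive_contract P1 Pd (fun k l => (J1 i j k l).2).
have T4 := (is_derive_contract P1 Pd (fun i j => (J2 i j).2)).2.
have D := is_derive_sub (is_derive_sub (is_derive_sub (is_derive_scale (- 4^-1) T1)
  (is_derive_scale 2^-1 T2)) T3) (is_derive_scale 12^-1 T4).
move: D; set val := (X in is_derive _ _ _ X) => D.
suff <- : val = energy t by exact: D.
rewrite /val {D val}.
rewrite energyE -(sc_evolution cA cJ KA12 KA23 dK) /=.
have hhE (i j : 'I_n) : h e`_i e`_j = sc_h c K i j by exact: hE.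
set v1 := (X in - 4^-1 * X - _ - _ - _); set v2 := (X in _ - 2^-1 * X - _ - _).
set v3 := (X in _ - _ - X - _); set v4 := (X in _ - _ - _ - 12^-1 * X).
(* The moving g contributes <h, N>, and each of the two inverse metrics contributes -<h, A>. *)
have -> : v1 = \sum_a \sum_b sc_h c K a b * sc_N c a b
    - 2 * \sum_a \sum_b sc_h c K a b * sc_A c a b.
  have hhF : hh = sc_h c K by apply/funext => i; apply/funext => j; exact: hE.
  have q3 : \sum_(i < n) \sum_(j < n) h e`_i e`_j * contract (P t)
        (fun k l : 'I_n => g t (br e`_i e`_k) (br e`_j e`_l)) =
      \sum_a \sum_b sc_h c K a b * sc_A c a b.
    by apply: eq_bigr => i _; apply: eq_bigr => j _; rewrite (I1 _ _).1 AE hhE.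
  by rewrite /v1 sumrB hN hA q3 hhF; ring.
have -> : v2 = - \sum_a \sum_b sc_h c K a b * sc_K c a b.
  rewrite /v2 big1// sub0r; congr (- _).
  by apply: eq_bigr => i _; apply: eq_bigr => j _; rewrite hhE KE.
have -> : v3 = - \sum_a \sum_b sc_h c K a b * (sc_z c a * sc_z c b).
  rewrite /v3 big1// sub0r; congr (- _).
  by apply: eq_bigr => i _; apply: eq_bigr => j _; rewrite hhE !zE.
have Q1 : \sum_(i < n) \sum_(k < n) \sum_(p < n) \sum_(q < n)
    h e`_p e`_q * (H e`_i e`_k e`_p * H e`_i e`_k e`_q) =
    \sum_a \sum_b sc_h c K a b * sc_Q K a b.
  under eq_bigr do rewrite exchange_big/=.
  rewrite exchange_big; apply: eq_bigr => p _ /=.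
  under eq_bigr do rewrite exchange_big/=.
  rewrite exchange_big; apply: eq_bigr => q _ /=.
  rewrite -hhE /sc_Q mulr_sumr; apply: eq_bigr => i _.
  rewrite mulr_sumr; apply: eq_bigr => k _.
  by rewrite [K p i k]KA12 [K i p k]KA23 [K q i k]KA12 [K i q k]KA23 !opprK.
have Q2 : \sum_(i < n) \sum_(k < n) \sum_(l < n)
    h e`_k e`_l * (\sum_(p < n) H e`_i e`_k e`_p * H e`_i e`_l e`_p) =
    \sum_a \sum_b sc_h c K a b * sc_Q K a b.
  rewrite exchange_big; apply: eq_bigr => k _ /=.
  rewrite exchange_big; apply: eq_bigr => l _ /=.
  rewrite -mulr_sumr -hhE /sc_Q; congr (_ * _); apply: eq_bigr => i _.
  apply: eq_bigr => p _.
  by rewrite [K k i p]KA12 [K l i p]KA12 mulrNN.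
have Q3 : \sum_(i < n) \sum_(j < n) h e`_i e`_j *
    (\sum_(k < n) \sum_(p < n) H e`_i e`_k e`_p * H e`_j e`_k e`_p) =
    \sum_a \sum_b sc_h c K a b * sc_Q K a b.
  by apply: eq_bigr => i _; apply: eq_bigr => j _; rewrite hhE.
have HB : \sum_(i < n) \sum_(k < n) \sum_(p < n)
    (d2 br be e`_i e`_k e`_p * H e`_i e`_k e`_p +
     H e`_i e`_k e`_p * d2 br be e`_i e`_k e`_p) =
    - 6 * \sum_a \sum_b sc_E c K a b * - sc_cod c K a b.
  have -> : - 6 * \sum_a \sum_b sc_E c K a b * - sc_cod c K a b =
      2 * (- 3 * \sum_a \sum_b sc_E c K a b * - sc_cod c K a b) by ring.
  rewrite -(sc_Hdb c KA12 KA23 (fun a b => - sc_cod c K a b)).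
  rewrite mulr_sumr; apply: eq_bigr => i _.
  rewrite mulr_sumr; apply: eq_bigr => k _.
  rewrite mulr_sumr; apply: eq_bigr => p _.
  rewrite dbeE; under eq_bigr do rewrite !beE.
  by rewrite /K; ring.
(* Each of the two factors H contributes -3 <E, be> by [sc_Hdb], and each of the three inverse
   metrics contributes -<h, Q>. *)
have -> : v4 = - 6 * (\sum_a \sum_b sc_E c K a b * - sc_cod c K a b)
    - 3 * \sum_a \sum_b sc_h c K a b * sc_Q K a b.
  rewrite /v4.
  have r3 : \sum_(i < n) \sum_(j < n) h e`_i e`_j * contract (P t) (fun k l : 'I_n =>
        contract (P t) (fun p q : 'I_n => H e`_i e`_k e`_p * H e`_j e`_l e`_q)) =
      \sum_a \sum_b sc_h c K a b * sc_Q K a b.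
    rewrite -Q3; apply: eq_bigr => i _; apply: eq_bigr => j _.
    rewrite (J2 _ _).1; congr (_ * _); apply: eq_bigr => k _.
    by rewrite (J1 _ _ _ _).1.
  have r2 : \sum_(i < n) \sum_(k < n) \sum_(l < n) h e`_k e`_l *
        contract (P t) (fun p q : 'I_n => H e`_i e`_k e`_p * H e`_i e`_l e`_q) =
      \sum_a \sum_b sc_h c K a b * sc_Q K a b.
    rewrite -Q2; apply: eq_bigr => i _; apply: eq_bigr => k _.
    by apply: eq_bigr => l _; rewrite (J1 _ _ _ _).1.
  rewrite r3 sumrB r2; under eq_bigr do rewrite sumrB.
  by rewrite sumrB Q1 HB; ring.
by field.
Qed.

End at_time.
End evolution.

(** * Limits at a finite end of the time interval *)

(** From |X_i Y_j| <= (X_i^2 + Y_j^2)/2 for components in the frame. For X = Y the factor is exactly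
    g(X, X), as the logarithmic derivative requires. *)
Lemma bilinear_frame_bound (R : realType) (V : vectType R) (g phi : V -> V -> R)
    (e : (\dim {:V}).-tuple V) (X Y : V) :
  metric g -> Defs.orthonormal g e ->
  (forall Y, scalar (fun X => phi X Y)) -> (forall X, scalar (phi X)) ->
  `|phi X Y| <= 2^-1 * (g X X + g Y Y) *
    \sum_(i < \dim {:V}) \sum_(j < \dim {:V}) `|phi e`_i e`_j|.
Proof.
move=> gm eo pl pr.
have coord_le Z (i : 'I_(\dim {:V})) : g Z e`_i ^+ 2 <= g Z Z.
  rewrite [leRHS](frame_parseval gm eo) (bigD1 i)//= -expr2 lerDl sumr_ge0//.
  by move=> j _; rewrite -expr2 sqr_ge0.
have -> : phi X Y = \sum_(i < \dim {:V}) \sum_(j < \dim {:V})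
    (g X e`_i * g Y e`_j) * phi e`_i e`_j.
  rewrite (frame_form gm eo X (pl Y)); apply: eq_bigr => i _.
  rewrite (frame_form gm eo Y (pr _)) mulr_sumr; apply: eq_bigr => j _; ring.
rewrite mulr_sumr (le_trans (ler_norm_sum _ _ _))// ler_sum// => i _.
rewrite mulr_sumr (le_trans (ler_norm_sum _ _ _))// ler_sum// => j _.
rewrite normrM ler_wpM2r//.
have := coord_le X i; have := coord_le Y j.
set u := g X e`_i; set v := g Y e`_j => hv hu.
have h1 : 0 <= (u - v) ^+ 2 by exact: sqr_ge0.
have h2 : 0 <= (u + v) ^+ 2 by exact: sqr_ge0.
rewrite ler_norml; apply/andP; split; nra.
Qed.

(** Makes the energy, quadratic in the velocities, dominate them up to a constant. *)
Lemma sum_norm_le_sqr (R : realType) n (F : 'I_n -> 'I_n -> R) :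
  \sum_(i < n) \sum_(j < n) `|F i j| <=
  (n * n)%:R + 2^-1 * (\sum_(i < n) \sum_(j < n) F i j ^+ 2).
Proof.
have -> : (n * n)%:R = \sum_(i < n) \sum_(j < n) (1 : R).
  by rewrite !sumr_const !card_ord -mulrnA.
rewrite mulr_sumr -big_split ler_sum// => i _ /=.
rewrite mulr_sumr -big_split ler_sum// => j _ /=.
rewrite -real_normK ?num_real//; have : 0 <= (`|F i j| - 1) ^+ 2 by exact: sqr_ge0.
by rewrite sqrrB1 mulr2n; have := normr_ge0 (F i j); lra.
Qed.

Section limits.
Context {R : realType} {V : vectType R} (br : V -> V -> V).
Context (H0 : V -> V -> V -> R) (em ep : \bar R) (g b : R -> V -> V -> R).
Hypothesis sol : gRF_solution br H0 em ep g b.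
Local Notation n := (\dim {:V}).
Local Notation h := (metric_velocity br H0 g b).
Local Notation be := (form_velocity br H0 g b).
Local Notation E := (energy br H0 g b).
Let C0 : R := (n * n)%:R + 1.

Lemma energy_ge0 t : 0 <= E t.
Proof.
by rewrite /energy addr_ge0// mulr_ge0// ?invr_ge0// sumr_ge0// => i _;
  rewrite sumr_ge0// => j _; rewrite sqr_ge0.
Qed.

Lemma velocity_bound t X Y : (em < t%:E)%E -> (t%:E < ep)%E ->
  `|h t X Y| <= 2^-1 * (g t X X + g t Y Y) * (C0 * (1 + E t)) /\
  `|be t X Y| <= 2^-1 * (g t X X + g t Y Y) * (C0 * (1 + E t)).
Proof.
move=> tm tp; have [gm _ _ _] := sol tm tp.
have [hl hr bl b_r] := velocity_bilinear sol tm tp.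
have g0 Z : 0 <= g t Z Z.
  have [->|Z0] := eqVneq Z 0; first by rewrite (scalar_form0 (metric_scalarl gm _)).
  by case: gm => _ _ /(_ Z Z0)/ltW.
have gg : 0 <= 2^-1 * (g t X X + g t Y Y) by rewrite mulr_ge0 ?addr_ge0.
have S0 (F : 'I_n -> 'I_n -> R) :
    0 <= 2^-1 * (\sum_(i < n) \sum_(j < n) F i j ^+ 2).
  by rewrite mulr_ge0// sumr_ge0// => i _; rewrite sumr_ge0// => j _; rewrite sqr_ge0.
have N0 : 0 <= (n * n)%:R :> R by rewrite ler0n.
have CE (s : R) : s <= E t -> (n * n)%:R + s <= C0 * (1 + E t).
  by move=> sE; have := energy_ge0 t; rewrite /C0; nra.
pose e := onframe (g t); have eo : Defs.orthonormal (g t) e := onframeP gm.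
split; apply: le_trans (bilinear_frame_bound X Y gm eo _ _) _ => //.
- rewrite ler_wpM2l// (le_trans (sum_norm_le_sqr _))//; apply: CE.
  by rewrite lerDl S0.
- rewrite ler_wpM2l// (le_trans (sum_norm_le_sqr _))//; apply: CE.
  by rewrite lerDr S0.
Qed.

(** * Limits along a filter that stands for either end of the interval *)

Section along_filter.
Context (Fl : set_system R) {FF : ProperFilter Fl}.
Hypothesis Fl_itv : \forall t \near Fl, (em < t%:E)%E /\ (t%:E < ep)%E.
(** To be supplied by [cvg_at_left_dominated] or [cvg_at_right_dominated], once S is bounded on the
    relevant side. *)
Hypothesis dominated_cvg : forall (f df : R -> R) (C : R), 0 <= C ->
  (\forall t \near Fl, is_derive (t : R) 1 f (df t) /\
                       `|df t| <= C * (1 + E t)) ->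
  cvg (f t @[t --> Fl]).

Let C00 : 0 <= C0. Proof. by rewrite addr_ge0. Qed.

Let gXX_cvg X : X != 0 -> exists2 l : R, 0 < l & g t X X @[t --> Fl] --> l.
Proof.
move=> X0.
have : cvg (ln (g t X X) @[t --> Fl]).
  apply: (@dominated_cvg _ (fun t => (g t X X)^-1 * h t X X) C0) => //.
  apply: filterS Fl_itv => t [tm tp]; have [[_ _ gp] _ gd _] := sol tm tp.
  have gX := gp X X0; split.
    have lnd : is_derive (g t X X) 1 (@ln R) (g t X X)^-1 := is_derive1_ln gX.
    have gXd : is_derive t 1 (fun s => g s X X) (h t X X) := gd X X.
    exact: (is_derive1_comp lnd gXd).
  rewrite normrM normfV (gtr0_norm gX) ler_pdivrMl//.
  have [hb _] := velocity_bound X X tm tp.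
  by rewrite (le_trans hb)// ler_wpM2r//; [|lra];
    rewrite mulr_ge0// addr_ge0// energy_ge0.
move=> /cvg_ex[l gl]; exists (expR l); first exact: expR_gt0.
have : expR (ln (g t X X)) @[t --> Fl] --> expR l.
  by apply: continuous_cvg => //; exact: continuous_expR.
apply: cvg_trans; apply: near_eq_cvg; apply: filterS Fl_itv => t [tm tp].
have [[_ _ gp] _ _ _] := sol tm tp.
by rewrite lnK// posrE gp.
Qed.

Lemma limit_metric : exists gT bT : V -> V -> R,
  [/\ metric gT, two_form bT,
      forall X Y, g t X Y @[t --> Fl] --> gT X Y &
      forall X Y, b t X Y @[t --> Fl] --> bT X Y].
Proof.
have gXX X : cvg (g t X X @[t --> Fl]).
  have [->|/gXX_cvg[l _ gl]] := eqVneq X 0; last by apply/cvg_ex; exists l.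
  apply/cvg_ex; exists 0; apply: cvg_near_cst.
  apply: filterS Fl_itv => t [tm tp]; have [gm _ _ _] := sol tm tp.
  by rewrite (scalar_form0 (metric_scalarl gm _)).
have gXY X Y : cvg (g t X Y @[t --> Fl]).
  (* Polarization reduces to the diagonal values. *)
  have : cvg ((2^-1 * (g t (X + Y) (X + Y) - g t X X - g t Y Y)) @[t --> Fl]).
    by apply: is_cvgMr; apply: is_cvgB => //; apply: is_cvgB.
  move=> /cvg_ex[l gl]; apply/cvg_ex; exists l; move: gl; apply: cvg_trans.
  apply: near_eq_cvg; apply: filterS Fl_itv => t [tm tp].
  have [gm _ _ _] := sol tm tp.
  rewrite !(scalar_formD (metric_scalarl gm _), scalar_formD (metric_scalarr gm _)).
  by rewrite (metricC gm Y X); field.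
have bXY X Y : cvg (b t X Y @[t --> Fl]).
  (* The factor g(X,X) + g(Y,Y) in the bound for b' converges by the previous step, so near the end
     it is at most |l| + 1. *)
  pose l := lim (g t X X @[t --> Fl]) + lim (g t Y Y @[t --> Fl]).
  have gl : g t X X + g t Y Y @[t --> Fl] --> l by apply: cvgD; exact: gXX.
  have gle : \forall t \near Fl, g t X X + g t Y Y <= `|l| + 1.
    have ll : l < `|l| + 1 by rewrite ltr_pwDr// ler_norm.
    have := @cvgr_le R R Fl _ (fun t => g t X X + g t Y Y) l gl _ ll.
    exact.
  apply: (@dominated_cvg _ (fun t => be t X Y) ((`|l| + 1) * C0)).
    by rewrite mulr_ge0// addr_ge0.
  near=> t; have [tm tp] : (em < t%:E)%E /\ (t%:E < ep)%E by near: t.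
  have gt : g t X X + g t Y Y <= `|l| + 1 by near: t.
  have [gm _ _ bd] := sol tm tp; split; first exact: bd.
  have [_ bb] := velocity_bound X Y tm tp.
  rewrite (le_trans bb)// -[leRHS]mulrA ler_wpM2r//.
    by rewrite mulr_ge0// addr_ge0// energy_ge0.
  by have := normr_ge0 l; lra.
pose gT X Y : R := lim (g t X Y @[t --> Fl]).
pose bT X Y : R := lim (b t X Y @[t --> Fl]).
have gTc X Y : g t X Y @[t --> Fl] --> gT X Y by exact: gXY.
have bTc X Y : b t X Y @[t --> Fl] --> bT X Y by exact: bXY.
have uniq (u v : R -> R) (l m : R) : (\forall t \near Fl, u t = v t) ->
    u t @[t --> Fl] --> l -> v t @[t --> Fl] --> m -> l = m.
  move=> uv ul vm; apply: (@cvg_unique _ (@Rhausdorff R) _ _ _ _ ul).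
  by apply: cvg_trans vm; apply: near_eq_cvg; apply: filterS uv.
have near_sol : \forall t \near Fl, metric (g t) /\ two_form (b t).
  by apply: filterS Fl_itv => t [tm tp]; have [] := sol tm tp.
have gTC X Y : gT X Y = gT Y X.
  apply: (uniq _ _ _ _ _ (gTc X Y) (gTc Y X)); apply: filterS near_sol => t [gm _].
  exact: metricC.
have gTl Y : scalar (fun X => gT X Y).
  move=> a u v.
  have c : a * g t u Y + g t v Y @[t --> Fl] --> a * gT u Y + gT v Y.
    by apply: cvgD; [apply: cvgMr|]; exact: gTc.
  apply: (uniq _ _ _ _ _ (gTc _ _) c).
  by apply: filterS near_sol => t [gm _]; rewrite (metric_scalarl gm).
have gTr X : scalar (gT X).
  by move=> a u v; rewrite !(gTC X) gTl.
have bTl Y : scalar (fun X => bT X Y).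
  move=> a u v.
  have c : a * b t u Y + b t v Y @[t --> Fl] --> a * bT u Y + bT v Y.
    by apply: cvgD; [apply: cvgMr|]; exact: bTc.
  apply: (uniq _ _ _ _ _ (bTc _ _) c).
  by apply: filterS near_sol => t [_ bf]; rewrite (two_form_scalarl _ bf).
have bTr X : scalar (bT X).
  move=> a u v.
  have c : a * b t X u + b t X v @[t --> Fl] --> a * bT X u + bT X v.
    by apply: cvgD; [apply: cvgMr|]; exact: bTc.
  apply: (uniq _ _ _ _ _ (bTc _ _) c).
  by apply: filterS near_sol => t [_ bf]; rewrite (two_form_scalarr _ bf).
exists gT, bT; split => //.
- split=> //.
  move=> X X0; have [l l0 gl] := gXX_cvg X0.
  by rewrite (uniq _ _ _ _ _ (gTc X X) gl)//; exact: nearW.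
- split; first by split.
  move=> X; apply: (uniq _ (fun=> 0) _ _ _ (bTc X X)); last exact: cvg_cst.
  by apply: filterS near_sol => t [_ [_ ->]].
Unshelve. all: by end_near. Qed.

End along_filter.
End limits.

(** * The flow as an ordinary differential equation *)

Section coordinates.
Context {R : realType} {V : vectType R} (br : V -> V -> V).
Context (H0 : V -> V -> V -> R) (f : (\dim {:V}).-tuple V).
Hypothesis hbr : lie_bracket br.
Hypothesis H0f : three_form H0.
Hypothesis fb : basis_of fullv f.
Local Notation n := (\dim {:V}).
Local Notation state := (bool * ('I_n * 'I_n) -> R).

(* A state lists the components of a metric and of a 2-form in the basis f;
   reading it symmetrizes the former and antisymmetrizes the latter. *)
Definition state_metric (x : state) (X Y : V) : R :=
  \sum_(i < n) \sum_(j < n)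
    (2^-1 * (x (true, (i, j)) + x (true, (j, i)))) *
    (coord f i X * coord f j Y).

Definition state_form (x : state) (X Y : V) : R :=
  \sum_(i < n) \sum_(j < n)
    (2^-1 * (x (false, (i, j)) + -1 * x (false, (j, i)))) *
    (coord f i X * coord f j Y).

Definition state_of (g b : V -> V -> R) : state := fun k =>
  if k.1 then g f`_k.2.1 f`_k.2.2 else b f`_k.2.1 f`_k.2.2.

Definition state_inv (x : state) (i j : 'I_n) : R :=
  inv_entry (gram (state_metric x) f) i j.

(** Built from the formulas in the basis f, hence defined at every state, degenerate ones included,
    as Picard's theorem requires of a field. *)
Definition state_velocity (x : state) (k : bool * ('I_n * 'I_n)) : R :=
  let X := f`_k.2.1 in let Y := f`_k.2.2 in
  let H := flux br H0 (state_form x) in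
  if k.1 then - 2 * basis_Ric br f (state_metric x) (state_inv x) X Y
              + 2^-1 * basis_sqform f (state_inv x) H X Y
  else - 1 * basis_codiff3 br f (state_metric x) (state_inv x) H X Y.

Lemma bilinear_coord (phi : V -> V -> R) X Y :
  (forall Y, scalar (fun X => phi X Y)) -> (forall X, scalar (phi X)) ->
  phi X Y = \sum_(i < n) \sum_(j < n)
    phi f`_i f`_j * (coord f i X * coord f j Y).
Proof.
move=> pl pr; rewrite {1}(coord_basis fb (memvf X)) (scalar_form_sum (pl _)).
apply: eq_bigr => i _.
rewrite {1}(coord_basis fb (memvf Y)) (scalar_form_sum (pr _)) mulr_sumr.
by apply: eq_bigr => j _; ring.
Qed.

Lemma state_metric_of g b : metric g -> state_metric (state_of g b) = g.
Proof.
move=> gm; apply/funext => X; apply/funext => Y.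
rewrite [RHS](bilinear_coord _ _ (metric_scalarl gm) (metric_scalarr gm)).
apply: eq_bigr => i _; apply: eq_bigr => j _; congr (_ * _).
by rewrite /state_of/= [g f`_j f`_i](metricC gm); field.
Qed.

Lemma state_form_of g b : two_form b -> state_form (state_of g b) = b.
Proof.
move=> bf; apply/funext => X; apply/funext => Y.
rewrite [RHS](bilinear_coord _ _ (fun Y => two_form_scalarl Y bf)
  (fun X => two_form_scalarr X bf)).
apply: eq_bigr => i _; apply: eq_bigr => j _; congr (_ * _).
by rewrite /state_of/= [b f`_j f`_i](two_formC bf); field.
Qed.

Lemma state_metric_bilinear x :
  [/\ forall Y, scalar (fun X => state_metric x X Y),
      forall X, scalar (state_metric x X) &
      forall X Y, state_metric x X Y = state_metric x Y X].
Proof.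
have sl Y : scalar (fun X => state_metric x X Y).
  move=> a u v; rewrite /state_metric mulr_sumr -big_split; apply: eq_bigr => i _.
  rewrite mulr_sumr -big_split; apply: eq_bigr => j _ /=.
  by rewrite linearP/=; ring.
have sC X Y : state_metric x X Y = state_metric x Y X.
  rewrite /state_metric exchange_big; apply: eq_bigr => i _.
  by apply: eq_bigr => j _; ring.
by split=> // X a u v; rewrite !(sC X) sl.
Qed.

Lemma state_form_two_form x : two_form (state_form x).
Proof.
have sl Y : scalar (fun X => state_form x X Y).
  move=> a u v; rewrite /state_form mulr_sumr -big_split; apply: eq_bigr => i _.
  rewrite mulr_sumr -big_split; apply: eq_bigr => j _ /=.
  by rewrite linearP/=; ring.
have sC X Y : state_form x X Y = - state_form x Y X.
  rewrite /state_form exchange_big -sumrN; apply: eq_bigr => i _.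
  by rewrite -sumrN; apply: eq_bigr => j _; ring.
have sr X : scalar (state_form x X).
  by move=> a u v; rewrite !(sC X) sl; ring.
by split=> [|X]; [split|have := sC X X; lra].
Qed.

Lemma state_velocityE x : metric (state_metric x) ->
  state_velocity x = fun k => let X := f`_k.2.1 in let Y := f`_k.2.2 in
  let H := flux br H0 (state_form x) in
  if k.1 then - 2 * Ric br (state_metric x) X Y
              + 2^-1 * sqform (state_metric x) H X Y
  else - codiff3 br (state_metric x) H X Y.
Proof.
move=> gm; apply/funext => -[s [i j]]; rewrite /state_velocity.
have Hf := flux_three_form hbr H0f (state_form_two_form x).
have -> : state_inv x = fun a b => invmx (gram (state_metric x) f) a b.
  apply/funext => a; apply/funext => c; rewrite /state_inv inv_entryE//.
  exact: (gram_unit gm (onframeP gm) fb).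
rewrite (basis_RicE hbr fb gm) (basis_sqformE fb gm Hf).
by rewrite (basis_codiff3E hbr fb gm Hf); case: s => //=; rewrite mulN1r.
Qed.

(** * Local Lipschitz continuity of the flow field *)

Section smoothness.
Context (p : state).
Hypothesis pm : metric (state_metric p).
Let C := loc_lip p.

Let Cc k : C (fun=> k) := loc_lip_cst p k.
Let Ca u v : C u -> C v -> C (fun x => u x + v x) := @loc_lip_add _ _ p u v.
Let Cm u v : C u -> C v -> C (fun x => u x * v x) := @loc_lip_mul _ _ p u v.
Let Cs (J : Type) (r : seq J) (F : state -> J -> R) :
  (forall j, C (F^~ j)) -> C (fun x => \sum_(j <- r) F x j) :=
  @closure_sum _ _ C Cc Ca J r F.

Let Cg X Y : C (fun x => state_metric x X Y).
Proof.
apply: Cs => i; apply: Cs => j; apply: (Cm _ (Cc _)); apply: (Cm (Cc _)).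
by apply: Ca; exact: loc_lip_coord.
Qed.

Let Cb X Y : C (fun x => state_form x X Y).
Proof.
apply: Cs => i; apply: Cs => j; apply: (Cm _ (Cc _)); apply: (Cm (Cc _)).
by apply: Ca; [|apply: (Cm (Cc _))]; exact: loc_lip_coord.
Qed.

Let CP i j : C (fun x => state_inv x i j).
Proof.
have Ce k l : C (fun x => gram (state_metric x) f k l).
  by under eq_fun do rewrite mxE; exact: Cg.
apply: Cm; last exact: (closure_adj Cc Ca Cm).
apply: loc_lip_inv; last exact: (closure_det Cc Ca Cm).
by have := gram_unit pm (onframeP pm) fb; rewrite unitmxE unitfE.
Qed.

Let CN u : C u -> C (fun x => - u x).
Proof. by move=> Cu; under eq_fun do rewrite -mulN1r; exact: Cm. Qed.

Let CH X Y Z : C (fun x => flux br H0 (state_form x) X Y Z).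
Proof.
apply: Ca; first exact: Cc.
apply: Ca; last by apply: CN; exact: Cb.
by apply: Ca; [apply: CN|]; exact: Cb.
Qed.

Let Cctr (F : state -> 'I_n -> 'I_n -> R) :
  (forall i j, C (fun x => F x i j)) -> C (fun x => contract (state_inv x) (F x)).
Proof. by move=> CF; apply: Cs => i; apply: Cs => j; exact: Cm. Qed.

(** The field is composed of coordinates by sums, products and a single inversion, that of the Gram
    determinant, which is nonzero at a metric. *)
Lemma state_velocity_loc_lip k : loc_lip p (state_velocity^~ k).
Proof.
case: k => [[] [i j]]; rewrite /state_velocity /=.
- apply: Ca; apply: (Cm (Cc _)).
  + apply: Ca; first apply: Ca; first apply: Ca.
    * by apply: (Cm (Cc _)); apply: Cctr => a c; exact: Cg.
    * exact: Cc.
    * apply: (Cm (Cc _)); apply: Cctr => a c; apply: Cctr => d e.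
      by apply: Cm; exact: Cg.
    * apply: CN; apply: (Cm (Cc _)); apply: Cctr => a c; apply: (Cm (Cc _)).
      by apply: Ca; exact: Cg.
  + by apply: Cctr => a c; apply: Cctr => d e; apply: Cm; exact: CH.
- apply: (Cm (Cc _)); apply: Ca; first apply: Ca.
  + by apply: Cctr => a c; apply: (Cm (Cc _)); exact: CH.
  + apply: CN; apply: (Cm (Cc _)); apply: Cctr => a c; apply: Cctr => d e.
    by apply: Cm; [exact: Cg|exact: CH].
  + apply: (Cm (Cc _)); apply: Cctr => a c; apply: Cctr => d e.
    by apply: Cm; [exact: Cg|exact: CH].
Qed.

End smoothness.

(** In a gT-orthonormal basis gT is the identity. Changing each entry by at most r lowers the
    quadratic form by at most n r |c|^2, because |c_i c_j| <= (c_i^2 + c_j^2)/2; the choice r =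
    1/(n+1) leaves r |c|^2. *)
Lemma state_metric_near gT bT (x : state) : metric gT ->
  Defs.orthonormal gT f ->
  (forall k, `|x k - state_of gT bT k| <= n.+1%:R^-1) ->
  metric (state_metric x).
Proof.
move=> gm fo xp; have [sl sr sC] := state_metric_bilinear x.
split=> // X X0.
pose c (i : 'I_n) := coord f i X; pose r : R := n.+1%:R^-1.
have r0 : 0 < r by rewrite invr_gt0 ltr0n.
have c0 : 0 < \sum_(i < n) c i ^+ 2.
  rewrite lt_neqAle sumr_ge0 ?andbT => [|i _]; last exact: sqr_ge0.
  apply/eqP => /esym/eqP; rewrite psumr_eq0 => [|i _]; last exact: sqr_ge0.
  move=> /allP ci; move: X0; rewrite (coord_basis fb (memvf X)) big1 ?eqxx// => i _.
  have := ci i (mem_index_enum i); rewrite sqrf_eq0 => /eqP.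
  by rewrite /c => ->; rewrite scale0r.
have xe (i j : 'I_n) :
    `|2^-1 * (x (true, (i, j)) + x (true, (j, i))) - (i == j)%:R| <= r.
  have := xp (true, (i, j)); have := xp (true, (j, i)).
  rewrite /state_of/= !fo [j == i]eq_sym -/r !ler_norml.
  by move=> /andP[? ?] /andP[? ?]; apply/andP; split; lra.
have sE : \sum_(i < n) c i ^+ 2 =
    \sum_(i < n) \sum_(j < n) (i == j)%:R * (c i * c j).
  apply: eq_bigr => i _; rewrite (bigD1 i)//= eqxx mul1r big1 ?addr0//.
  by move=> j /negPf ji; rewrite eq_sym ji mul0r.
have nE : n%:R * (\sum_(i < n) c i ^+ 2) =
    \sum_(i < n) \sum_(j < n) 2^-1 * (c i ^+ 2 + c j ^+ 2).
  have -> : \sum_(i < n) \sum_(j < n) 2^-1 * (c i ^+ 2 + c j ^+ 2) =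
      2^-1 * (\sum_(i < n) \sum_(j < n) c i ^+ 2) +
      2^-1 * (\sum_(i < n) \sum_(j < n) c j ^+ 2).
    rewrite !mulr_sumr -big_split; apply: eq_bigr => i _ /=.
    by rewrite !mulr_sumr -big_split; apply: eq_bigr => j _ /=; rewrite mulrDr.
  rewrite [X in _ + _ * X]exchange_big/=.
  have -> : \sum_(i < n) \sum_(j < n) c i ^+ 2 = n%:R * \sum_(i < n) c i ^+ 2.
    rewrite mulr_sumr; apply: eq_bigr => i _.
    by rewrite sumr_const card_ord mulr_natl.
  by field.
have lb : (1 - n%:R * r) * (\sum_(i < n) c i ^+ 2) <= state_metric x X X.
  rewrite mulrBl mul1r {1}sE [n%:R * r]mulrC -mulrA nE mulr_sumr -sumrB.
  apply: ler_sum => i _; rewrite mulr_sumr -sumrB; apply: ler_sum => j _.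
  have := xe i j; rewrite -/(c i) -/(c j) ler_norml.
  set s := 2^-1 * (x _ + x _); set k := (_ == _)%:R; move=> /andP[h1 h2].
  have h3 : 0 <= (c i - c j) ^+ 2 := sqr_ge0 _.
  have h4 : 0 <= (c i + c j) ^+ 2 := sqr_ge0 _.
  have [cc|cc] := leP 0 (c i * c j); nra.
apply: lt_le_trans lb; apply: mulr_gt0 => //.
have -> : 1 - n%:R * r = r.
  have : n.+1%:R * r = 1 by rewrite mulfV// pnatr_eq0.
  by rewrite -natr1 mulrDl mul1r; lra.
exact: r0.
Qed.

End coordinates.

(** * Bilinearity and symmetries of the velocities *)

Section tensor_symmetries.
Context {R : realType} {V : vectType R} (br : V -> V -> V).
Context (g : V -> V -> R) (H : V -> V -> V -> R).
Hypothesis hbr : lie_bracket br.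
Hypothesis gm : metric g.
Hypothesis Hf : three_form H.
Local Notation n := (\dim {:V}).
Let e := onframe g.
Let eb : basis_of fullv e := orthonormal_basis gm (onframeP gm).
Let g1 := gam_scalar1 hbr gm.
Let g2 := gam_scalar2 hbr gm.

Lemma Ric_scalarl Y : scalar (fun X => Ric br g X Y).
Proof.
under eq_fun do rewrite (basis_RicE hbr eb gm) /basis_Ric -!mulNr.
apply: scalar_add; first apply: scalar_add; first apply: scalar_add;
  apply: scalar_mull; try apply: scalar_contract => a b.
- exact: g1.
- exact: killing_scalarl.
- by apply: scalar_contract => c d; apply: scalar_mulr; exact: metric_scalarr.
- apply: scalar_mull; apply: scalar_add; first exact: g2.
  exact: metric_scalarr.
Qed.

Lemma Ric_scalarr X : scalar (Ric br g X).
Proof. by move=> a u v; rewrite !(RicC hbr gm X) Ric_scalarl. Qed.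

Lemma sqformC X Y : sqform g H X Y = sqform g H Y X.
Proof. by apply: eq_bigr => i _; apply: eq_bigr => j _; rewrite mulrC. Qed.

Lemma sqform_scalarl Y : scalar (fun X => sqform g H X Y).
Proof.
under eq_fun do rewrite (basis_sqformE eb gm Hf).
apply: scalar_contract => a b; apply: scalar_contract => c d.
by apply: scalar_mulr; exact: three_form_scalar1.
Qed.

Lemma sqform_scalarr X : scalar (sqform g H X).
Proof. by move=> a u v; rewrite !(sqformC X) sqform_scalarl. Qed.

Lemma codiff3C X Y : codiff3 br g H X Y = - codiff3 br g H Y X.
Proof.
rewrite !(codiff3E hbr gm _ _ eb Hf).
under eq_bigr do rewrite (three_formA23 Hf) mulrN.
by rewrite sumrN; ring.
Qed.

Lemma codiff3_scalarl Y : scalar (fun X => codiff3 br g H X Y).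
Proof.
under eq_fun do rewrite (basis_codiff3E hbr eb gm Hf) /basis_codiff3 -!mulNr.
apply: scalar_add; first apply: scalar_add.
- by apply: scalar_contract => a b; apply: scalar_mull; exact: three_form_scalar2.
- apply: scalar_mull; apply: scalar_contract => a b.
  by apply: scalar_contract => c d; apply: scalar_mulr; exact: metric_scalarr.
- apply: scalar_mull; apply: scalar_contract => a b.
  by apply: scalar_contract => c d; apply: scalar_mull; exact: three_form_scalar3.
Qed.

Lemma codiff3_scalarr X : scalar (codiff3 br g H X).
Proof. by move=> a u v; rewrite !(codiff3C X) codiff3_scalarl; ring. Qed.

End tensor_symmetries.

(** * Passage between solutions of the flow and curves of states *)

Section state_flow.
Context {R : realType} {V : vectType R} (br : V -> V -> V).
Context (H0 : V -> V -> V -> R) (f : (\dim {:V}).-tuple V).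
Hypothesis hbr : lie_bracket br.
Hypothesis H0f : three_form H0.
Hypothesis fb : basis_of fullv f.
Local Notation n := (\dim {:V}).
Local Notation state := (bool * ('I_n * 'I_n) -> R).

(** The field is symmetric in the metric components and antisymmetric in the form components, so the
    symmetrizations in [state_metric] and [state_form] leave it unchanged, whatever the symmetry of
    the curve y. *)
Lemma state_flow_solution (em ep : \bar R) (y : R -> state) :
  (forall t, (em < t%:E)%E -> (t%:E < ep)%E -> metric (state_metric f (y t))) ->
  (forall t, (em < t%:E)%E -> (t%:E < ep)%E -> forall k,
     is_derive t 1 (y^~ k) (state_velocity br H0 f (y t) k)) ->
  gRF_solution br H0 em ep (fun t => state_metric f (y t))
    (fun t => state_form f (y t)).
Proof.
move=> ym yd t tm tp; have gm := ym t tm tp.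
have bf := state_form_two_form f (y t).
have Hf := flux_three_form hbr H0f bf.
have yE := state_velocityE hbr H0f fb gm.
split=> // X Y.
- set phi := fun X Y => - 2 * Ric br (state_metric f (y t)) X Y +
    2^-1 * sqform (state_metric f (y t)) (flux br H0 (state_form f (y t))) X Y.
  have phil Z : scalar (fun W => phi W Z).
    by apply: scalar_add; apply: scalar_mull;
      [exact: Ric_scalarl|exact: sqform_scalarl].
  have phir Z : scalar (phi Z).
    by apply: scalar_add; apply: scalar_mull;
      [exact: Ric_scalarr|exact: sqform_scalarr].
  have phiC Z W : phi Z W = phi W Z by rewrite /phi (RicC hbr gm) sqformC.
  rewrite -/(phi X Y) (bilinear_coord fb X Y phil phir).
  apply: is_derive_bigsum => i; apply: is_derive_bigsum => j.
  have d1 := yd t tm tp (true, (i, j)); have d2 := yd t tm tp (true, (j, i)).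
  have D := is_derive_mul (is_derive_scale 2^-1 (is_derive_add d1 d2))
    (is_derive_const t (coord f i X * coord f j Y)).
  have <- : 2^-1 * (state_velocity br H0 f (y t) (true, (i, j)) +
      state_velocity br H0 f (y t) (true, (j, i))) *
      (coord f i X * coord f j Y) + 2^-1 * (y t (true, (i, j)) +
      y t (true, (j, i))) * 0 = phi f`_i f`_j * (coord f i X * coord f j Y).
    rewrite !yE /= -/(phi f`_i f`_j) -/(phi f`_j f`_i) [phi f`_j _]phiC.
    by field.
  exact: D.
- set phi := fun X Y =>
    - codiff3 br (state_metric f (y t)) (flux br H0 (state_form f (y t))) X Y.
  have phil Z : scalar (fun W => phi W Z).
    by move=> a u v; rewrite /phi (codiff3_scalarl hbr gm Hf); ring.
  have phir Z : scalar (phi Z).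
    by move=> a u v; rewrite /phi (codiff3_scalarr hbr gm Hf); ring.
  have phiC Z W : phi Z W = - phi W Z by rewrite /phi (codiff3C hbr gm Hf).
  rewrite -/(phi X Y) (bilinear_coord fb X Y phil phir).
  apply: is_derive_bigsum => i; apply: is_derive_bigsum => j.
  have d1 := yd t tm tp (false, (i, j)); have d2 := yd t tm tp (false, (j, i)).
  have D := is_derive_mul (is_derive_scale 2^-1
      (is_derive_add d1 (is_derive_scale (-1) d2)))
    (is_derive_const t (coord f i X * coord f j Y)).
  have <- : 2^-1 * (state_velocity br H0 f (y t) (false, (i, j)) +
      -1 * state_velocity br H0 f (y t) (false, (j, i))) *
      (coord f i X * coord f j Y) + 2^-1 * (y t (false, (i, j)) +
      -1 * y t (false, (j, i))) * 0 = phi f`_i f`_j * (coord f i X * coord f j Y).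
    rewrite !yE /= -/(phi f`_i f`_j) -/(phi f`_j f`_i) [phi f`_j _]phiC.
    by field.
  exact: D.
Qed.

Lemma solution_state_flow (em ep : \bar R) (g b : R -> V -> V -> R) t k :
  gRF_solution br H0 em ep g b -> (em < t%:E)%E -> (t%:E < ep)%E ->
  is_derive t 1 (fun s => state_of f (g s) (b s) k)
    (state_velocity br H0 f (state_of f (g t) (b t)) k).
Proof.
move=> sol tm tp; have [gm bf gd bd] := sol t tm tp.
rewrite state_velocityE ?(state_metric_of fb)// (state_form_of fb)//.
by case: k => [[] [i j]] /=; [exact: gd|exact: bd].
Qed.

End state_flow.

Theorem theorem6p2 (R : realType) (V : vectType R) (br : V -> V -> V)
    (H0 : V -> V -> V -> R) (em ep : \bar R) (g b : R -> V -> V -> R) :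
  lie_bracket br ->
  three_form H0 ->
  (forall W X Y Z, d3 br H0 W X Y Z = 0) ->
  (em < 0)%E -> (0 < ep)%E ->
  (forall X Y, b 0 X Y = 0) ->
  gRF_maximal_solution br H0 em ep g b ->
  let S := fun t : R => gen_scalar_curvature br (g t) (flux br H0 (b t)) in
  ((ep < +oo)%E -> S t @[t --> (fine ep)^'-] --> +oo) /\
  ((-oo < em)%E -> S t @[t --> (fine em)^'+] --> -oo).
Proof.
move=> hbr H0f dH0 em0 ep0 _ [sol maxi] S.
have Sd t : (em < t%:E)%E -> (t%:E < ep)%E ->
    is_derive t 1 S (energy br H0 g b t) /\ 0 <= energy br H0 g b t.
  move=> tm tp; split; last exact: energy_ge0.
  exact: (gen_scalar_evolution hbr H0f dH0 sol tm tp).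
have emep : (em < ep)%E := lt_trans em0 ep0.
split.
- case: ep ep0 emep sol maxi Sd => [T|//|//] ep0 emep sol maxi Sd _ /=.
  have [//|[M SM]] := @bounded_or_cvgy R S (energy br H0 g b) em T emep
    (fun t tm tT => Sd t tm tT).
  (* With S bounded above near T, a continuation past T is built against maximality. *)
  exfalso.
  have near_itv : \forall t \near T^'-, (em < t%:E)%E /\ (t%:E < T%:E)%E.
    near=> t; split; last by rewrite lte_fin; near: t; exact: nbhs_left_lt.
    near: t; case: em em0 emep {sol maxi Sd SM} => [a||//] //.
    + rewrite !lte_fin => _ aT; near=> t; rewrite lte_fin; near: t.
      exact: nbhs_left_gt.
    + by move=> _ _; apply: nearW => t; rewrite ltNyr.
  have [|gT [bT [gTm bTf gTc bTc]]] := @limit_metric _ _ _ _ _ _ _ _ sol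
      T^'- _ near_itv.
    move=> h dh C C0 hh; apply: (@cvg_at_left_dominated R S
      (energy br H0 g b) h dh T C M C0).
    near=> t.
    have [h1 h2] : is_derive (t : R) 1 h (dh t) /\
      `|dh t| <= C * (1 + energy br H0 g b t) by near: t; exact: hh.
    have [tm tp] : (em < t%:E)%E /\ (t%:E < T%:E)%E by near: t.
    by split => //; [have [] := Sd t tm tp|near: t].
  (* An orthonormal basis for the limit metric, as [state_metric_near] requires; it also dictates
     the radius 1/(n+1) passed to the extension below. *)
  pose f := onframe gT; have fo : Defs.orthonormal gT f := onframeP gTm.
  have fb : basis_of fullv f := orthonormal_basis gTm fo.
  pose p := state_of f gT bT.
  have [||||d [y [d0 yx yp yd]]] := @ode_extend_right R _
      (state_velocity br H0 f) p em T (\dim {:V}).+1%:R^-1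
      (fun t => state_of f (g t) (b t)) emep.
  + by rewrite invr_gt0 ltr0n.
  + by move=> k; apply: state_velocity_loc_lip => //; rewrite state_metric_of.
  + by move=> t tm tT k; exact: (solution_state_flow hbr H0f fb k sol tm).
  + by move=> [[] [i j]]; [exact: gTc|exact: bTc].
  (* Before T the state is that of the given solution; from T on it stays within the radius of the
     limit state. *)
  have ym t : (em < t%:E)%E -> (t%:E < (T + d)%:E)%E ->
      metric (state_metric f (y t)).
    rewrite lte_fin => tm td; have [tT|Tt] := ltP t T.
      by rewrite yx// state_metric_of//; have [] := sol t tm tT.
    exact: (state_metric_near fb gTm fo (yp t Tt td)).
  have sol' := state_flow_solution hbr H0f fb ym yd.
  (* Maximality, with the left end unchanged, would give T + d = T. *)
  have [||_ /eqP] := maxi em (T + d)%:E _ _ (lexx _) _ sol'.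
  + by rewrite lee_fin lerDl ltW.
  + move=> t tm tT X Y; have [gm bf _ _] := sol t tm tT.
    by rewrite yx// state_metric_of// state_form_of.
  + by rewrite eqe -subr_eq0 addrAC subrr add0r gt_eqF.
(* The other end is symmetric, with S bounded below and the solution continued to the left. *)
- case: em em0 emep sol maxi Sd => [T|//|//] em0 emep sol maxi Sd _ /=.
  have [//|[M SM]] := @bounded_or_cvgNy R S (energy br H0 g b) ep T emep
    (fun t tp tT => Sd t tT tp).
  exfalso.
  have near_itv : \forall t \near T^'+, (T%:E < t%:E)%E /\ (t%:E < ep)%E.
    near=> t; split; first by rewrite lte_fin; near: t; exact: nbhs_right_gt.
    near: t; case: ep ep0 emep {sol maxi Sd SM} => [a||//] //.
    + rewrite !lte_fin => _ aT; near=> t; rewrite lte_fin; near: t.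
      exact: nbhs_right_lt.
    + by move=> _ _; apply: nearW => t; rewrite ltry.
  have [|gT [bT [gTm bTf gTc bTc]]] := @limit_metric _ _ _ _ _ _ _ _ sol
      T^'+ _ near_itv.
    move=> h dh C C0 hh; apply: (@cvg_at_right_dominated R S
      (energy br H0 g b) h dh T C M C0).
    near=> t.
    have [h1 h2] : is_derive (t : R) 1 h (dh t) /\
      `|dh t| <= C * (1 + energy br H0 g b t) by near: t; exact: hh.
    have [tm tp] : (T%:E < t%:E)%E /\ (t%:E < ep)%E by near: t.
    by split => //; [have [] := Sd t tm tp|near: t].
  pose f := onframe gT; have fo : Defs.orthonormal gT f := onframeP gTm.
  have fb : basis_of fullv f := orthonormal_basis gTm fo.
  pose p := state_of f gT bT.
  have [||||d [y [d0 yx yp yd]]] := @ode_extend_left R _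
      (state_velocity br H0 f) p ep T (\dim {:V}).+1%:R^-1
      (fun t => state_of f (g t) (b t)) emep.
  + by rewrite invr_gt0 ltr0n.
  + by move=> k; apply: state_velocity_loc_lip => //; rewrite state_metric_of.
  + by move=> t tp tT k; exact: (solution_state_flow hbr H0f fb k sol tT tp).
  + by move=> [[] [i j]]; [exact: gTc|exact: bTc].
  have ym t : ((T - d)%:E < t%:E)%E -> (t%:E < ep)%E ->
      metric (state_metric f (y t)).
    rewrite lte_fin => td tp; have [Tt|tT] := ltP T t.
      by rewrite yx// state_metric_of//; have [] := sol t Tt tp.
    exact: (state_metric_near fb gTm fo (yp t tT td)).
  have sol' := state_flow_solution hbr H0f fb ym (fun t td tp => yd t tp td).
  have [||/eqP +] := maxi (T - d)%:E ep _ _ _ (lexx _) sol'.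
  + by rewrite lee_fin lerBlDr lerDl ltW.
  + move=> t Tt tp X Y; have [gm bf _ _] := sol t Tt tp.
    by rewrite yx// state_metric_of// state_form_of.
  + by rewrite eqe -subr_eq0 addrAC subrr add0r oppr_eq0 gt_eqF.
Unshelve. all: by end_near. Qed.
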